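(* Let $\tau>0$, let $f\in L^\infty(\mathbb T^2)$ have mean zero, and let $(\omega^n)_{n\ge0}$ be the solution of $$\frac{\omega^{n+1}-\omega^n}{\tau}+\Pi_N(u^n\cdot\nabla\omega^n)=\Delta\omega^{n+1}\ \text{ on }\mathbb T^2,\quad n\ge0,\qquad \omega^0=\Pi_Nf,$$ where $u^n=\nabla^\perp\Delta^{-1}\omega^n$. Then there is $\tau_0=\tau_0(\|f\|_\infty)>0$ such that for all $0<\tau<\tau_0$ and $N\ge2$, $$\sup_{n\ge0}\|\omega^n\|_\infty\le\|\omega^0\|_\infty+\alpha_1\cdot N^{-\frac12}+\alpha_2\,\tau^{0.4},$$ where $\alpha_1,\alpha_2>0$ depend only on $\|f\|_\infty$.
   Context: $\mathbb T^2=[0,1)^2$ periodic; functions are real-valued; $\omega^n$ has mean zero. $\Pi_N$ is the Fourier projection onto modes $e^{2\pi ik\cdot x}$, $k\in\mathbb Z^2$, with $|k|_\infty=\max(|k_1|,|k_2|)\le N$. $\nabla^\perp=(-\partial_{x_2},\partial_{x_1})$ and $\Delta^{-1}$ is the inverse Laplacian on mean-zero functions. $\|\cdot\|_\infty$ is the $L^\infty(\mathbb T^2)$ norm. *)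

(* Defs.v *)
From HB Require Import structures.
From mathcomp Require Import all_boot all_order all_algebra.
From mathcomp Require Export complex.
From mathcomp Require Import all_classical all_reals all_analysis.

Set Implicit Arguments.
Unset Strict Implicit.
Unset Printing Implicit Defensive.
Import Order.TTheory GRing.Theory Num.Theory.
Import numFieldNormedType.Exports.

Local Open Scope classical_set_scope.
Local Open Scope ring_scope.
Local Open Scope complex_scope.

(* A function on the torus is a function R * R -> R of period 1 in each
   variable; integrals and norms are taken over the cell [0,1)^2. *)
Section Torus.
Context {R : realType}.
Implicit Types (f g w psi : R * R -> R) (k : int * int) (x : R * R).

Definition unit_cell : set (R * R) := `[0, 1[%classic `*` `[0, 1[%classic.

Lemma measurable_unit_cell : measurable unit_cell.
Proof. exact: measurableX. Qed.

Definition torus_measure : set (measurableTypeR R * measurableTypeR R) -> \bar R :=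
  mrestr (lebesgue_measure \x lebesgue_measure)%E measurable_unit_cell.

HB.instance Definition _ := Measure.on torus_measure.

Lemma torus_measure_setT : torus_measure setT = 1%E.
Proof.
rewrite /torus_measure /mrestr setTI product_measure1E//=.
by rewrite !lebesgue_measure_itv /= !lte_fin ltr01 oppr0 adde0 mule1.
Qed.

Definition torus_periodic f := periodic f (1, 0) /\ periodic f (0, 1).

Definition Linfty_norm f : \bar R := 'N[torus_measure]_+oo [EFin \o f].

Definition torus_Linfty f :=
  torus_periodic f /\ (f : measurableTypeR R * measurableTypeR R -> R) \in Lfun torus_measure +oo%E.

Definition mean_zero f := (\int[torus_measure]_x f x)%R = 0.

Definition phase k x : R := 2 * pi * (k.1%:~R * x.1 + k.2%:~R * x.2).

Definition expi_mode k x : R[i] := cos (phase k x) +i* sin (phase k x).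

(* the integral of f x * e^{-2 pi i k.x}, by real and imaginary parts *)
Definition fourier_coef f k : R[i] :=
  (\int[torus_measure]_x (f x * cos (phase k x)))%R
  -i* (\int[torus_measure]_x (f x * sin (phase k x)))%R.

Definition modes (N : nat) : set (int * int) :=
  [set k | Num.max `|k.1| `|k.2| <= N%:Z].

Definition fourier_sum (N : nat) f x : R[i] :=
  \sum_(k \in modes N) (fourier_coef f k * expi_mode k x).

(* fourier_sum is real for real-valued f (Im_fourier_sum), so that taking
   the real part only changes the codomain *)
Definition fourier_proj (N : nat) f x : R := complex.Re (fourier_sum N f x).

Definition d1 f x : R := 'D_(1, 0) f x.
Definition d2 f x : R := 'D_(0, 1) f x.

Definition laplacian f x : R := d1 (d1 f) x + d2 (d2 f) x.

Definition C1 f :=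
  [/\ forall x, differentiable f x, continuous (d1 f) & continuous (d2 f)].

Definition C2 f := [/\ C1 f, C1 (d1 f) & C1 (d2 f)].

Definition torus_C2_mean_zero f := [/\ torus_periodic f, C2 f & mean_zero f].

(* psi = Delta^{-1} w; there is at most one such psi *)
Definition inverse_laplacian w psi :=
  torus_C2_mean_zero psi /\ forall x, laplacian psi x = w x.

Definition grad_perp psi x : R * R := (- d2 psi x, d1 psi x).

Definition advection (u : R * R -> R * R) w x : R :=
  (u x).1 * d1 w x + (u x).2 * d2 w x.

Definition scheme_solution (tau : R) (N : nat) f (w : nat -> R * R -> R) :=
  [/\ forall n, torus_C2_mean_zero (w n),
      w 0%N = fourier_proj N f &
      exists psi : nat -> R * R -> R, forall n,
        inverse_laplacian (w n) (psi n) /\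
        forall x, (w n.+1 x - w n x) / tau
                  + fourier_proj N (advection (grad_perp (psi n)) (w n)) x
                  = laplacian (w n.+1) x].

Lemma finite_modes N : finite_set (modes N).
Proof.
pose h (p : nat * nat) : int * int := (p.1%:Z - N%:Z, p.2%:Z - N%:Z).
apply: (@sub_finite_set _ _ (h @` (`I_(N.*2.+1) `*` `I_(N.*2.+1)))); last first.
  by apply: finite_image; apply: finite_setX; exact: finite_II.
move=> [a b]; rewrite /modes /= ge_max => /andP[].
rewrite !ler_norml => /andP[a1 a2] /andP[b1 b2].
have H (c : int) : - N%:Z <= c -> c <= N%:Z ->
    (absz (c + N%:Z)%R < N.*2.+1)%N /\ (absz (c + N%:Z)%R)%:Z - N%:Z = c.
  move=> c1 c2; have c0 : 0 <= c + N%:Z by rewrite -lerBlDr sub0r.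
  split; last by rewrite gez0_abs// addrK.
  rewrite ltnS -lez_nat gez0_abs// -addnn PoszD.
  by rewrite lerD2r.
have [ha1 ha2] := H _ a1 a2; have [hb1 hb2] := H _ b1 b2.
by exists (absz (a + N%:Z)%R, absz (b + N%:Z)%R); [split|rewrite /h /= ha2 hb2].
Qed.

Lemma phaseN k x : phase (- k) x = - phase k x.
Proof. by rewrite /phase /= !rmorphN /= !mulNr -opprD mulrN. Qed.

Lemma expi_modeN k x : expi_mode (- k) x = ((expi_mode k x)^*)%C.
Proof. by rewrite /expi_mode phaseN cosN sinN. Qed.

Lemma torus_RintegralN g :
  (\int[torus_measure]_x (- g x))%R = - (\int[torus_measure]_x g x)%R.
Proof.
rewrite /Rintegral integralE [in RHS]integralE.
rewrite -[fun x => (- g x)%:E]/(\- (EFin \o g))%E funeposN funenegN.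
set a := integral _ _ _; set b := integral _ _ _.
by case: b a => [b||] [a||] //=; rewrite ?oppr0// opprB.
Qed.

Lemma fourier_coefN f k : fourier_coef f (- k) = ((fourier_coef f k)^*)%C.
Proof.
rewrite /fourier_coef /=; congr (_ +i* _).
  by congr Rintegral; apply/funext => x; rewrite phaseN cosN.
rewrite opprK -torus_RintegralN.
by congr Rintegral; apply/funext => x; rewrite phaseN sinN mulrN opprK.
Qed.

Lemma fourier_sum_conj N f x : ((fourier_sum N f x)^*)%C = fourier_sum N f x.
Proof.
have bijN : set_bij (modes N) (modes N) (fun k => - k).
  split=> [k|k l _ _|k kN]; first by rewrite /modes /= !normrN.
    exact: oppr_inj.
  by exists (- k); rewrite ?opprK// /modes /= !normrN.
rewrite /fourier_sum [RHS](reindex_fsbig (fun k => - k) (modes N))//.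
rewrite !fsbig_finite; try exact: finite_modes.
rewrite rmorph_sum; apply: eq_bigr => k _.
by rewrite fourier_coefN expi_modeN rmorphM.
Qed.

Lemma Im_fourier_sum N f x : complex.Im (fourier_sum N f x) = 0.
Proof.
have := fourier_sum_conj N f x; case: (fourier_sum N f x) => a b /= [bE].
by apply/eqP; rewrite -eqNr bE.
Qed.

End Torus.

(* Main.v *)
(* An explicit step [w - tau (u . grad) w] agrees up to O(tau^2 |u|^2 |D^2 w|) with
   the value of [w] at the point [x - tau u], and the implicit diffusion obeys the
   maximum principle; so, up to the effect of the projection, the supremum can
   only grow by summable errors. Writing [t = n tau], the energy inequality and
   parabolic smoothing bound the Fourier sum of [D^2 w] by t^(-3/2) and the modes
   discarded by the projection by N^(-2) |u| t^(-2), with |u| at most t^(-1/4).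
   Both are summable over t >= t1 = N^(-6/5) + tau^(9/10), with sums of the order
   tau t1^(-1/2) and N^(-2) t1^(-5/4).

   For t <= t1 the solution is compared with the discrete heat flow: the
   difference is the divergence of a Duhamel sum of fluxes, and a barrier argument
   bounds the gradient of such a sum by sqrt t1 times the fluxes. The projection
   of a flux costs a power of log N. This is affordable when N <= tau^(-2).
   Otherwise the unprojected fluxes are used: the discarded modes are so high that
   one step of the resolvent gains N^(-1/2). Their cost is controlled by the
   initial supremum only if that is bounded; if it is large, the first resolvent
   step already brings it down, because [w 0] is the projection of a bounded
   function and a de la Vallee Poussin sum of [f] has the same low modes. *)
From HB Require Import structures.
Require Import Defs.
From mathcomp Require Import all_boot all_order all_algebra.
From mathcomp Require Import all_classical all_reals all_analysis.
From mathcomp Require Import measurable_realfun ess_sup_inf.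
From mathcomp Require Import ring lra zify.

Set Implicit Arguments.
Unset Strict Implicit.
Unset Printing Implicit Defensive.

Import Order.TTheory GRing.Theory Num.Theory.
Import numFieldNormedType.Exports.

Local Open Scope classical_set_scope.
Local Open Scope ring_scope.
Local Open Scope complex_scope.

(** * Finite Fourier sums *)

(** The constant in front of the initial supremum must be 1, while that supremum may itself grow
    like log^2 N, since [w 0] is a truncation of a bounded function. Error constants therefore rest
    on what survives truncation: the energy, the initial velocity and, for large N, the supremum
    after one resolvent step.

    The exponents come from a balance at t1. As t1 >= N^(-6/5), the discarded modes cost at most
    N^(-2) t1^(-5/4) <= N^(-1/2), which is the full rate, so no logarithm may enter there. The early
    phase costs sqrt t1, at most of order N^(-3/5) + tau^(9/20); its surplus over N^(-1/2) +
    tau^(2/5) is a factor N^(-1/10) in one term and tau^(1/20) in the other, and these pay for the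
    powers of log N. The late transport error tau t1^(-1/2) <= tau^(11/20) has room to spare.

    Since tau and N are unrelated, tau^(1/20) beats the powers of log N only when N is at most a
    power of 1/tau; this forces the separate treatment of very large N. *)

Section Boxes.

Definition irange (L : nat) : seq int := [seq i%:Z - L%:Z | i <- iota 0 L.*2.+1].

Definition box (L : nat) : seq (int * int) :=
  [seq (a, b) | a <- irange L, b <- irange L].

Lemma mem_irange L (a : int) : (a \in irange L) = (`|a| <= L%:Z).
Proof.
apply/mapP/idP => [[m]|aL].
  by rewrite mem_iota => /andP[_ mL] ->; lia.
exists (absz (a + L%:Z)); last by lia.
by rewrite mem_iota; lia.
Qed.

Lemma irange_uniq L : uniq (irange L).
Proof. by rewrite map_inj_uniq ?iota_uniq// => i j; lia. Qed.

Lemma size_irange L : size (irange L) = L.*2.+1.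
Proof. by rewrite size_map size_iota. Qed.

Lemma mem_box L k : (k \in box L) = (`|k.1| <= L%:Z) && (`|k.2| <= L%:Z).
Proof.
apply/allpairsP/andP => [ [p]|[k1 k2]].
  by rewrite !mem_irange => -[p1 p2 ->].
by exists k; rewrite !mem_irange; split => //; case: k {k1 k2}.
Qed.

Lemma box_uniq L : uniq (box L).
Proof.
by apply: allpairs_uniq; rewrite ?irange_uniq// => -[a b] [c d].
Qed.

Lemma size_box L : size (box L) = (L.*2.+1 ^ 2)%N.
Proof. by rewrite size_allpairs !size_irange. Qed.

Lemma box0 L : (0, 0) \in box L.
Proof. by rewrite mem_box /= normr0. Qed.

Lemma mem_boxN L k : (- k \in box L) = (k \in box L).
Proof. by rewrite !mem_box /= !normrN. Qed.

Lemma mem_boxD L M k l : k \in box L -> l \in box M -> k + l \in box (L + M).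
Proof. by rewrite !mem_box /=; lia. Qed.

Lemma sub_box L M k : (L <= M)%N -> k \in box L -> k \in box M.
Proof. by rewrite !mem_box; lia. Qed.

Lemma eq_sum_supp (V : nmodType) (I : eqType) (r1 r2 : seq I) (g : I -> V) :
  uniq r1 -> uniq r2 -> (forall k, g k != 0 -> (k \in r1) = (k \in r2)) ->
  \sum_(k <- r1) g k = \sum_(k <- r2) g k.
Proof.
move=> u1 u2 e.
rewrite (bigID (fun k => g k != 0)) [RHS](bigID (fun k => g k != 0)) /=.
rewrite [X in _ + X]big1 ?[X in _ = _ + X]big1; last 2 first.
- by move=> k /negPn/eqP.
- by move=> k /negPn/eqP.
rewrite !addr0 -big_filter -[RHS]big_filter; apply: perm_big; apply: uniq_perm.
- exact: filter_uniq.
- exact: filter_uniq.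
by move=> k; rewrite !mem_filter; case: (boolP (g k != 0)) => //= /e ->.
Qed.

(** Arrays are total functions on the lattice; the support condition is what lets a sum ignore a
    shift of the index or an enlargement of the box. *)
Definition supp (V : nmodType) (L : nat) (g : int * int -> V) :=
  forall k, k \notin box L -> g k = 0.

Lemma supp_neq0 (V : nmodType) L (g : int * int -> V) k :
  supp L g -> g k != 0 -> k \in box L.
Proof. by move=> sg; apply: contraR => /sg ->. Qed.

Lemma sum_box_widen (V : nmodType) (L M : nat) (g : int * int -> V) :
  supp L g -> (L <= M)%N -> \sum_(k <- box M) g k = \sum_(k <- box L) g k.
Proof.
move=> sg LM; apply: eq_sum_supp; rewrite ?box_uniq// => k /(supp_neq0 sg) kL.
by rewrite kL (sub_box LM).
Qed.

Lemma sum_box_opp (V : nmodType) (L : nat) (g : int * int -> V) :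
  \sum_(k <- box L) g (- k) = \sum_(k <- box L) g k.
Proof.
rewrite -(big_map (fun k => - k) xpredT g); apply: perm_big; apply: uniq_perm.
- by rewrite map_inj_uniq ?box_uniq//; exact: oppr_inj.
- exact: box_uniq.
- move=> k; apply/mapP/idP => [ [l lL ->]|kL]; first by rewrite mem_boxN.
  by exists (- k); rewrite ?mem_boxN ?opprK.
Qed.

Lemma sum_box_shift (V : nmodType) (L N M : nat) l (g : int * int -> V) :
  supp N g -> l \in box M -> (N + M <= L)%N ->
  \sum_(k <- box L) g (k - l) = \sum_(k <- box N) g k.
Proof.
move=> sg lM NML.
rewrite -(big_map (fun k => k - l) xpredT g); apply: eq_sum_supp.
- by rewrite map_inj_uniq ?box_uniq//; exact: addIr.
- exact: box_uniq.
- move=> k /(supp_neq0 sg) kN; rewrite kN; apply/mapP; exists (k + l); last by rewrite addrK.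
  by apply: (sub_box NML); exact: mem_boxD.
Qed.

Lemma sum_box_prod (S : pzSemiRingType) (L : nat) (g h : int -> S) :
  \sum_(k <- box L) g k.1 * h k.2 = (\sum_(a <- irange L) g a) * (\sum_(b <- irange L) h b).
Proof.
rewrite big_allpairs_dep /= big_distrl /=; apply: eq_bigr => a _.
by rewrite big_distrr.
Qed.

Lemma sum_modes (V : nmodType) N (g : int * int -> V) :
  \sum_(k \in modes N) g k = \sum_(k <- box N) g k.
Proof.
have -> : modes N = [set` box N].
  by apply/seteqP; split => k; rewrite /modes /= mem_box ge_max.
by rewrite -fsbig_seq// box_uniq.
Qed.

End Boxes.

Section Modulus.
Context {R : realType}.
Implicit Types z w : R[i].

Definition cmod z : R := ComplexField.Normc.normc z.

Lemma cmodM z w : cmod (z * w) = cmod z * cmod w.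
Proof. exact: ComplexField.Normc.normcM. Qed.
Lemma cmodD z w : cmod (z + w) <= cmod z + cmod w.
Proof. by rewrite -lecR rmorphD/=; exact: (@ler_normD _ R[i]). Qed.
Lemma cmodN z : cmod (- z) = cmod z.
Proof. by case: z => a b; rewrite /cmod /= !sqrrN. Qed.
Lemma cmod0 : cmod 0 = 0.
Proof. exact: ComplexField.Normc.normc0. Qed.
Lemma cmod_ge0 z : 0 <= cmod z.
Proof. by case: z => a b; rewrite /cmod /= sqrtr_ge0. Qed.
Lemma cmodJ z : cmod (z^*) = cmod z.
Proof. by case: z => a b; rewrite /cmod /= sqrrN. Qed.
Lemma cmod_sqr z : cmod z ^+ 2 = complex.Re z ^+ 2 + complex.Im z ^+ 2.
Proof. by case: z => a b; rewrite /cmod /= sqr_sqrtr// addr_ge0 ?sqr_ge0. Qed.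
Lemma cmodr (x : R) : cmod x%:C = `|x|.
Proof. by rewrite /cmod /= expr0n /= addr0 sqrtr_sqr. Qed.
Lemma cmodi (x : R) : cmod (0 +i* x) = `|x|.
Proof. by rewrite /cmod /= expr0n /= add0r sqrtr_sqr. Qed.
Lemma normRe_le z : `|complex.Re z| <= cmod z.
Proof.
by rewrite -(@ler_pXn2r _ 2) ?nnegrE ?cmod_ge0// cmod_sqr real_normK ?num_real// lerDl sqr_ge0.
Qed.
Lemma normIm_le z : `|complex.Im z| <= cmod z.
Proof.
by rewrite -(@ler_pXn2r _ 2) ?nnegrE ?cmod_ge0// cmod_sqr real_normK ?num_real// lerDr sqr_ge0.
Qed.
Lemma cmod_sum (I : Type) (r : seq I) (P : pred I) (F : I -> R[i]) :
  cmod (\sum_(i <- r | P i) F i) <= \sum_(i <- r | P i) cmod (F i).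
Proof.
elim/big_ind2: _ => [|x a y b xa yb|//]; first by rewrite cmod0.
by rewrite (le_trans (cmodD _ _))// lerD.
Qed.
Lemma cReM z w : complex.Re (z * w) =
  complex.Re z * complex.Re w - complex.Im z * complex.Im w.
Proof. by case: z w => a b [c d]. Qed.
Lemma cReD z w : complex.Re (z + w) = complex.Re z + complex.Re w.
Proof. by case: z w => a b [c d]. Qed.
Lemma cImD z w : complex.Im (z + w) = complex.Im z + complex.Im w.
Proof. by case: z w => a b [c d]. Qed.
Lemma cRe_sum (I : Type) (r : seq I) (P : pred I) (F : I -> R[i]) :
  complex.Re (\sum_(i <- r | P i) F i) = \sum_(i <- r | P i) complex.Re (F i).
Proof. by elim/big_rec2: _ => [//|i x y _ <-]; rewrite cReD. Qed.
Lemma cIm_sum (I : Type) (r : seq I) (P : pred I) (F : I -> R[i]) :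
  complex.Im (\sum_(i <- r | P i) F i) = \sum_(i <- r | P i) complex.Im (F i).
Proof. by elim/big_rec2: _ => [//|i x y _ <-]; rewrite cImD. Qed.
Lemma cReZ (a : R) z : complex.Re (a%:C * z) = a * complex.Re z.
Proof. by case: z => c d; rewrite /= mul0r subr0. Qed.
Lemma cmod_expi k (x : R * R) : cmod (expi_mode k x) = 1.
Proof. by rewrite /cmod /= cos2Dsin2 sqrtr1. Qed.

End Modulus.

Section DirectionalDerivatives.
Context {R : realType}.
Implicit Types (f g : R * R -> R) (x : R * R) (j : bool).

Definition ev (j : bool) : R * R := if j then (0, 1) else (1, 0).
Definition co (j : bool) (k : int * int) : int := if j then k.2 else k.1.
Definition dd (j : bool) f x : R := 'D_(ev j) f x.

Lemma scaler_regE (a b : R) : a *: b = a * b.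
Proof. by []. Qed.

(** Turns a directional derivative into a one-variable derivative at [0], where the chain rule and
    the mean value theorem are at hand. *)
Lemma is_derive_line f x v (df : R) :
  is_derive x v f df <-> is_derive (0 : R) 1 (fun h : R => f (h *: v + x)) df.
Proof.
have E : (fun h : R => h^-1 *: (((fun h : R => f (h *: v + x)) \o shift 0) (h *: 1) -
    f (0 *: v + x))) = (fun h => h^-1 *: ((f \o shift x) (h *: v) - f x)).
  by apply/funext => h /=; rewrite addr0 scale0r add0r [h%:A]mulr1.
split=> -[d <-].
  by split; [rewrite /derivable E|rewrite /derive E].
by split; [rewrite /derivable E in d|rewrite [RHS]/derive E].
Qed.

Lemma is_derive_bigsum (I : Type) (r : seq I) (F : I -> R * R -> R) (dF : I -> R) x v :
  (forall i, is_derive x v (F i) (dF i)) ->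
  is_derive x v (fun y => \sum_(i <- r) F i y) (\sum_(i <- r) dF i).
Proof.
move=> H; elim: r => [|a r IH].
  under [X in is_derive _ _ X _]funext do rewrite big_nil.
  by rewrite big_nil; exact: is_derive_cst.
under [X in is_derive _ _ X _]funext do rewrite big_cons.
by rewrite big_cons; exact: is_deriveD.
Qed.

Lemma phase_line k x j (h : R) :
  phase k (h *: ev j + x) = h * (2 * pi * (co j k)%:~R) + phase k x.
Proof. by rewrite /phase /ev /co; case: j => /=; rewrite !scaler_regE /=; ring. Qed.

(** The real part gives a real value for every array [c]; for Hermitian [c] the sum is real anyway
    ([tp_im0]). *)
Definition tp (L : nat) (c : int * int -> R[i]) x : R :=
  \sum_(k <- box L) complex.Re (c k * expi_mode k x).

Definition dcoef (j : bool) (c : int * int -> R[i]) k : R[i] :=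
  (0 +i* (2 * pi * (co j k)%:~R)) * c k.

Lemma is_derive_mode (z : R[i]) k j x :
  is_derive x (ev j) (fun x => complex.Re (z * expi_mode k x))
    (complex.Re ((0 +i* (2 * pi * (co j k)%:~R)) * z * expi_mode k x)).
Proof.
case: z => a b; apply/is_derive_line.
rewrite (_ : (fun _ => _) = (fun h : R =>
   a * cos (h * (2 * pi * (co j k)%:~R) + phase k x)
   - b * sin (h * (2 * pi * (co j k)%:~R) + phase k x))); last first.
  by apply/funext => h; rewrite /= phase_line.
set w := 2 * pi * _.
have dl : is_derive (0 : R) 1 (fun h : R => h * w + phase k x) w.
  apply: is_derive_eq.
  by rewrite /= !scaler0 add0r addr0 scaler_regE mulr1.
have dc := @is_derive1_comp R cos (fun h : R => h * w + phase k x) 0 _ w (is_derive_cos _) dl.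
have ds := @is_derive1_comp R sin (fun h : R => h * w + phase k x) 0 _ w (is_derive_sin _) dl.
have H := is_deriveB (is_deriveZ a dc) (is_deriveZ b ds).
apply: (is_derive_eq H).
rewrite mul0r add0r !scaler_regE /=; ring.
Qed.

Lemma is_derive_tp L c j x : is_derive x (ev j) (tp L c) (tp L (dcoef j c) x).
Proof. by apply: is_derive_bigsum => k; exact: is_derive_mode. Qed.

Lemma dd_tp L c j : dd j (tp L c) = tp L (dcoef j c).
Proof. by apply/funext => x; case: (is_derive_tp L c j x). Qed.

Lemma phase_continuous k : continuous (@phase R k).
Proof.
move=> x; rewrite /phase; apply: cvgMr => //; apply: cvgD.
  by apply: cvgMr => //; exact: cvg_fst.
by apply: cvgMr => //; exact: cvg_snd.
Qed.

Lemma tp_continuous L c : continuous (tp L c).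
Proof.
move=> x; rewrite /tp; elim: (box L) => [|k r IH].
  under [X in continuous_at _ X]funext do rewrite big_nil.
  exact: cvg_cst.
under [X in continuous_at _ X]funext do rewrite big_cons.
apply: cvgD => //.
case: (c k) => a b /=; apply: cvgB; apply: cvgMr => //.
  by apply: continuous_comp; [exact: phase_continuous|exact: continuous_cos].
by apply: continuous_comp; [exact: phase_continuous|exact: continuous_sin].
Qed.

Lemma cos_2pi_int (z : int) : cos (2 * pi * z%:~R) = 1 :> R.
Proof.
have H (n : nat) : cos (2 * pi * n%:R) = 1 :> R.
  have -> : 2 * pi * n%:R = 0 + pi *+ 2 *+ n :> R.
    by rewrite add0r -[RHS]mulr_natr [pi *+ 2]mulr2n; ring.
  by rewrite (periodicn (@cosD2pi R)) cos0.
case: z => n; first exact: H.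
by rewrite NegzE mulrNz mulrN cosN; exact: H.
Qed.

Lemma sin_2pi_int (z : int) : sin (2 * pi * z%:~R) = 0 :> R.
Proof.
have H (n : nat) : sin (2 * pi * n%:R) = 0 :> R.
  have -> : 2 * pi * n%:R = 0 + pi *+ 2 *+ n :> R.
    by rewrite add0r -[RHS]mulr_natr [pi *+ 2]mulr2n; ring.
  by rewrite (periodicn (@sinD2pi R)) sin0.
case: z => n; first exact: H.
by rewrite NegzE mulrNz mulrN sinN; apply/eqP; rewrite oppr_eq0; apply/eqP; exact: H.
Qed.

Lemma expi_modeD k x y : expi_mode k (x + y) = expi_mode k x * expi_mode k y.
Proof.
rewrite /expi_mode.
have -> : phase k (x + y) = phase k x + phase k y by rewrite /phase /=; ring.
by apply/eqP; rewrite eq_complex /= cosD sinD [X in _ && (X == _)]addrC !eqxx.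
Qed.

Lemma expi_mode_ev k j : expi_mode k (ev j) = 1.
Proof.
rewrite /expi_mode.
have -> : phase k (ev j) = 2 * pi * (co j k)%:~R.
  by rewrite /phase /ev /co; case: j => /=; ring.
by rewrite cos_2pi_int sin_2pi_int.
Qed.

Lemma tp_periodic L c : torus_periodic (tp L c).
Proof.
have H j : periodic (tp L c) (ev j).
  by move=> x; apply: eq_bigr => k _; rewrite expi_modeD expi_mode_ev mulr1.
by split; [exact: (H false)|exact: (H true)].
Qed.

(** The regularity that the maximum principle consumes: only the pure second derivatives along the
    axes. Trigonometric polynomials and [C2] solutions both have it, and it passes to
    differences. *)
Definition reg f := [/\ torus_periodic f, continuous f &
  forall j x, derivable f x (ev j) /\ derivable (dd j f) x (ev j)].

Lemma reg_tp L c : reg (tp L c).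
Proof.
split; [exact: tp_periodic|exact: tp_continuous|move=> j x].
by rewrite dd_tp; split; apply: (@ex_derive _ _ _ _ _ _ _ (is_derive_tp _ _ _ _)).
Qed.

Lemma reg_C2 f : torus_periodic f -> C2 f -> reg f.
Proof.
move=> pf [[df c1 c2] [df1 _ _] [df2 _ _]]; split => //.
  by move=> x; exact/differentiable_continuous.
move=> j x; split; first exact: diff_derivable.
case: j; apply: diff_derivable; [exact: df2|exact: df1].
Qed.

Lemma ddB j f g : reg f -> reg g -> dd j (f - g) = dd j f - dd j g.
Proof.
move=> [_ _ rf] [_ _ rg]; apply/funext => x; rewrite /dd deriveB//.
  by case: (rf j x).
by case: (rg j x).
Qed.

Lemma reg_sub f g : reg f -> reg g -> reg (f - g).
Proof.
move=> rf rg; have [[pf1 pf2] cf df] := rf; have [[pg1 pg2] cg dg] := rg; split.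
- split=> x; first exact: (congr2 (fun a b => a - b) (pf1 x) (pg1 x)).
  exact: (congr2 (fun a b => a - b) (pf2 x) (pg2 x)).
- by move=> x; apply: cvgB; [exact: cf|exact: cg].
- move=> j x; rewrite ddB//; case: (df j x) (dg j x) => ? ? [? ?].
  by split; exact: derivableB.
Qed.

Lemma laplacianE f x : laplacian f x = dd false (dd false f) x + dd true (dd true f) x.
Proof. by []. Qed.

Lemma laplacianB f g x : reg f -> reg g ->
  laplacian (f - g) x = laplacian f x - laplacian g x.
Proof.
move=> rf rg; rewrite !laplacianE (ddB false rf rg) (ddB true rf rg).
have [_ _ df] := rf; have [_ _ dg] := rg.
rewrite {1}/dd deriveB; [|by case: (df false x)|by case: (dg false x)].
rewrite {3}/dd deriveB; [|by case: (df true x)|by case: (dg true x)].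
by rewrite opprD addrACA.
Qed.

End DirectionalDerivatives.

(** * Maximum principle and gradient barrier *)

Section MaximumPrinciple.
Context {R : realType}.
Implicit Types (f g : R * R -> R) (x : R * R) (j : bool).

Lemma derive_gt (p : R -> R) (s d K : R) : is_derive s 1 p d -> K < d ->
  exists2 e : R, 0 < e & forall h, 0 < h < e -> K * h < p (s + h) - p s.
Proof.
move=> [dp pd] Kd.
have : (fun h : R => h^-1 *: ((p \o shift s) (h *: 1) - p s)) @ 0^' --> d.
  by rewrite -pd; exact: dp.
move=> /cvgr_gt - /(_ _ Kd) [e /= e0 He].
exists e => // h /andP[h0 he].
have /= := He h; rewrite sub0r normrN gtr0_norm// => /(_ he).
rewrite gt_eqF// => /(_ isT).
by rewrite [h%:A]mulr1 [_ *: _]mulrC ltr_pdivlMr// [s + h]addrC.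
Qed.

(** The second derivative exists only at [s0] itself, so the argument goes through [dg]: it vanishes
    at [s0], and were [d2] positive it would be positive just after [s0], whereupon the mean value
    theorem would push [g] above its maximum. *)
Lemma second_derivative_max (g dg : R -> R) (s0 e d2 : R) : 0 < e ->
  (forall s, `|s - s0| < e -> is_derive s 1 g (dg s)) ->
  is_derive s0 1 dg d2 -> (forall s, `|s - s0| < e -> g s <= g s0) -> d2 <= 0.
Proof.
move=> e0 Hg Hd Hm.
have dg0 : dg s0 = 0.
  have inI t : t \in `]s0 - e, s0 + e[%R -> `|t - s0| < e.
    by rewrite in_itv /= => /andP[? ?]; rewrite ltr_norml; apply/andP; split; lra.
  have /= := @derive1_at_max R g (s0 - e) (s0 + e) s0.
  case=> //.
  - by lra.
  - by move=> t /inI /Hg[].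
  - by rewrite in_itv /=; apply/andP; split; lra.
  - by move=> t /inI /Hm.
  move=> _ <-; have [|_ <-//] := Hg s0; by rewrite subrr normr0.
rewrite leNgt; apply/negP => d20.
have [e' e'0 He'] := derive_gt Hd d20.
have m0 : 0 < Num.min e e' by rewrite lt_min e0 e'0.
have m1 : Num.min e e' <= e by rewrite ge_min lexx.
have m2 : Num.min e e' <= e' by rewrite ge_min lexx orbT.
pose h := Num.min e e' / 2.
have h0 : 0 < h by rewrite divr_gt0.
have he : h < e by rewrite /h; lra.
have he' : h < e' by rewrite /h; lra.
have [|||c /[!in_itv] /= /andP[c1 c2] E] := @MVT R g dg s0 (s0 + h).
- by lra.
- move=> t; rewrite in_itv /= => /andP[t1 t2]; apply: Hg.
  by rewrite gtr0_norm; lra.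
- apply: derivable_within_continuous => t; rewrite in_itv /= => /andP[t1 t2].
  have [|//] := Hg t; by rewrite ger0_norm; lra.
have := He' (c - s0).
rewrite mul0r addrCA subrr addr0 dg0 subr0 => H.
have dc : 0 < dg c by apply: H; apply/andP; split; lra.
have := Hm (s0 + h); rewrite addrAC subrr add0r gtr0_norm// => /(_ he).
rewrite leNgt => /negP; apply; rewrite -subr_gt0 E mulr_gt0//; lra.
Qed.

Lemma is_derive_line_at f (s df : R) z v :
  is_derive (s *: v + z) v f df -> is_derive s 1 (fun s => f (s *: v + z)) df.
Proof.
move=> /is_derive_line H.
have E : (fun s0 : R => f (s0 *: v + z)) =
  (fun h => f (h *: v + (s *: v + z))) \o (fun t => t - s).
  by apply/funext => t /=; rewrite addrA -scalerDl subrK.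
rewrite E -[df]mulr1; apply: is_derive1_comp; first by rewrite subrr.
apply: is_derive_eq; by rewrite subr0.
Qed.

Lemma periodic_int f (z1 z2 : int) x : torus_periodic f ->
  f (x.1 + z1%:~R, x.2 + z2%:~R) = f x.
Proof.
move=> [p1 p2].
have H (T : R * R) (z : int) y : periodic f T -> f (y + T *~ z) = f y.
  move=> pT; case: z => n; first exact: periodicn.
  by rewrite NegzE mulrNz -(periodicn pT n.+1) pmulrn subrK.
have -> : (x.1 + z1%:~R, x.2 + z2%:~R) = x + (1, 0) *~ z1 + (0, 1) *~ z2.
  have F1 (v : R * R) (z : int) : (v *~ z).1 = v.1 *~ z by exact: (raddfMz fst).
  have F2 (v : R * R) (z : int) : (v *~ z).2 = v.2 *~ z by exact: (raddfMz snd).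
  apply/eqP; rewrite /eq_op /= !F1 !F2 /= !mul0rz !addr0.
  by rewrite !eqxx.
by rewrite !H.
Qed.

Lemma square_max (f : R * R -> R) (a b : R) : 0 <= a -> 0 <= b -> continuous f ->
  exists2 m, (0 <= m.1 <= a) && (0 <= m.2 <= b) &
    forall x, 0 <= x.1 <= a -> 0 <= x.2 <= b -> f x <= f m.
Proof.
move=> a0 b0 cf.
have cA : compact (`[0, a]%classic `*` `[0, b]%classic : set (R * R)).
  by apply: compact_setX; exact: segment_compact.
have [|m mA Hm] := compact_EVT_max _ cA (continuous_subspaceT cf).
  by exists (0, 0); rewrite /= !in_itv /= !lexx a0 b0.
exists m; first by move: mA; rewrite inE /= !in_itv /= => -[-> ->].
by move=> x x1 x2; apply: Hm; rewrite inE /= !in_itv.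
Qed.

Lemma periodic_max f : torus_periodic f -> continuous f ->
  exists m, forall x, f x <= f m.
Proof.
move=> pf cf; have [m _ Hm] := square_max ler01 ler01 cf.
exists m => x.
rewrite -(periodic_int (- Num.floor x.1) (- Num.floor x.2) x pf).
have H (y : R) : 0 <= y + (- Num.floor y)%:~R <= 1.
  rewrite mulrNz; have := floor_le_tmp y; have := floorD1_gt y.
  by rewrite intrD => h1 h2; apply/andP; split; lra.
by apply: Hm; rewrite /= H.
Qed.

Lemma is_derive_reg f j x : reg f -> is_derive x (ev j) f (dd j f x).
Proof. by move=> [_ _ /(_ j x)[d _]]; apply: DeriveDef. Qed.

Lemma is_derive_reg2 f j x : reg f -> is_derive x (ev j) (dd j f) (dd j (dd j f) x).
Proof. by move=> [_ _ /(_ j x)[_ d]]; apply: DeriveDef. Qed.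

Lemma laplacian_max f m : reg f -> (forall x, f x <= f m) -> laplacian f m <= 0.
Proof.
move=> rf Hm.
have H j : dd j (dd j f) m <= 0.
  apply: (@second_derivative_max (fun s => f (s *: ev j + m))
    (fun s => dd j f (s *: ev j + m)) 0 1 _ ltr01).
  - by move=> s _; apply: is_derive_line_at; exact: is_derive_reg.
  - by apply: is_derive_line_at; rewrite scale0r add0r; exact: is_derive_reg2.
  - by move=> s _; rewrite scale0r add0r.
by rewrite laplacianE -[leRHS]addr0 lerD.
Qed.

Lemma max_principle f (tau B : R) : reg f -> 0 <= tau ->
  (forall x, f x - tau * laplacian f x <= B) -> forall x, f x <= B.
Proof.
move=> rf t0 H x; have [pf cf _] := rf.
have [m Hm] := periodic_max pf cf.
apply: (le_trans (Hm x)); apply: (le_trans _ (H m)).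
by rewrite lerDl oppr_ge0 mulr_ge0_le0//; exact: laplacian_max.
Qed.

Lemma reg0 : reg (0 : R * R -> R).
Proof.
have E : (0 : R * R -> R) = tp 0 (fun=> 0).
  by apply/funext => x; rewrite /tp big1// => k _; rewrite mul0r.
by rewrite E; exact: reg_tp.
Qed.

Lemma laplacian0 x : laplacian (0 : R * R -> R) x = 0.
Proof.
have E j : dd j (0 : R * R -> R) = 0 by apply/funext => y; exact: derive_cst.
by rewrite laplacianE !E addr0.
Qed.

Lemma reg_opp f : reg f -> reg (- f).
Proof. by move=> rf; rewrite -[- f]add0r; exact: reg_sub reg0 rf. Qed.

Lemma laplacianN f x : reg f -> laplacian (- f) x = - laplacian f x.
Proof.
move=> rf; have E : laplacian (0 - f) x = - laplacian f x.
  by rewrite (laplacianB x reg0 rf) laplacian0 sub0r.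
by move: E; rewrite sub0r.
Qed.

Lemma ddN j f : reg f -> dd j (- f) = - dd j f.
Proof.
move=> rf; have E : dd j (0 - f) = - dd j f.
  rewrite (ddB j reg0 rf) (_ : dd j 0 = 0) ?sub0r//.
  by apply/funext => y; exact: derive_cst.
by move: E; rewrite sub0r.
Qed.

Lemma max_principle_norm f (tau B : R) : reg f -> 0 <= tau ->
  (forall x, `|f x - tau * laplacian f x| <= B) -> forall x, `|f x| <= B.
Proof.
move=> rf t0 H x; rewrite ler_norml lerNl; apply/andP; split.
  rewrite -[- f x]/((- f) x).
  apply: (max_principle (reg_opp rf) t0) => y; rewrite laplacianN//.
  have := H y; rewrite ler_norml => /andP[+ _]; rewrite lerNl.
  by rewrite mulrN opprB opprK addrC.
by apply: (max_principle rf t0) => y; have := H y; rewrite ler_norml => /andP[_].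
Qed.

End MaximumPrinciple.

Section Barrier.
Context {R : realType}.
Implicit Types (f g : R * R -> R) (x : R * R) (j : bool).

Lemma dd_shift_derive f j (a s : R) z : reg f -> is_derive s 1
  (fun s => f ((a * s) *: ev j + z)) (a * dd j f ((a * s) *: ev j + z)).
Proof.
move=> rf.
have H : is_derive (a * s) 1 (fun t => f (t *: ev j + z)) (dd j f ((a * s) *: ev j + z)).
  by apply: is_derive_line_at; exact: is_derive_reg.
have E : is_derive s 1 (fun s : R => a * s) a.
  by apply: (is_derive_eq (is_deriveZ a (is_derive_id s 1))); rewrite scaler_regE mulr1.
by have := is_derive1_comp H E; rewrite mulrC.
Qed.

Lemma dd_shift_derive2 f j (a s : R) z : reg f -> is_derive s 1
  (fun s => a * dd j f ((a * s) *: ev j + z)) (a * (a * dd j (dd j f) ((a * s) *: ev j + z))).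
Proof.
move=> rf.
have H : is_derive (a * s) 1 (fun t => dd j f (t *: ev j + z)) (dd j (dd j f) ((a * s) *: ev j + z)).
  by apply: is_derive_line_at; exact: is_derive_reg2.
have E : is_derive s 1 (fun s : R => a * s) a.
  by apply: (is_derive_eq (is_deriveZ a (is_derive_id s 1))); rewrite scaler_regE mulr1.
have F := is_derive1_comp H E.
by apply: (is_derive_eq (is_deriveZ a F)); rewrite scaler_regE [_ * a]mulrC.
Qed.

Lemma laplacian_dir j f x :
  laplacian f x = dd j (dd j f) x + dd (~~ j) (dd (~~ j) f) x.
Proof. by rewrite laplacianE; case: j; [exact: addrC|reflexivity]. Qed.

(** For nonnegative [a] and [q], a concave profile rising from [0] towards [a] with initial slope
    [a * q]; it satisfies [- bar'' = q ^ 2 * (a - bar)]. *)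
Definition bar (q a s : R) : R := a * (1 - expR (- (q * s))).

Lemma is_derive_bar (q a s : R) : is_derive s 1 (bar q a) (a * q * expR (- (q * s))).
Proof.
have H : is_derive s 1 (fun s : R => - (q * s)) (- q).
  by apply: (is_derive_eq (is_deriveN (is_deriveZ q (is_derive_id s 1)))); rewrite scaler_regE mulr1.
have E := is_derive1_comp (is_derive_expR _) H.
apply: (is_derive_eq (is_deriveZ a (is_deriveB (is_derive_cst (1 : R) s 1) E))).
by rewrite scaler_regE; ring.
Qed.

Lemma is_derive_bar2 (q a s : R) : is_derive s 1
  (fun s => a * q * expR (- (q * s))) (- (a * q ^+ 2 * expR (- (q * s)))).
Proof.
have H : is_derive s 1 (fun s : R => - (q * s)) (- q).
  by apply: (is_derive_eq (is_deriveN (is_deriveZ q (is_derive_id s 1)))); rewrite scaler_regE mulr1.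
have E := is_derive1_comp (is_derive_expR _) H.
apply: (is_derive_eq (is_deriveZ (a * q) E)).
by rewrite scaler_regE; ring.
Qed.

(* Comparison of [F(z + s e_j) - F(z - s e_j)] with a concave barrier in [s]:
   the difference vanishes at [s = 0] and, by periodicity, at [s = 1/2]. *)
Lemma barrier_step F F0 h (B0 : R -> R) j (tau q a gam : R) :
  reg F -> 0 <= tau -> 0 <= a ->
  (forall x, F x - tau * laplacian F x = F0 x + tau * h x) ->
  (forall x, `|h x| <= gam) -> 0 <= q ->
  (forall (z : R * R) (s : R), 0 <= s <= 2^-1 -> F0 (s *: ev j + z) - F0 (- s *: ev j + z) <= B0 s) ->
  (forall s : R, 0 <= s <= 2^-1 -> B0 s + 2 * tau * gam <=
     bar q a s + tau * (a * q ^+ 2 * expR (- (q * s)))) ->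
  forall (z : R * R) (s : R), 0 <= s <= 2^-1 -> F (s *: ev j + z) - F (- s *: ev j + z) <= bar q a s.
Proof.
move=> rF tau0 a0 EF hg q0 H0 HB z s sI.
have [pF cF dF] := rF.
pose w := ev (~~ j) : R * R.
(* [p.1] is half the distance between the two points and [p.2] moves both of them across the
   direction [j]. At an interior maximum the two second derivatives of [Q] add up, apart from the
   barrier term, to the difference of the Laplacians of [F] at the two points. *)
pose Q (p : R * R) := F (p.1 *: ev j + (p.2 *: w + z))
  - F (- p.1 *: ev j + (p.2 *: w + z)) - bar q a p.1.
have cQ : continuous Q.
  move=> p; apply: cvgB; first apply: cvgB.
  - apply: (@continuous_comp _ _ _ (fun p : R * R => p.1 *: ev j + (p.2 *: w + z)) F); last exact: cF.
    apply: cvgD; first by apply: cvgZr_tmp; exact: cvg_fst.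
    by apply: cvgD; [apply: cvgZr_tmp; exact: cvg_snd|exact: cvg_cst].
  - apply: (@continuous_comp _ _ _ (fun p : R * R => - p.1 *: ev j + (p.2 *: w + z)) F); last exact: cF.
    apply: cvgD; first by apply: cvgZr_tmp; apply: cvgN; exact: cvg_fst.
    by apply: cvgD; [apply: cvgZr_tmp; exact: cvg_snd|exact: cvg_cst].
  - apply: (@continuous_comp _ _ _ (fun p : R * R => p.1) (bar q a)); first exact: cvg_fst.
    apply: differentiable_continuous; apply/derivable1_diffP.
    exact: (@ex_derive _ _ _ _ _ _ _ (is_derive_bar q a p.1)).
have half0 : (0 : R) <= 2^-1 by rewrite invr_ge0.
have [m /andP[m1 m2] Hm] := square_max half0 ler01 cQ.
have perw (f : R * R -> R) (x : R * R) (i : int) : torus_periodic f ->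
    f (i%:~R *: w + x) = f x.
  move=> pf; rewrite -[RHS](periodic_int (if j then i else 0) (if j then 0 else i) x pf).
  congr f; apply/eqP; rewrite /eq_op /= /w /ev; case: (j) => /=;
  by rewrite !scaler_regE ?mulr1 ?mulr0 ?addr0 ?add0r [_ + i%:~R]addrC !eqxx.
have perv (f : R * R -> R) (x : R * R) (i : int) : torus_periodic f ->
    f (i%:~R *: ev j + x) = f x.
  move=> pf; rewrite -[RHS](periodic_int (if j then 0 else i) (if j then i else 0) x pf).
  congr f; apply/eqP; rewrite /eq_op /= /ev; case: (j) => /=;
  by rewrite !scaler_regE ?mulr1 ?mulr0 ?addr0 ?add0r [_ + i%:~R]addrC !eqxx.
have Hmax p : 0 <= p.1 <= 2^-1 -> Q p <= Q m.
  move=> p1.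
  have E : Q p = Q (p.1, p.2 + (- Num.floor p.2)%:~R).
    rewrite /Q /=.
    have S t : t *: ev j + ((p.2 + (- Num.floor p.2)%:~R) *: w + z) =
        (- Num.floor p.2)%:~R *: w + (t *: ev j + (p.2 *: w + z)).
      by rewrite scalerDl -addrA addrCA [in RHS]addrCA; congr (_ + _); rewrite addrCA.
    by rewrite !S !perw.
  rewrite E; apply: Hm => //=.
  rewrite mulrNz; have := floor_le_tmp p.2; have := floorD1_gt p.2.
  by rewrite intrD => h1 h2; apply/andP; split; lra.
suff Qm : Q m <= 0.
  have := Hmax (s, 0); rewrite /Q /= scale0r add0r => /(_ sI) H.
  by have := le_trans H Qm; rewrite lerBlDl addr0.
rewrite leNgt; apply/negP => Qm.
have bar_ge0 t : 0 <= t -> 0 <= bar q a t.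
  move=> t0; rewrite mulr_ge0// subr_ge0 -expR0 ler_expR.
  by rewrite oppr_le0 mulr_ge0.
move/andP: m1 => [m10 m11].
have m1n0 : 0 < m.1.
  rewrite lt_neqAle m10 andbT; apply/eqP => E0; move: Qm.
  rewrite /Q -E0 oppr0 scale0r add0r subrr /bar mulr0 oppr0 expR0 subrr mulr0 subrr.
  by rewrite ltxx.
have m1n1 : m.1 < 2^-1.
  rewrite lt_neqAle m11 andbT; apply/eqP => E1; move: Qm.
  have -> : Q m = - bar q a m.1.
    rewrite /Q E1 -[X in X - _ - _](perv F _ (-1) pF) addrA -scalerDl.
    have -> : (-1)%:~R + 2^-1 = - 2^-1 :> R.
      by rewrite mulrNz; field.
    by rewrite subrr sub0r.
  by rewrite oppr_gt0 ltNge bar_ge0.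
pose y := m.2 *: w + z.
pose e := Num.min m.1 (2^-1 - m.1).
have e0 : 0 < e by rewrite lt_min m1n0 subr_gt0.
have e1 : e <= m.1 by rewrite ge_min lexx.
have e2 : e <= 2^-1 - m.1 by rewrite ge_min lexx orbT.
have bounds t : `|t - m.1| < e -> 0 <= t <= 2^-1.
  by rewrite ltr_norml => /andP[? ?]; apply/andP; split; lra.
have D1 : dd j (dd j F) (m.1 *: ev j + y) - dd j (dd j F) (- m.1 *: ev j + y)
    <= - (a * q ^+ 2 * expR (- (q * m.1))).
  pose g1 (t : R) := F ((1 * t) *: ev j + y) - F ((-1 * t) *: ev j + y) - bar q a t.
  pose dg1 (t : R) := 1 * dd j F ((1 * t) *: ev j + y) - (-1) * dd j F ((-1 * t) *: ev j + y)
     - a * q * expR (- (q * t)).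
  have Dg (t : R) : is_derive t 1 g1 (dg1 t).
    by apply: is_deriveB; [apply: is_deriveB; exact: dd_shift_derive|exact: is_derive_bar].
  have Dg2 := is_deriveB (is_deriveB (dd_shift_derive2 j 1 m.1 y rF)
    (dd_shift_derive2 j (-1) m.1 y rF)) (is_derive_bar2 q a m.1).
  have := second_derivative_max e0 (fun t _ => Dg t) Dg2.
  rewrite !mul1r !mulN1r !opprK -lerBrDr sub0r.
  by apply => t /bounds tI; have := Hmax (t, m.2) tI; rewrite /Q /g1 /= !mul1r !mulN1r.
have D2 : dd (~~ j) (dd (~~ j) F) (m.1 *: ev j + y) -
   dd (~~ j) (dd (~~ j) F) (- m.1 *: ev j + y) <= 0.
  pose v1 := m.1 *: ev j + z; pose v2 := - m.1 *: ev j + z.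
  pose g1 (t : R) := F (t *: ev (~~ j) + v1) - F (t *: ev (~~ j) + v2).
  pose dg1 (t : R) := dd (~~ j) F (t *: ev (~~ j) + v1) - dd (~~ j) F (t *: ev (~~ j) + v2).
  have Dg (t : R) : is_derive t 1 g1 (dg1 t).
    by apply: is_deriveB; apply: is_derive_line_at; exact: is_derive_reg.
  have Dg2 : is_derive m.2 1 dg1 (dd (~~ j) (dd (~~ j) F) (m.2 *: ev (~~ j) + v1) -
      dd (~~ j) (dd (~~ j) F) (m.2 *: ev (~~ j) + v2)).
    by apply: is_deriveB; apply: is_derive_line_at; exact: is_derive_reg2.
  have S (t r : R) : t *: ev (~~ j) + (r *: ev j + z) = r *: ev j + (t *: w + z).
    exact: addrCA.
  have := second_derivative_max (@ltr01 R) (fun t _ => Dg t) Dg2.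
  rewrite (S m.2 m.1) (S m.2 (- m.1)); apply => t _.
  have := Hmax (m.1, t); rewrite /= m10 m11 /Q /= => /(_ isT).
  by rewrite lerD2r /g1 (S t m.1) (S t (- m.1)) (S m.2 m.1) (S m.2 (- m.1)).
have L : laplacian F (m.1 *: ev j + y) - laplacian F (- m.1 *: ev j + y) <=
   - (a * q ^+ 2 * expR (- (q * m.1))).
  rewrite !(laplacian_dir j) opprD addrACA -[leRHS]addr0.
  exact: lerD.
have E1 := EF (m.1 *: ev j + y); have E2 := EF (- m.1 *: ev j + y).
have h1 := hg (m.1 *: ev j + y); have h2 := hg (- m.1 *: ev j + y).
have m1I : 0 <= m.1 <= 2^-1 by rewrite m10 m11.
have HH := H0 y m.1 m1I; have HBB := HB _ m1I.
have TL := ler_wpM2l tau0 L.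
have h12 : h (m.1 *: ev j + y) - h (- m.1 *: ev j + y) <= 2 * gam.
  move: h1 h2; rewrite !ler_norml => /andP[_ h1] /andP[h2 _].
  by rewrite mulr_natl mulr2n lerD// lerNl.
have Th := ler_wpM2l tau0 h12.
move: Qm; rewrite /Q -/y => Qm.
move: E1 E2 HH HBB TL Th Qm; clear.
move: (F _) (F _) (F0 _) (F0 _) (laplacian F _) (laplacian F _) (h _) (h _) (B0 _) (bar _ _ _)
  (a * q ^+ 2 * expR (- (q * m.1))).
move=> *; nra.
Qed.

End Barrier.

(** The eigenvalue of minus the Laplacian on the mode [k], locked so that it stays an atom under
    simplification. *)
HB.lock Definition lam {R : realType} (k : int * int) : R :=
  (2 * pi) ^+ 2 * (k.1%:~R ^+ 2 + k.2%:~R ^+ 2).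

Section Resolvent.
Context {R : realType}.
Implicit Types (f g : R * R -> R) (x : R * R) (j : bool) (c : int * int -> R[i]).

(** The barrier has rate [1 / sqrt sigma], and its amplitude [a m] grows by [2 * gam * tau] per
    step. Of the forcing [2 * tau * gam] of the difference, this growth pays the fraction
    [1 - expR (- (q * s))]; concavity pays the rest, because [a * q ^ 2 >= 2 * gam]. The final slope
    at [s = 0] is at most [4 * gam * sqrt sigma], which bounds twice the derivative. *)
Lemma barrier_upper (G g : nat -> R * R -> R) j (tau sigma gam : R) (n : nat) :
  (forall m, reg (G m)) -> (forall x, G 0%N x = 0) ->
  (forall m x, G m.+1 x - tau * laplacian (G m.+1) x = G m x + tau * g m x) ->
  (forall m x, (m < n)%N -> `|g m x| <= gam) -> 0 <= gam ->
  0 <= tau -> 0 < sigma -> n%:R * tau <= sigma ->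
  forall x, dd j (G n) x <= 2 * gam * Num.sqrt sigma.
Proof.
move=> rG G0 EG gb gam0 t0 s0 ns x.
set r := Num.sqrt sigma.
have r0 : 0 < r by rewrite sqrtr_gt0.
have r2 : r * r = sigma by rewrite -expr2 sqr_sqrtr// ltW.
pose q := r^-1.
pose a m := (sigma + m%:R * tau) * (2 * gam).
have q0 : 0 <= q by rewrite invr_ge0 ltW.
have a0 m : 0 <= a m by rewrite mulr_ge0// ?mulr_ge0// addr_ge0 ?mulr_ge0// ltW.
have P m : (m <= n)%N -> forall (z : R * R) (s : R), 0 <= s <= 2^-1 ->
    G m (s *: ev j + z) - G m (- s *: ev j + z) <= bar q (a m) s.
  elim: m => [_ z s /andP[s1 _]|m IH mn].
    rewrite !G0 subrr mulr_ge0// subr_ge0 -expR0 ler_expR oppr_le0 mulr_ge0//.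
  apply: (@barrier_step _ (G m.+1) (G m) (g m) (bar q (a m)) j tau q (a m.+1) gam) => //.
  - by move=> y; apply: gb.
  - by apply: IH; exact: ltnW.
  - move=> s _; rewrite /bar.
    have E0 : 0 <= expR (- (q * s)) := expR_ge0 _.
    set E := expR _ in E0 *.
    have aq : a m.+1 * q ^+ 2 = (1 + m.+1%:R * tau / sigma) * (2 * gam).
      rewrite /a /q expr2 -r2; field; exact: lt0r_neq0.
    have aq2 : 2 * gam <= a m.+1 * q ^+ 2.
      rewrite aq -[leLHS]mul1r ler_wpM2r ?mulr_ge0// lerDl.
      by rewrite divr_ge0 ?mulr_ge0// ltW.
    have H := ler_wpM2l t0 (ler_wpM2r E0 aq2).
    have Ea : a m.+1 = a m + 2 * gam * tau by rewrite /a -natr1; ring.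
    rewrite Ea in H *; move: H; clear; set b := a m; set d := _ * q ^+ 2 * E.
    by move=> H; lra.
have {}P s : 0 <= s <= 2^-1 -> G n (s *: ev j + x) - G n (- s *: ev j + x) <= 4 * gam * r * s.
  move=> /[dup] /andP[s1 _] sI; apply: (le_trans (P n (leqnn _) x s sI)).
  have h1 : 1 - expR (- (q * s)) <= q * s.
    by have := expR_ge1Dx (- (q * s)); lra.
  apply: (@le_trans _ _ ((sigma + sigma) * (2 * gam) * (q * s))).
    apply: ler_pM => //.
      by rewrite subr_ge0 -expR0 ler_expR oppr_le0 mulr_ge0.
    by rewrite ler_wpM2r ?mulr_ge0// lerD2l.
  rewrite -r2 /q le_eqVlt; apply/orP; left; apply/eqP; field; exact: lt0r_neq0.
have Dg : is_derive (0 : R) 1 (fun s => G n ((1 * s) *: ev j + x) - G n ((-1 * s) *: ev j + x))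
   (2 * dd j (G n) x).
  have D1 := dd_shift_derive j 1 0 x (rG n); have D2 := dd_shift_derive j (-1) 0 x (rG n).
  apply: (is_derive_eq (is_deriveB D1 D2)).
  by rewrite !mulr0 !scale0r !add0r; ring.
rewrite leNgt; apply/negP => H.
have H2 : 4 * gam * r < 2 * dd j (G n) x.
  by move: H; move: (dd _ _ _) => d; lra.
have [e e0 He] := derive_gt Dg H2.
pose h := Num.min e 2^-1 / 2.
have m0 : 0 < Num.min e 2^-1 by rewrite lt_min e0 invr_gt0 ltr0n.
have m1 : Num.min e 2^-1 <= e by rewrite ge_min lexx.
have m2 : Num.min e 2^-1 <= 2^-1 by rewrite ge_min lexx orbT.
have h0 : 0 < h by rewrite divr_gt0.
have he : h < e by rewrite /h; lra.
have h2 : h <= 2^-1 by rewrite /h; lra.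
have := He h; rewrite h0 he => /(_ isT).
rewrite add0r !mulr0 !scale0r !add0r subrr subr0 mul1r mulN1r.
by rewrite ltNge P// (ltW h0).
Qed.

Lemma barrier_bound (G g : nat -> R * R -> R) j (tau sigma gam : R) (n : nat) :
  (forall m, reg (G m)) -> (forall x, G 0%N x = 0) ->
  (forall m x, G m.+1 x - tau * laplacian (G m.+1) x = G m x + tau * g m x) ->
  (forall m x, (m < n)%N -> `|g m x| <= gam) -> 0 <= gam ->
  0 <= tau -> 0 < sigma -> n%:R * tau <= sigma ->
  forall x, `|dd j (G n) x| <= 2 * gam * Num.sqrt sigma.
Proof.
move=> rG G0 EG gb gam0 t0 s0 ns x.
rewrite ler_norml lerNl; apply/andP; split; last exact: (barrier_upper j rG G0 EG gb).
have -> : - dd j (G n) x = dd j (- G n) x by rewrite (ddN j (rG n)).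
apply: (@barrier_upper (fun m => - G m) (fun m => - g m) j tau sigma gam n _ _ _ _ gam0 t0 s0 ns).
- by move=> m; exact: (reg_opp (rG m)).
- by move=> y; rewrite -[(- G 0%N) y]/(- G 0%N y) G0 oppr0.
- move=> m y; rewrite (laplacianN y (rG m.+1)) -[(- G _) y]/(- G _ y) -[(- G m) y]/(- G m y).
  rewrite -[(- g m) y]/(- g m y) !mulrN -!opprD; congr (- _); exact: EG.
- by move=> m y mn; rewrite -[(- g m) y]/(- g m y) normrN; exact: gb.
Qed.

(** One resolvent step of size [sigma] started from [0]: [f] is its result and
    [(f - sigma * laplacian f) / sigma] its forcing, so the barrier bound applies with [n = 1]. The
    forcing [h] is defined as whatever the recursion demands. *)
Lemma gradient_bound f j (sigma gam : R) : reg f -> 0 < sigma -> 0 <= gam ->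
  (forall x, `|f x - sigma * laplacian f x| <= gam) ->
  forall x, `|dd j f x| <= 2 * gam / Num.sqrt sigma.
Proof.
move=> rf s0 g0 H x.
pose G (m : nat) : R * R -> R := if m is 1%N then f else 0.
pose h (m : nat) : R * R -> R := fun x =>
  ((G m.+1 x - sigma * laplacian (G m.+1) x) - G m x) / sigma.
have := @barrier_bound G h j sigma sigma (gam / sigma) 1.
have r2 : sigma = Num.sqrt sigma * Num.sqrt sigma by rewrite -expr2 sqr_sqrtr// ltW.
have rn0 : Num.sqrt sigma != 0 by rewrite sqrtr_eq0 -ltNge.
have -> : 2 * (gam / sigma) * Num.sqrt sigma = 2 * gam / Num.sqrt sigma.
  by move: (Num.sqrt sigma) r2 rn0 => r -> rn0; field.
apply; [| | | | |exact: ltW|exact: s0|].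
- by case=> [|[|m]]; [exact: reg0|exact: rf|exact: reg0].
- by [].
- move=> m y; rewrite /h [sigma * (_ / _)]mulrC divfK ?lt0r_neq0//.
  by rewrite [RHS]addrC subrK.
- move=> [|//] y _; rewrite /h /= subr0 normrM normfV (gtr0_norm s0).
  by rewrite ler_pM2r ?invr_gt0.
- by rewrite divr_ge0// ltW.
- by rewrite mul1r.
Qed.

(** A Liouville argument: [gradient_bound] holds at every scale [sigma] with the same numerator, and
    [sigma] may be taken arbitrarily large. *)
Lemma harmonic_grad0 f j : reg f -> (forall x, laplacian f x = 0) ->
  forall x, dd j f x = 0.
Proof.
move=> rf lf x; have [pf cf _] := rf.
have [m1 Hm1] := periodic_max pf cf.
have [pN cN _] := reg_opp rf; have [m2 Hm2] := periodic_max pN cN.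
pose B := `|f m1| + `|f m2|.
have B0 : 0 <= B by rewrite addr_ge0.
have Hb y : `|f y| <= B.
  rewrite ler_norml lerNl; apply/andP; split.
    have := Hm2 y; rewrite -[(- f) _]/(- f _) -[(- f) m2]/(- f m2) => /le_trans; apply.
    by rewrite (le_trans (ler_norm _))// normrN lerDr.
  by rewrite (le_trans (Hm1 y))// (le_trans (ler_norm _))// lerDl.
apply/eqP; rewrite -normr_le0; apply/ler_addgt0Pl => e e0; rewrite addr0.
pose s := (2 * B / e + 1) ^+ 2.
have s1 : 0 < 2 * B / e + 1 by rewrite ltr_wpDl// divr_ge0 ?mulr_ge0// ltW.
have s0 : 0 < s by rewrite exprn_gt0.
have := @gradient_bound f j s B rf s0 B0.
rewrite sqrtr_sqr gtr0_norm// => /(_ _ x) H.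
apply: (le_trans (H _)); first by move=> y; rewrite lf mulr0 subr0.
rewrite ler_pdivrMr// [e * _]mulrDr mulr1 [e * (_ / e)]mulrC divfK ?lt0r_neq0// lerDl ltW//.
Qed.

Lemma lamE k : lam k = (2 * pi) ^+ 2 * (k.1%:~R ^+ 2 + k.2%:~R ^+ 2) :> R.
Proof. by rewrite lam.unlock. Qed.

(** The Fourier multiplier with real symbol [a]; the resolvent [sv] and the stream function [pc] are
    instances. *)
Definition rs (a : int * int -> R) c k : R[i] := (a k)%:C * c k.

Lemma tpD L c1 c2 x : tp L (c1 + c2) x = tp L c1 x + tp L c2 x.
Proof. by rewrite /tp -big_split /=; apply: eq_bigr => k _; rewrite mulrDl cReD. Qed.

Lemma tpZ L (a : R) c x : tp L (rs (fun=> a) c) x = a * tp L c x.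
Proof. by rewrite /tp big_distrr /=; apply: eq_bigr => k _; rewrite /rs -mulrA cReZ. Qed.

Lemma eq_tp L c1 c2 : (forall k, k \in box L -> c1 k = c2 k) -> tp L c1 = tp L c2.
Proof. by move=> e; apply/funext => x; apply: eq_big_seq => k kL; rewrite e. Qed.

Lemma tpN L c x : tp L (- c) x = - tp L c x.
Proof.
rewrite -[RHS]mulN1r -tpZ; congr (_ x); apply: eq_tp => k _.
by rewrite /rs rmorphN1 mulN1r.
Qed.

Lemma tpB L c1 c2 x : tp L (c1 - c2) x = tp L c1 x - tp L c2 x.
Proof. by rewrite tpD tpN. Qed.

Lemma dcoef2 c k : dcoef false (dcoef false c) k + dcoef true (dcoef true c) k
  = (- lam k)%:C * c k.
Proof.
case: k => k1 k2; rewrite /dcoef lamE /co /=; case: (c _) => a b.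
by apply/eqP; rewrite eq_complex /=; apply/andP; split; apply/eqP; ring.
Qed.

Lemma laplacian_tp L c x : laplacian (tp L c) x = tp L (rs (fun k => - lam k) c) x.
Proof.
rewrite laplacianE !dd_tp -tpD; congr (_ x); apply: eq_tp => k _.
exact: dcoef2.
Qed.

Lemma lam_ge0 k : 0 <= lam k :> R.
Proof. by rewrite lamE mulr_ge0 ?sqr_ge0// addr_ge0 ?sqr_ge0. Qed.

Lemma den_gt0 (tau : R) k : 0 <= tau -> 0 < 1 + tau * lam k.
Proof. by move=> t0; rewrite ltr_wpDr// mulr_ge0// lam_ge0. Qed.

Definition sv (tau : R) c := rs (fun k => (1 + tau * lam k)^-1) c.

Lemma tp_sv (tau : R) L c x : 0 <= tau ->
  tp L (sv tau c) x - tau * laplacian (tp L (sv tau c)) x = tp L c x.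
Proof.
move=> t0; rewrite laplacian_tp -tpZ -tpB; congr (_ x); apply: eq_tp => k _.
have d0 := lt0r_neq0 (den_gt0 k t0).
rewrite -[LHS]/(_ - _) /sv /rs; case: (c k) => a b.
apply/eqP; rewrite eq_complex /=; apply/andP.
by split; apply/eqP; move: (lam k) d0 => l d0; field.
Qed.

Lemma sv_bound (tau B : R) L c : 0 <= tau -> (forall x, `|tp L c x| <= B) ->
  forall x, `|tp L (sv tau c) x| <= B.
Proof.
move=> t0 H; apply: (@max_principle_norm _ _ tau B) => //; first exact: reg_tp.
by move=> x; rewrite tp_sv.
Qed.

Lemma sv_barrier (G g : nat -> int * int -> R[i]) L j (tau sigma gam : R) (n : nat) :
  G 0%N = 0 -> (forall m, G m.+1 = sv tau (G m + rs (fun=> tau) (g m))) ->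
  (forall m x, (m < n)%N -> `|tp L (g m) x| <= gam) -> 0 <= gam ->
  0 <= tau -> 0 < sigma -> n%:R * tau <= sigma ->
  forall x, `|tp L (dcoef j (G n)) x| <= 2 * gam * Num.sqrt sigma.
Proof.
move=> G0 EG gb g0 t0 s0 ns x; rewrite -dd_tp.
apply: (@barrier_bound (fun m => tp L (G m)) (fun m => tp L (g m)) j tau) => //.
- by move=> m; exact: reg_tp.
- by move=> y; rewrite G0 /tp big1// => k _; rewrite mul0r.
- by move=> m y; rewrite EG tp_sv// tpD tpZ.
Qed.

Lemma tp_gradient_bound c L j (sigma gam : R) : 0 < sigma -> 0 <= gam ->
  (forall x, `|tp L c x + sigma * tp L (rs lam c) x| <= gam) ->
  forall x, `|tp L (dcoef j c) x| <= 2 * gam / Num.sqrt sigma.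
Proof.
move=> s0 g0 H x; rewrite -dd_tp; apply: gradient_bound => //; first exact: reg_tp.
move=> y; rewrite laplacian_tp.
have -> : tp L (rs (fun k => - lam k) c) y = - tp L (rs lam c) y.
  rewrite -tpN; congr (_ y); apply: eq_tp => k _.
  by rewrite /rs rmorphN mulNr.
by rewrite mulrN opprK.
Qed.

End Resolvent.

(** * Fourier coefficients and Parseval *)

Section TorusIntegral.
Context {R : realType}.
Implicit Types (f g : R * R -> R) (x : R * R) (j : bool) (c : int * int -> R[i]).

Local Notation T := (measurableTypeR R * measurableTypeR R)%type.
Local Notation mu := (@torus_measure R).
Local Notation leb := (@lebesgue_measure R).

Lemma measurable_phase k : measurable_fun [set: T] (@phase R k : T -> R).
Proof.
rewrite /phase; apply: measurable_funM; first exact: measurable_cst.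
apply: measurable_funD; apply: measurable_funM; try exact: measurable_cst.
  exact: measurable_fst.
exact: measurable_snd.
Qed.

Lemma measurable_cos_phase k b : measurable_fun [set: T] (fun x : T => cos (phase k x + b)).
Proof.
have mc : measurable_fun [set: measurableTypeR R] (@cos R : _ -> measurableTypeR R).
  by apply: continuous_measurable_fun; exact: continuous_cos.
apply: (measurableT_comp mc).
by apply: measurable_funD; [exact: measurable_phase|exact: measurable_cst].
Qed.

Lemma torus_measure_fin : (mu [set: T] < +oo)%E.
Proof. by rewrite torus_measure_setT ltry. Qed.

Lemma torus_integrable f (B : R) : measurable_fun [set: T] (f : T -> R) ->
  (forall x, `|f x| <= B) -> mu.-integrable [set: T] (EFin \o (f : T -> R)).
Proof.
move=> mf bf; apply: measurable_bounded_integrable => //.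
  exact: torus_measure_fin.
exists B; split; first exact: num_real.
by move=> M BM x _; apply: (le_trans (bf x)); exact: ltW.
Qed.

Lemma torus_integralE f (B : R) : measurable_fun [set: T] (f : T -> R) ->
  (forall x, `|f x| <= B) ->
  (\int[mu]_x (f x)%:E = \int[leb]_(s in `[0%R, 1%R[) \int[leb]_(t in `[0%R, 1%R[) (f (s, t))%:E)%E.
Proof.
move=> mf bf; have mC := @measurable_unit_cell R.
have fi := torus_integrable mf bf.
have -> : (\int[mu]_x (f x)%:E = \int[mu]_(x in unit_cell) (f x)%:E)%E.
  rewrite (@negligible_integral _ _ _ mu setT (~` unit_cell) (EFin \o f))//.
  - by rewrite setDE setCK setTI.
  - exact: measurableC.
  - rewrite -[LHS]/((leb \x leb)%E (~` unit_cell `&` unit_cell)).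
    by rewrite setICl measure0.
rewrite (@eq_measure_integral _ _ _ _ (leb \x leb)%E); last first.
  by move=> A mA AC; rewrite /= /torus_measure /mrestr; congr (_ _); apply/setIidl.
have fin2 : ((leb \x leb)%E (@unit_cell R) < +oo)%E.
  have := @torus_measure_setT R; rewrite /torus_measure /mrestr setTI => ->.
  exact: ltry.
have fi2 : (leb \x leb)%E.-integrable unit_cell (EFin \o f).
  apply: measurable_bounded_integrable => //.
    exact: measurable_funS mf.
  exists B; split; first exact: num_real.
  by move=> M BM x _; apply: (le_trans (bf x)); exact: ltW.
rewrite integral_mkcond -integral12_prod_meas1; last first.
  by apply: (integrable_mkcond _ _).1; [exact: mC|exact: fi2].
rewrite [RHS]integral_mkcond; apply: eq_integral => s _.
rewrite [RHS]patchE; case: ifPn => sI.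
  rewrite [RHS]integral_mkcond; apply: eq_integral => t _.
  rewrite !patchE; congr (if _ then _ else _).
  apply/idP/idP; rewrite !inE /unit_cell /=; first by case.
  by move=> ?; split => //; rewrite inE in sI.
apply: integral0_eq => t _; rewrite patchE; case: ifPn => //.
by rewrite inE => -[/= sI' _]; move: sI; rewrite notin_setE /= sI'.
Qed.

(** The shift [b] serves twice: it holds the contribution of the other variable in the double
    integral, and the value [- (pi / 2)] turns the cosine into a sine. *)
Lemma integral_cos_line (a : int) (b : R) : a != 0 ->
  (\int[leb]_(t in `[0%R, 1%R[) (cos (2 * pi * (a%:~R * t) + b))%:E = 0)%E.
Proof.
move=> a0; pose w : R := 2 * pi * a%:~R.
have w0 : w != 0 by rewrite mulf_neq0 ?intr_eq0// mulf_neq0// lt0r_neq0// pi_gt0.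
have E : (fun t : R => cos (2 * pi * (a%:~R * t) + b)) = (fun t => cos (w * t + b)).
  by apply/funext => t; rewrite /w mulrA.
have dl (t : R) : is_derive t 1 (fun t => w * t + b) w.
  apply: (is_derive_eq (is_deriveD (is_deriveZ w (is_derive_id t 1)) (is_derive_cst b t 1))).
  by rewrite scaler_regE mulr1 addr0.
have dc (t : R) : is_derive t 1 (fun t => cos (w * t + b)) (- sin (w * t + b) * w).
  exact: (@is_derive1_comp R cos (fun t => w * t + b) t _ w (is_derive_cos _) (dl t)).
have ds (t : R) : is_derive t 1 (fun t => w^-1 * sin (w * t + b)) (cos (w * t + b)).
  have H := @is_derive1_comp R sin (fun t => w * t + b) t _ w (is_derive_sin _) (dl t).
  apply: (is_derive_eq (is_deriveZ w^-1 H)).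
  by rewrite scaler_regE mulrC mulfK.
have cc : continuous (fun t => cos (w * t + b)).
  by move=> t; apply: differentiable_continuous; apply/derivable1_diffP; case: (dc t).
have cs : continuous (fun t => w^-1 * sin (w * t + b)).
  by move=> t; apply: differentiable_continuous; apply/derivable1_diffP; case: (ds t).
rewrite integral_itv_bndo_bndc; last first.
  apply/measurable_EFinP; apply: measurable_funTS; rewrite E.
  exact: continuous_measurable_fun.
under eq_integral do rewrite mulrA -/w.
rewrite (@continuous_FTC2 _ _ (fun t => w^-1 * sin (w * t + b)))//.
- rewrite mulr0 mulr1 add0r.
  have -> : sin (w + b) = sin b.
    by rewrite /w addrC sinD cos_2pi_int sin_2pi_int mulr1 mulr0 addr0.
  by rewrite subee.
- exact: continuous_subspaceT.
- split.
  + by move=> t _; case: (ds t).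
  + exact: cvg_at_right_filter (cs 0).
  + exact: cvg_at_left_filter (cs 1).
- by move=> t _; rewrite derive1E; case: (ds t).
Qed.

Lemma integral_cos_phase k b : k != 0 -> (\int[mu]_x (cos (phase k x + b))%:E = 0)%E.
Proof.
move=> k0; rewrite (@torus_integralE (fun x => cos (phase k x + b)) 1); first last.
- by move=> x; rewrite ler_norml cos_geN1 cos_le1.
- exact: measurable_cos_phase.
have [k20|k20] := eqVneq k.2 0.
  have k10 : k.1 != 0.
    by apply: contra_neq k0 => k10; apply/eqP; rewrite /eq_op /= k10 k20 eqxx.
  rewrite -[RHS](@integral_cos_line k.1 b k10); apply: eq_integral => s _.
  under eq_integral do rewrite /phase /= k20 mul0r addr0.
  rewrite integral_cst//= lebesgue_measure_itv /= lte_fin ltr01.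
  by rewrite oppr0 adde0 mule1.
rewrite integral0_eq// => s _.
rewrite -[RHS](@integral_cos_line k.2 (2 * pi * (k.1%:~R * s) + b) k20).
apply: eq_integral => t _; congr (cos _)%:E; rewrite /phase /=; ring.
Qed.

Lemma Rintegral_cos_phase k : (\int[mu]_x cos (phase k x))%R = (k == 0)%:R.
Proof.
have [->|k0] := eqVneq k 0.
  have E : (fun x : T => cos (phase 0 x)) = cst (1 : R).
    by apply/funext => x; rewrite /phase /= !mul0r addr0 mulr0 cos0.
  rewrite E Rintegral_cst// mul1r -[RHS]/(fine 1%E); congr fine.
  exact: torus_measure_setT.
rewrite /Rintegral -[RHS]/(fine 0%E) -(integral_cos_phase 0 k0).
by congr fine; apply: eq_integral => x _; rewrite addr0.
Qed.

Lemma Rintegral_sin_phase k : (\int[mu]_x sin (phase k x))%R = 0.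
Proof.
have [->|k0] := eqVneq k 0.
  have E : (fun x : T => sin (phase 0 x)) = cst (0 : R).
    by apply/funext => x; rewrite /phase /= !mul0r addr0 mulr0 sin0.
  by rewrite E Rintegral_cst// mul0r.
rewrite /Rintegral -[RHS]/(fine 0%E) -(integral_cos_phase (- (pi / 2)) k0).
by congr fine; apply: eq_integral => x _; rewrite -cosBpihalf.
Qed.

Lemma measurable_tp L c : measurable_fun [set: T] (tp L c : T -> R).
Proof.
rewrite /tp; apply: measurable_sum => k.
case: (c k) => a b /=; apply: measurable_funB; apply: measurable_funM;
  try exact: measurable_cst.
  have := measurable_cos_phase k 0.
  by under [X in measurable_fun _ X]eq_fun do rewrite addr0.
have := measurable_cos_phase k (- (pi / 2)).
by under [X in measurable_fun _ X]eq_fun do rewrite cosBpihalf.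
Qed.

Lemma tp_bound L c x : `|tp L c x| <= \sum_(k <- box L) cmod (c k).
Proof.
rewrite (le_trans (ler_norm_sum _ _ _))//; apply: ler_sum => k _.
by rewrite (le_trans (normRe_le _))// cmodM cmod_expi mulr1.
Qed.

Lemma integrable_tp L c : mu.-integrable [set: T] (EFin \o (tp L c : T -> R)).
Proof. exact: (torus_integrable (measurable_tp L c) (tp_bound L c)). Qed.

Lemma Rintegral_sum (I : Type) (r : seq I) (F : I -> T -> R) :
  (forall i, mu.-integrable [set: T] (EFin \o F i)) ->
  (\int[mu]_x (\sum_(i <- r) F i x))%R = \sum_(i <- r) (\int[mu]_x F i x)%R /\
  mu.-integrable [set: T] (EFin \o (fun x => \sum_(i <- r) F i x)).
Proof.
move=> H; elim: r => [|a r [IH1 IH2]].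
  rewrite big_nil; have E : (fun x : T => \sum_(i <- [::]) F i x) = cst 0.
    by apply/funext => x; rewrite big_nil.
  rewrite E; split; first by rewrite Rintegral_cst// mul0r.
  apply: (@torus_integrable (cst 0) 0); first exact: measurable_cst.
  by move=> x; rewrite normr0.
have E : (fun x : T => \sum_(i <- a :: r) F i x) = (fun x => F a x + \sum_(i <- r) F i x).
  by apply/funext => x; rewrite big_cons.
rewrite E big_cons; split; first by rewrite RintegralD// IH1.
by have := integrableD measurableT (H a) IH2; apply: eq_integrable.
Qed.

Lemma integrable_mode (z : R[i]) k :
  mu.-integrable [set: T] (EFin \o (fun x : T => complex.Re (z * expi_mode k x))).
Proof.
apply: (@torus_integrable _ (cmod z)).
  case: z => a b /=; apply: measurable_funB; apply: measurable_funM;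
    try exact: measurable_cst.
    have := measurable_cos_phase k 0.
    by under [X in measurable_fun _ X]eq_fun do rewrite addr0.
  have := measurable_cos_phase k (- (pi / 2)).
  by under [X in measurable_fun _ X]eq_fun do rewrite cosBpihalf.
by move=> x; rewrite (le_trans (normRe_le _))// cmodM cmod_expi mulr1.
Qed.

Lemma Rintegral_mode (z : R[i]) k :
  (\int[mu]_x complex.Re (z * expi_mode k x))%R = (k == 0)%:R * complex.Re z.
Proof.
have ic : mu.-integrable [set: T] (EFin \o (fun x : T => cos (phase k x))).
  have := integrable_mode 1 k; rewrite (_ : (fun _ => _) = (fun x : T => cos (phase k x)))//.
  by apply/funext => x; rewrite mul1r.
have is_ : mu.-integrable [set: T] (EFin \o (fun x : T => sin (phase k x))).
  have := integrable_mode (0 -i* 1) k.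
  rewrite (_ : (fun _ => _) = (fun x : T => sin (phase k x)))//.
  by apply/funext => x /=; rewrite mul0r mulN1r opprK add0r.
case: z => a b /=.
rewrite RintegralB//; last 2 first.
- exact: (@integrableZl _ _ _ mu setT measurableT a _ ic).
- exact: (@integrableZl _ _ _ mu setT measurableT b _ is_).
rewrite !RintegralZl// Rintegral_cos_phase Rintegral_sin_phase mulr0 subr0.
by rewrite mulrC.
Qed.

Lemma Rintegral_tp L c : (\int[mu]_x tp L c x)%R = complex.Re (c 0).
Proof.
rewrite /tp (Rintegral_sum _ (fun k => integrable_mode (c k) k)).1.
rewrite (eq_bigr (fun k => (k == 0)%:R * complex.Re (c k))); last first.
  by move=> k _; exact: Rintegral_mode.
rewrite (bigD1_seq 0) ?box_uniq ?box0// eqxx mul1r big1; first exact: addr0.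
by move=> k /negbTE ->; rewrite mul0r.
Qed.

End TorusIntegral.

Section TrigonometricPolynomials.
Context {R : realType}.
Implicit Types (f g : R * R -> R) (x : R * R) (j : bool) (a b c : int * int -> R[i]).

Local Notation T := (measurableTypeR R * measurableTypeR R)%type.
Local Notation mu := (@torus_measure R).

Definition herm c := forall k, c (- k) = ((c k)^*)%C.

Lemma expi_modeDk k l x : expi_mode (k + l) x = expi_mode k x * expi_mode l x :> R[i].
Proof.
have E : phase (k + l) x = phase k x + phase l x.
  by rewrite /phase /= !intrD; ring.
rewrite /expi_mode E cosD sinD.
by apply/eqP; rewrite eq_complex /= [X in _ && (X == _)]addrC !eqxx.
Qed.

Lemma modes_mul (z w : R[i]) l k x :
  complex.Re (z * expi_mode l x) * complex.Re (w * expi_mode k x) =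
  complex.Re (2^-1%:C * (z * w) * expi_mode (l + k) x) +
  complex.Re (2^-1%:C * (z * (w^*)%C) * expi_mode (l - k) x).
Proof.
rewrite !expi_modeDk expi_modeN.
case: z w (expi_mode l x) (expi_mode k x) => z1 z2 [w1 w2] [a1 a2] [b1 b2] /=.
by field.
Qed.

Lemma Rintegral_tp_mode L c (w : R[i]) k : herm c -> k \in box L ->
  (\int[mu]_x (tp L c x * complex.Re (w * expi_mode k x)))%R = complex.Re (c k * (w^*)%C).
Proof.
move=> hc kL.
have E : (fun x => tp L c x * complex.Re (w * expi_mode k x)) = (fun x =>
  \sum_(l <- box L) (complex.Re (2^-1%:C * (c l * w) * expi_mode (l + k) x) +
  complex.Re (2^-1%:C * (c l * (w^*)%C) * expi_mode (l - k) x))).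
  by apply/funext => x; rewrite /tp mulr_suml; apply: eq_bigr => l _; exact: modes_mul.
rewrite E (Rintegral_sum _ _).1; last first.
  move=> l; have := integrableD measurableT
    (integrable_mode (2^-1%:C * (c l * w)) (l + k))
    (integrable_mode (2^-1%:C * (c l * (w^*)%C)) (l - k)).
  by apply: eq_integrable.
have E2 l : (\int[mu]_x (complex.Re (2^-1%:C * (c l * w) * expi_mode (l + k) x) +
  complex.Re (2^-1%:C * (c l * (w^*)%C) * expi_mode (l - k) x)))%R =
  (l == - k)%:R * complex.Re (2^-1%:C * (c l * w)) +
  (l == k)%:R * complex.Re (2^-1%:C * (c l * (w^*)%C)).
  rewrite RintegralD//; try exact: integrable_mode.
  by rewrite !Rintegral_mode addr_eq0 subr_eq0.
rewrite (eq_bigr _ (fun l _ => E2 l)) big_split /=.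
have sel (g : int * int -> R) m : m \in box L ->
    \sum_(l <- box L) (l == m)%:R * g l = g m.
  move=> mL; rewrite (bigD1_seq m) ?box_uniq// eqxx mul1r big1; first exact: addr0.
  by move=> l /negbTE ->; rewrite mul0r.
rewrite (sel (fun l => complex.Re (2^-1%:C * (c l * w)))) ?mem_boxN//.
rewrite (sel (fun l => complex.Re (2^-1%:C * (c l * (w^*)%C))))// hc.
by case: (c k) w {E E2 sel} => c1 c2 [w1 w2] /=; field.
Qed.

Lemma fourier_coef_tp L c k : herm c -> k \in box L -> fourier_coef (tp L c) k = c k.
Proof.
move=> hc kL; rewrite /fourier_coef.
have -> : (fun x => tp L c x * cos (phase k x)) =
    (fun x => tp L c x * complex.Re (1 * expi_mode k x)).
  by apply/funext => x; rewrite mul1r.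
have -> : (fun x => tp L c x * sin (phase k x)) =
    (fun x => tp L c x * complex.Re ((0 -i* 1) * expi_mode k x)).
  by apply/funext => x /=; rewrite mul0r mulN1r opprK add0r.
rewrite !Rintegral_tp_mode//; case: (c k) => c1 c2 /=.
by apply/eqP; rewrite eq_complex /=; apply/andP; split; apply/eqP; ring.
Qed.

Definition conv (L : nat) a b k : R[i] := \sum_(l <- box L) a l * b (k - l).

Lemma tp_im0 L c x : herm c -> complex.Im (\sum_(k <- box L) c k * expi_mode k x) = 0.
Proof.
move=> hc; set S := \sum_(_ <- _) _.
have : (S^*)%C = S.
  rewrite /S -[RHS]sum_box_opp rmorph_sum; apply: eq_bigr => k _.
  by rewrite hc expi_modeN rmorphM.
case: S => p q [/= h]; lra.
Qed.

Lemma tp_Re L c x : tp L c x = complex.Re (\sum_(k <- box L) c k * expi_mode k x).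
Proof. by rewrite cRe_sum. Qed.

(** Hermitian symmetry of [a] makes the first sum real, which is why the product of the real parts
    is the real part of the product. *)
Lemma tp_mul L M a b x : herm a -> supp M b ->
  tp L a x * tp M b x = tp (L + M) (conv L a b) x.
Proof.
move=> ha sb; rewrite !tp_Re.
set A := \sum_(_ <- _) _; set B := \sum_(_ <- _) _.
have -> : complex.Re A * complex.Re B = complex.Re (A * B).
  by rewrite cReM tp_im0// mul0r subr0.
congr complex.Re; rewrite /A /B big_distrl /=.
transitivity (\sum_(k <- box (L + M)) \sum_(l <- box L) a l * b (k - l) * expi_mode k x).
  rewrite exchange_big /=; apply: eq_big_seq => l lL.
  rewrite big_distrr /=.
  rewrite -(@sum_box_shift _ (L + M) M L l (fun m => a l * expi_mode l x * (b m * expi_mode m x)))//.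
  - apply: eq_bigr => k _; have -> : expi_mode k x = expi_mode l x * expi_mode (k - l) x :> R[i].
      by rewrite -expi_modeDk addrC subrK.
    by rewrite mulrACA mulrA.
  - by move=> k kM; rewrite sb// mul0r mulr0.
  - by rewrite addnC.
by apply: eq_bigr => k _; rewrite /conv mulr_suml.
Qed.

Lemma herm_conv L a b : herm a -> herm b -> herm (conv L a b).
Proof.
move=> ha hb k; rewrite /conv rmorph_sum -sum_box_opp; apply: eq_bigr => l _.
by rewrite rmorphM ha -[- k - - l]opprD hb.
Qed.

Lemma supp_conv L M a b : supp M b -> supp (L + M) (conv L a b).
Proof.
move=> sb k kLM; rewrite /conv big1_seq// => l /= lL.
rewrite sb ?mulr0//; apply: contra kLM => klM.
by rewrite -(subrK l k) addnC; apply: mem_boxD.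
Qed.

Lemma parseval L c : herm c -> supp L c ->
  (\int[mu]_x (tp L c x * tp L c x))%R = \sum_(k <- box L) cmod (c k) ^+ 2.
Proof.
move=> hc sc.
have -> : (fun x : T => tp L c x * tp L c x) = tp (L + L) (conv L c c).
  by apply/funext => x; rewrite tp_mul.
rewrite Rintegral_tp /conv cRe_sum; apply: eq_bigr => k _.
by rewrite sub0r hc cmod_sqr; case: (c k) => p q /=; ring.
Qed.

(** The passage from a pointwise velocity bound to an L2 bound on the coefficients of the flux. *)
Lemma parseval_le L M c p (V : R) : herm c -> supp L c -> herm p -> supp M p ->
  (forall x, `|tp M p x| <= V * `|tp L c x|) ->
  \sum_(k <- box M) cmod (p k) ^+ 2 <= V ^+ 2 * \sum_(k <- box L) cmod (c k) ^+ 2.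
Proof.
move=> hc sc hp sp H; rewrite -!parseval//.
have sq N q : supp N q -> herm q -> mu.-integrable [set: T] (EFin \o (fun x : T => tp N q x * tp N q x)).
  move=> sq hq; have := integrable_tp (N + N) (conv N q q).
  by rewrite (_ : (tp (N + N) (conv N q q) : T -> R) = fun x : T => tp N q x * tp N q x)//;
    apply/funext => x; rewrite tp_mul.
rewrite -RintegralZl//; last exact: sq.
apply: le_Rintegral => //.
- exact: sq.
- exact: (integrableZl _ (V ^+ 2) (sq L c sc hc)).
move=> x _; rewrite -!expr2 -(real_normK (num_real (tp M p x))).
rewrite -(real_normK (num_real (tp L c x))) -exprMn.
by rewrite lerXn2r ?nnegrE// (le_trans _ (H x)).
Qed.

Lemma parseval_sup M p (V : R) : herm p -> supp M p ->
  (forall x, `|tp M p x| <= V) -> \sum_(k <- box M) cmod (p k) ^+ 2 <= V ^+ 2.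
Proof.
move=> hp sp H.
(* The coefficients of the constant function 1, with which [p] is compared. *)
pose c (k : int * int) : R[i] := (k == 0)%:R.
have hc : herm c by move=> k; rewrite /c eqr_oppLR oppr0 rmorph_nat.
have sc : supp 0 c.
  by move=> k k0; rewrite /c; case: eqVneq k0 => // ->; rewrite box0.
have := @parseval_le 0 M c p V hc sc hp sp.
have b0 : box 0 = [:: 0] by [].
have c0 : c 0 = 1 by rewrite /c eqxx.
have m1 : cmod (1 : R[i]) = 1 by rewrite /cmod ComplexField.Normc.normc1.
rewrite b0 !big_cons !big_nil c0 m1 addr0 expr1n mulr1; apply => x.
rewrite [tp 0 c x](_ : _ = 1) ?normr1 ?mulr1//.
rewrite /tp b0 big_cons big_nil c0 mul1r addr0 /=.
by rewrite /phase /= !mul0r addr0 mulr0 cos0.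
Qed.

End TrigonometricPolynomials.

(** * Truncation in the supremum norm *)

Section LinftyData.
Context {R : realType}.
Implicit Types (f g : R * R -> R) (x : R * R).

Local Notation T := (measurableTypeR R * measurableTypeR R)%type.
Local Notation mu := (@torus_measure R).

Lemma Linfty_normE f : Linfty_norm f = ess_sup mu (abse \o (EFin \o f)).
Proof.
rewrite /Linfty_norm unlock /=.
have -> : (0%E < mu [set: T])%E by rewrite torus_measure_setT.
by [].
Qed.

Lemma Linfty_ae f (M : R) : Linfty_norm f = M%:E -> {ae mu, forall x, `|f x| <= M}.
Proof.
move=> fM; have := @ess_sup_ge _ _ _ mu (abse \o (EFin \o f)).
rewrite -Linfty_normE fM; apply: filterS => x /=.
by rewrite lee_fin.
Qed.

Lemma Linfty_norm_le g (B : R) : (forall x, `|g x| <= B) -> (Linfty_norm g <= B%:E)%E.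
Proof.
move=> gB; rewrite Linfty_normE; apply/ess_supP; apply: aeW => x; rewrite /comp /=.
by rewrite lee_fin.
Qed.

(** An excess over [A] at a point [x] of the cell persists, by continuity, on a square with lower
    corner [x]. For small [e1] this square stays inside the half-open cell, and its measure is
    positive. *)
Lemma Linfty_norm_ge g (A : R) : torus_periodic g -> continuous g ->
  Linfty_norm g = A%:E -> forall x, `|g x| <= A.
Proof.
move=> pg cg gA x0.
rewrite -(periodic_int (- Num.floor x0.1) (- Num.floor x0.2) x0 pg).
set x := (_, _).
have F (y : R) : 0 <= y + (- Num.floor y)%:~R < 1.
  rewrite mulrNz; have := floor_le_tmp y; have := floorD1_gt y.
  by rewrite intrD => h1 h2; apply/andP; split; lra.
have /andP[a0 a1] := F x0.1; have /andP[b0 b1] := F x0.2.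
rewrite leNgt; apply/negP => Ax.
have cn : continuous (fun y => `|g y|).
  by move=> y; apply: cvg_norm; exact: cg.
have /= : \forall y \near x, A < `|g y| by apply: (cvgr_gt _ (cn x)).
move=> /nbhs_ballP[e /= e0 He].
pose e1 := Num.min e (Num.min (1 - x.1) (1 - x.2)).
have e10 : 0 < e1 by rewrite !lt_min e0 !subr_gt0 a1 b1.
have e1e : e1 <= e by rewrite ge_min lexx.
have e1a : e1 <= 1 - x.1 by rewrite !ge_min lexx !orbT.
have e1b : e1 <= 1 - x.2 by rewrite !ge_min lexx !orbT.
have [N [mN N0 HN]] := Linfty_ae gA.
pose Q : set T := `[x.1, x.1 + e1[%classic `*` `[x.2, x.2 + e1[%classic.
have mQ : measurable Q by exact: measurableX.
have QN : Q `<=` N.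
  move=> y [/=]; rewrite !in_itv /= => /andP[y1 y2] /andP[y3 y4].
  apply: HN => /= H; have : A < `|g y|.
    apply: He; split => /=; rewrite /ball /= ltr_norml; apply/andP; split;
    move: e10 e1e y1 y2 y3 y4; clear; move: x.1 x.2 y.1 y.2 => *; lra.
  by rewrite ltNge H.
have QC : Q `<=` unit_cell.
  move=> y [/=]; rewrite /unit_cell /= !in_itv /= => /andP[y1 y2] /andP[y3 y4].
  move: e1a e1b a0 b0; rewrite /x /=; move: (x0.1 + _) (x0.2 + _) y1 y2 y3 y4.
  move=> p q; rewrite /x /= => *.
  split; apply/andP; split; lra.
have : (mu Q <= mu N)%E by apply: le_measure => //; rewrite inE.
have -> : mu Q = (e1 * e1)%:E.
  have -> : mu Q = (lebesgue_measure \x lebesgue_measure)%E (Q `&` unit_cell) by [].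
  rewrite (setIidl QC) product_measure1E//= !lebesgue_measure_itv /= !lte_fin.
  rewrite !ltrDl e10 -!EFinB -EFinM; congr (_%:E).
  by move: x.1 x.2 => p q; ring.
by rewrite N0 lee_fin leNgt mulr_gt0.
Qed.

Lemma Lfun_measurable f : torus_Linfty f -> measurable_fun [set: T] (f : T -> R).
Proof. by move=> [_ /andP[+ _]]; rewrite inE. Qed.

End LinftyData.

(** * De la Vallee Poussin sums of bounded data *)

Section DeLaValleePoussin.
Context {R : realType}.
Local Notation T := (measurableTypeR R * measurableTypeR R)%type.
Local Notation mu := (@torus_measure R).

Lemma conjcZ (a : R) (z : R[i]) : ((a%:C * z)^*)%C = a%:C * (z^*)%C.
Proof.
case: z => p q; apply/eqP; rewrite eq_complex /=.
by apply/andP; split; apply/eqP; ring.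
Qed.

Section Data.
Variables (f : R * R -> R) (M : R).
Hypotheses (mf : measurable_fun [set: T] (f : T -> R)) (M0 : 0 <= M)
  (fM : {ae mu, forall x, `|f x| <= M}).

Lemma integrable_mul_bounded (K : R * R -> R) (B : R) :
  measurable_fun [set: T] (K : T -> R) -> (forall x, `|K x| <= B) ->
  mu.-integrable [set: T] (EFin \o (fun x : T => f x * K x)).
Proof.
move=> mK KB; have mfK : measurable_fun [set: T] (fun x : T => f x * K x).
  exact: measurable_funM.
have B0 : 0 <= B by exact: le_trans (KB 0).
apply/integrableP; split; first exact/measurable_EFinP.
apply: (@le_lt_trans _ _ (\int[mu]_x (M * B)%:E)%E).
  apply: ae_ge0_le_integral => //.
  - by apply: measurableT_comp => //; exact/measurable_EFinP.
  - by move=> x _; rewrite lee_fin mulr_ge0.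
  - have [N [mN N0 HN]] := fM; exists N; split => // x /= nH.
    by apply: HN => /= H; apply: nH => _; rewrite lee_fin normrM ler_pM.
rewrite integral_cst//=; apply: lte_mul_pinfty; rewrite ?lee_fin ?mulr_ge0//.
exact: torus_measure_fin.
Qed.

Lemma Rintegral_mul_bound (K H : R * R -> R) (B : R) :
  measurable_fun [set: T] (K : T -> R) -> measurable_fun [set: T] (H : T -> R) ->
  (forall x, `|K x| <= H x) -> (forall x, H x <= B) ->
  `|(\int[mu]_x (f x * K x))%R| <= M * (\int[mu]_x H x)%R.
Proof.
move=> mK mH KH HB.
have H0 x : 0 <= H x by exact: le_trans (KH x).
have ifK := integrable_mul_bounded mK (fun x => le_trans (KH x) (HB x)).
have iH : mu.-integrable [set: T] (EFin \o (H : T -> R)).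
  by apply: (torus_integrable mH (B := B)) => x; rewrite ger0_norm.
rewrite -RintegralZl//.
apply: (le_trans (le_normr_Rintegral measurableT ifK)).
rewrite /Rintegral fine_le//.
- by apply: integrable_fin_num => //; have := integrable_abse ifK; apply: eq_integrable.
- by apply: integrable_fin_num => //; exact: (integrableZl measurableT M iH).
apply: ae_ge0_le_integral => //.
- apply/measurable_EFinP; apply: measurableT_comp => //; exact: measurable_funM.
- by move=> x _; rewrite lee_fin mulr_ge0.
- by apply/measurable_EFinP; apply: measurable_funM => //; exact: measurable_cst.
- have [N [mN N0 HN]] := fM; exists N; split => // x /= nH.
  by apply: HN => /= h; apply: nH => _; rewrite lee_fin normrM ler_pM.
Qed.

Lemma measurable_mode (z : R[i]) k :
  measurable_fun [set: T] (fun x : T => complex.Re (z * expi_mode k x)).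
Proof. by apply/measurable_EFinP; have /integrableP[] := integrable_mode z k. Qed.

Lemma mode_le (z : R[i]) k x : `|complex.Re (z * expi_mode k x)| <= cmod z.
Proof. by rewrite (le_trans (normRe_le _))// cmodM cmod_expi mulr1. Qed.

Lemma Rintegral_data_mode k x :
  (\int[mu]_y (f y * complex.Re (expi_mode k x * expi_mode (- k) y)))%R =
  complex.Re (fourier_coef f k * expi_mode k x).
Proof.
have ic : mu.-integrable [set: T] (EFin \o (fun y : T => f y * cos (phase k y))).
  have := integrable_mul_bounded (@measurable_mode 1 k) (mode_le 1 k).
  by apply: eq_integrable => // y _ /=; rewrite mul1r mul0r subr0.
have is_ : mu.-integrable [set: T] (EFin \o (fun y : T => f y * sin (phase k y))).
  have := integrable_mul_bounded (@measurable_mode (0 -i* 1) k) (mode_le _ k).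
  by apply: eq_integrable => // y _ /=; rewrite mul0r mulN1r opprK add0r.
have E : (fun y : T => f y * complex.Re (expi_mode k x * expi_mode (- k) y)) =
    (fun y => cos (phase k x) * (f y * cos (phase k y)) + sin (phase k x) * (f y * sin (phase k y))).
  by apply/funext => y; rewrite expi_modeN /=; ring.
rewrite E RintegralD//; last 2 first.
- exact: (integrableZl measurableT (cos (phase k x)) ic).
- exact: (integrableZl measurableT (sin (phase k x)) is_).
by rewrite !RintegralZl// /fourier_coef /=; ring.
Qed.

Let E m x : T -> R := fun y => complex.Re (expi_mode m x * expi_mode (- m) y).
Let P (J : seq (int * int)) x y : R[i] := \sum_(j <- J) expi_mode j x * expi_mode (- j) y.

(** [P J] is the Dirichlet kernel of [J] at [x - y]; a product of one such kernel with the conjugate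
    of another contains exactly the modes [j - i]. *)
Lemma double_mode_sum (J1 J2 : seq (int * int)) x y :
  \sum_(j <- J1) \sum_(i <- J2) E (j - i) x y = complex.Re (P J1 x y * ((P J2 x y)^*)%C).
Proof.
have H k : ((expi_mode k x * expi_mode (- k) y)^*)%C = expi_mode (- k) x * expi_mode k y :> R[i].
  rewrite !expi_modeN; case: (expi_mode k x) (expi_mode k y) => a b [c d].
  by apply/eqP; rewrite eq_complex /=; apply/andP; split; apply/eqP; ring.
rewrite /P rmorph_sum big_distrl cRe_sum; apply: eq_bigr => j _.
rewrite big_distrr cRe_sum; apply: eq_bigr => k _.
rewrite [X in _ = complex.Re (_ * X)](H k) /E; congr complex.Re.
by rewrite opprD opprK !expi_modeDk mulrACA.
Qed.

Lemma Rintegral_data_double (J1 J2 : seq (int * int)) x :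
  (\int[mu]_y (f y * \sum_(j <- J1) \sum_(i <- J2) E (j - i) x y))%R =
  \sum_(j <- J1) \sum_(i <- J2) complex.Re (fourier_coef f (j - i) * expi_mode (j - i) x).
Proof.
have iE m : mu.-integrable [set: T] (EFin \o (fun y : T => f y * E m x y)).
  exact: integrable_mul_bounded (measurable_mode _ _) (mode_le _ _).
have -> : (fun y : T => f y * \sum_(j <- J1) \sum_(i <- J2) E (j - i) x y) =
    (fun y => \sum_(j <- J1) \sum_(i <- J2) f y * E (j - i) x y).
  apply/funext => y; rewrite mulr_sumr; apply: eq_bigr => j _.
  by rewrite mulr_sumr.
rewrite (Rintegral_sum _ _).1; last by move=> j; exact: (Rintegral_sum _ _).2.
apply: eq_bigr => j _; rewrite (Rintegral_sum _ _).1//.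
by apply: eq_bigr => k _; exact: Rintegral_data_mode.
Qed.

Lemma Rintegral_double (J : seq (int * int)) x : uniq J ->
  (\int[mu]_y (\sum_(j <- J) \sum_(i <- J) E (j - i) x y))%R = (size J)%:R.
Proof.
move=> uJ; have iE m : mu.-integrable [set: T] (EFin \o E m x).
  exact: integrable_mode.
rewrite (Rintegral_sum _ _).1; last by move=> j; exact: (Rintegral_sum _ _).2.
have H j : j \in J -> (\int[mu]_y (\sum_(i <- J) E (j - i) x y))%R = 1.
  move=> jJ; rewrite (Rintegral_sum _ _).1//.
  rewrite (bigD1_seq j)//= big1; last first.
    move=> k kj; rewrite Rintegral_mode oppr_eq0 subr_eq0 eq_sym (negbTE kj).
    by rewrite mul0r.
  rewrite subrr Rintegral_mode oppr0 eqxx mul1r.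
  by rewrite /expi_mode /phase /= !mul0r !addr0 mulr0 cos0.
rewrite (eq_big_seq _ H) big_const_seq count_predT.
by elim: (size J) => //= n ->; rewrite -natr1 addrC.
Qed.

Lemma measurable_double (J1 J2 : seq (int * int)) x :
  measurable_fun [set: T] (fun y : T => \sum_(j <- J1) \sum_(i <- J2) E (j - i) x y).
Proof.
by apply: measurable_sum => j; apply: measurable_sum => k; exact: measurable_mode.
Qed.

(** The pointwise inequality [a * b <= a ^ 2 / 4 + b ^ 2] does the work of Cauchy-Schwarz, since the
    integral of [|P J| ^ 2] is exactly [size J]. The weight [1 / 4] suits two boxes whose sizes have
    a ratio close to 4. *)
Lemma double_sum_bound (J1 J2 : seq (int * int)) x : uniq J1 -> uniq J2 ->
  `|\sum_(j <- J1) \sum_(i <- J2) complex.Re (fourier_coef f (j - i) * expi_mode (j - i) x)|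
  <= M * ((size J1)%:R / 4 + (size J2)%:R).
Proof.
move=> u1 u2; rewrite -Rintegral_data_double.
pose D J y : R := \sum_(j <- J) \sum_(i <- J) E (j - i) x y.
have mD J : measurable_fun [set: T] (D J : T -> R) by exact: measurable_double.
have D_E J y : D J y = cmod (P J x y) ^+ 2.
  rewrite /D double_mode_sum; case: (P J x y) => a b.
  by rewrite cmod_sqr /=; ring.
have D0 J y : 0 <= D J y by rewrite D_E sqr_ge0.
have Pb J y : cmod (P J x y) <= (size J)%:R.
  rewrite (le_trans (cmod_sum _ _ _))//.
  rewrite (eq_bigr (fun=> 1)); last by move=> k _; rewrite cmodM !cmod_expi mulr1.
  rewrite big_const_seq count_predT.
  by elim: (size J) => //= n IH; rewrite -natr1 addrC lerD2r.
have Db J y : D J y <= (size J)%:R ^+ 2.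
  by rewrite D_E lerXn2r ?nnegrE ?cmod_ge0.
have iD J : mu.-integrable [set: T] (EFin \o (D J : T -> R)).
  by apply: (torus_integrable (mD J) (B := (size J)%:R ^+ 2)) => y; rewrite ger0_norm.
have -> : (size J1)%:R / 4 + (size J2)%:R = (\int[mu]_y (4^-1 * D J1 y + D J2 y))%R.
  rewrite RintegralD//; last exact: (integrableZl measurableT 4^-1 (iD J1)).
  by rewrite RintegralZl// /D !Rintegral_double// mulrC.
apply: (@Rintegral_mul_bound _ _ (4^-1 * (size J1)%:R ^+ 2 + (size J2)%:R ^+ 2)).
- exact: measurable_double.
- by apply: measurable_funD => //; apply: measurable_funM => //; exact: measurable_cst.
- move=> y; rewrite double_mode_sum (le_trans (normRe_le _))// cmodM cmodJ !D_E.
  set a := cmod (P J1 x y); set b := cmod (P J2 x y).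
  rewrite -subr_ge0; have -> : 4^-1 * a ^+ 2 + b ^+ 2 - a * b = (2^-1 * a - b) ^+ 2 by field.
  exact: sqr_ge0.
- by move=> y; rewrite lerD// ler_wpM2l// invr_ge0.
Qed.

(* The kernel [p1 * conj p2 / #|box N|], with [p1], [p2] the Dirichlet kernels
   of [box 2N] and [box N], has L1 norm at most 2 by Cauchy-Schwarz. *)
Lemma vallee_poussin (N : nat) : exists F : int * int -> R[i],
  [/\ herm F, supp (3 * N) F, (forall k, k \in box N -> F k = fourier_coef f k) &
      forall x, `|tp (3 * N) F x| <= 2 * M].
Proof.
pose n2 : R := (size (box N))%:R.
have n20 : 0 < n2 by rewrite /n2 ltr0n size_box expn_gt0.
(* The proportion of the shifts of [k] by [box N] that fall in [box (2 * N)]: it is 1 on [box N] and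
   0 off [box (3 * N)]. *)
pose v k : R := n2^-1 * \sum_(i <- box N) (k + i \in box (2 * N))%:R.
exists (fun k => (v k)%:C * fourier_coef f k); split.
- move=> k; rewrite fourier_coefN conjcZ; congr (_%:C * _).
  rewrite /v -sum_box_opp; congr (_ * _); apply: eq_bigr => m _.
  by rewrite -opprD mem_boxN.
- move=> k kN; rewrite /v big1_seq ?mulr0 ?mul0r// => m /andP[_ mN].
  case: (boolP (k + m \in _)) => // kmN; case/negP: kN.
  rewrite -(addrK m k) mulSn addnC; apply: mem_boxD => //.
  by rewrite mem_boxN.
- move=> k kN; rewrite /v (eq_big_seq (fun=> 1)); last first.
    by move=> m mN; rewrite mul2n -addnn mem_boxD.
  rewrite big_const_seq count_predT.
  have -> : iter (size (box N)) (+%R 1) 0 = n2.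
    by rewrite /n2; elim: (size _) => //= n ->; rewrite -natr1 addrC.
  by rewrite mulVf ?lt0r_neq0// mul1r.
move=> x; pose G k := complex.Re (fourier_coef f k * expi_mode k x).
have -> : tp (3 * N) (fun k => (v k)%:C * fourier_coef f k) x =
    n2^-1 * \sum_(j <- box (2 * N)) \sum_(i <- box N) G (j - i).
  rewrite exchange_big /=.
  have S i : i \in box N -> \sum_(j <- box (2 * N)) G (j - i) =
      \sum_(k <- box (3 * N)) (k + i \in box (2 * N))%:R * G k.
    move=> iN.
    rewrite -(@sum_box_shift _ (4 * N) (3 * N) N i (fun k => (k + i \in box (2 * N))%:R * G k))//.
    - transitivity (\sum_(j <- box (2 * N)) (j \in box (2 * N))%:R * G (j - i)).
        by apply: eq_big_seq => j ->; rewrite mul1r.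
      rewrite -(@sum_box_widen _ (2 * N) (4 * N) (fun j => (j \in box (2 * N))%:R * G (j - i))).
      + by apply: eq_bigr => j _; rewrite subrK.
      + by move=> j /negbTE ->; rewrite mul0r.
      + by rewrite leq_mul2r orbT.
    - move=> k kN; case: (boolP (k + i \in _)) => [kiN|_]; last by rewrite mul0r.
      case/negP: kN; rewrite -(addrK i k) mulSn addnC; apply: mem_boxD => //.
      by rewrite mem_boxN.
    - by rewrite -mulSnr.
  rewrite (eq_big_seq _ S) exchange_big /= mulr_sumr; apply: eq_bigr => k _.
  by rewrite -mulrA cReZ /v -mulrA mulr_suml.
rewrite normrM gtr0_norm ?invr_gt0// mulrC ler_pdivrMr//.
apply: (le_trans (double_sum_bound x (box_uniq _) (box_uniq _))).
rewrite [leRHS]mulrAC [leRHS]mulrC ler_wpM2l// -/n2.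
suff : (size (box (2 * N)))%:R <= 4 * n2 by lra.
rewrite /n2 -natrM ler_nat !size_box -mulnn -[in leqRHS]mulnn.
by lia.
Qed.

End Data.
End DeLaValleePoussin.

(** * The truncation operator in the supremum norm *)

Section DirichletKernel.
Context {R : realType}.

Lemma norm_sin_le (t : R) : `|sin t| <= `|t|.
Proof.
wlog t0 : t / 0 <= t => [H|].
  have [|/ltW tn] := leP 0 t; first exact: H.
  by rewrite -normrN -sinN -[leRHS]normrN; apply: H; rewrite oppr_ge0.
have cs : {within `[0, t], continuous (@sin R)}.
  by apply: continuous_subspaceT; exact: continuous_sin.
have [c _] := MVT_segment t0 (fun x _ => is_derive_sin x) cs.
rewrite sin0 !subr0 => ->; rewrite normrM ler_piMl//.
by rewrite ler_norml cos_geN1 cos_le1.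
Qed.

Lemma one_sub_cos (t : R) : 1 - cos t = 2 * sin (t / 2) ^+ 2.
Proof.
have -> : cos t = cos (t / 2 + t / 2) by congr cos; field.
by rewrite cosD -!expr2; have := cos2Dsin2 (t / 2); lra.
Qed.

Lemma one_sub_cos_ge0 (t : R) : 0 <= 1 - cos t.
Proof. by rewrite subr_ge0 cos_le1. Qed.

Lemma one_sub_cos_le2 (t : R) : 1 - cos t <= t ^+ 2 / 2.
Proof.
rewrite one_sub_cos.
have H : sin (t / 2) ^+ 2 <= (t / 2) ^+ 2.
  rewrite -[leLHS]real_normK ?num_real// -[leRHS]real_normK ?num_real//.
  by rewrite lerXn2r ?nnegrE// norm_sin_le.
lra.
Qed.

Lemma one_sub_cos_le1 (t : R) : 1 - cos t <= `|t|.
Proof.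
rewrite one_sub_cos.
have h1 : `|sin (t / 2)| <= `|t| / 2.
  by rewrite (le_trans (norm_sin_le _))// normrM [`|2^-1|]gtr0_norm// invr_gt0.
have h2 : `|sin (t / 2)| <= 1 by rewrite ler_norml sin_geN1 sin_le1.
rewrite -[sin _ ^+ 2]real_normK ?num_real//.
have := normr_ge0 (sin (t / 2)); nra.
Qed.

Lemma sin_sub_id (t : R) : `|sin t - t| <= t ^+ 2.
Proof.
wlog t0 : t / 0 <= t => [H|].
  have [|/ltW tn] := leP 0 t; first exact: H.
  have -> : `|sin t - t| = `|sin (- t) - - t| by rewrite sinN -opprD normrN.
  by rewrite -sqrrN; apply: H; rewrite oppr_ge0.
have cs : {within `[0, t], continuous (@sin R)}.
  by apply: continuous_subspaceT; exact: continuous_sin.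
have [c /[!in_itv] /= /andP[c0 ct]] := MVT_segment t0 (fun x _ => is_derive_sin x) cs.
rewrite sin0 !subr0 => ->; rewrite -[X in _ - X]mul1r -mulrBl normrM distrC.
rewrite (ger0_norm (one_sub_cos_ge0 c)) (ger0_norm t0) expr2 ler_wpM2r//.
by rewrite (le_trans (one_sub_cos_le1 c))// ger0_norm.
Qed.

(** A weak form of Jordan's inequality: up to 1 the slope of the sine is at least [1 / 2], and
    beyond 1 monotonicity gives [sin t >= sin 1 >= 1 / 2 >= t / pi]. *)
Lemma sin_lower (t : R) : 0 <= t <= pi / 2 -> t / pi <= sin t.
Proof.
have p2 : 2 <= pi :> R by exact: pi_ge2.
have H (u : R) : 0 <= u <= 1 -> u / 2 <= sin u.
  move=> /andP[u0 u1].
  have cs : {within `[0, u], continuous (@sin R)}.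
    by apply: continuous_subspaceT; exact: continuous_sin.
  have [c /[!in_itv] /= /andP[c0 cu]] := MVT_segment u0 (fun x _ => is_derive_sin x) cs.
  rewrite sin0 !subr0 => ->; rewrite mulrC ler_wpM2r//.
  have := one_sub_cos_le2 c; have : c ^+ 2 <= 1 by rewrite expr_le1// (le_trans cu).
  lra.
move=> /andP[t0 t1].
have pi0 : 0 < pi :> R by exact: pi_gt0.
have [tle1|t1'] := leP t 1.
  rewrite (le_trans _ (H t _)) ?t0//.
  by rewrite ler_wpM2l// lef_pV2 ?posrE.
rewrite (@le_trans _ _ 2^-1)//.
  by rewrite ler_pdivrMr// mulrC.
rewrite (@le_trans _ _ (sin 1))//.
  by have := H 1; rewrite ler01 lexx mul1r; apply.
have h1 : (1 : R) \in `[- (pi / 2), pi / 2]%R.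
  by rewrite in_itv /=; apply/andP; split; lra.
have h2 : t \in `[- (pi / 2), pi / 2]%R.
  by rewrite in_itv /=; apply/andP; split; lra.
by rewrite leNgt ltr_sin// -leNgt ltW.
Qed.

Definition ex (t : R) : R[i] := cos (2 * pi * t) +i* sin (2 * pi * t).

Lemma exD (s t : R) : ex (s + t) = ex s * ex t.
Proof.
rewrite /ex mulrDr cosD sinD; apply/eqP.
by rewrite eq_complex /= [X in _ && (X == _)]addrC !eqxx.
Qed.

Lemma ex_int (m : int) : ex m%:~R = 1.
Proof. by rewrite /ex cos_2pi_int sin_2pi_int. Qed.

Lemma exX (t : R) (n : nat) : ex (n%:R * t) = ex t ^+ n.
Proof.
elim: n => [|n IH]; first by rewrite mul0r (ex_int 0).
by rewrite -natr1 mulrDl mul1r exD IH exprSr.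
Qed.

Lemma ex_neq1 (t : R) : 0 < t < 1 -> ex t != 1.
Proof.
move=> /andP[t0 t1]; apply/eqP => /(congr1 (@complex.Re R)) /= E.
have := one_sub_cos (2 * pi * t); rewrite E subrr.
have -> : 2 * pi * t / 2 = pi * t by field.
have : 0 < sin (pi * t).
  apply: sin_gt0_pi; rewrite mulr_gt0 ?pi_gt0//=.
  by rewrite gtr_pMr ?pi_gt0.
move=> s0 /esym/eqP; rewrite mulf_eq0 pnatr_eq0 /= expf_eq0 /=.
by rewrite gt_eqF.
Qed.

Lemma root_sum (Q : nat) (b : int) : (`|b| < Q%:Z) ->
  \sum_(j < Q) ex (b%:~R * (j%:R / Q%:R)) = if b == 0 then Q%:R else 0.
Proof.
move=> bQ; have Q0 : (Q%:R : R) != 0 by rewrite pnatr_eq0; lia.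
case: eqVneq => [->|b0].
  rewrite (eq_bigr (fun=> 1)); last by move=> i _; rewrite mul0r (ex_int 0).
  by rewrite sumr_const card_ord.
pose z := ex (b%:~R / Q%:R).
rewrite (eq_bigr (fun j : 'I_Q => z ^+ j)); last first.
  by move=> j _; rewrite -exX; congr ex; rewrite mulrCA.
have z1 : z != 1.
  have [bp|bn] := leP 0 b.
    apply: ex_neq1; rewrite divr_gt0 ?ltr0z ?ltr0n; try lia.
    rewrite ltr_pdivrMr ?ltr0n; last lia.
    by rewrite mul1r -[Q%:R]/(Q%:Z%:~R) ltr_int; lia.
  have : ex (1 + b%:~R / Q%:R) != 1.
    apply: ex_neq1; apply/andP; split.
      rewrite -ltrBlDl sub0r ltr_pdivlMr ?ltr0n; last lia.
      by rewrite mulN1r -[Q%:R]/(Q%:Z%:~R) -mulrNz ltr_int; lia.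
    rewrite gtrDl ltr_pdivrMr ?ltr0n; last lia.
    by rewrite mul0r ltrz0.
  by rewrite exD (ex_int 1) mul1r.
apply/eqP; have : (z - 1) * (\sum_(j < Q) z ^+ j) == 0.
  rewrite -subrX1 /z -exX mulrC divfK// (ex_int b) subrr//.
by rewrite mulf_eq0 subr_eq0 (negbTE z1).
Qed.

Definition dker (N Q j : nat) : R := \sum_(m <- irange N) cos (2 * pi * (m%:~R * (j%:R / Q%:R))).

Lemma dker_ex N Q j : (dker N Q j)%:C = \sum_(m <- irange N) ex (m%:~R * (j%:R / Q%:R)).
Proof.
have sym : \sum_(m <- irange N) sin (2 * pi * (m%:~R * (j%:R / Q%:R))) = 0 :> R.
  set S := \sum_(_ <- _) _.
  have : S = - S.
    rewrite {1}/S -sumrN -(eq_big_seq _ (fun m _ => erefl)) /=.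
    rewrite [RHS](eq_bigr (fun m => sin (2 * pi * ((- m)%:~R * (j%:R / Q%:R))))); last first.
      by move=> m _; rewrite mulrNz mulNr mulrN sinN.
    rewrite -[RHS](big_map (fun m : int => - m) xpredT (fun m => sin (2 * pi * (m%:~R * (j%:R / Q%:R))))).
    apply: perm_big; apply: uniq_perm.
    - exact: irange_uniq.
    - by rewrite map_inj_uniq ?irange_uniq//; exact: oppr_inj.
    - move=> m; apply/idP/mapP => [mN|[l lN ->]].
        by exists (- m); rewrite ?opprK// mem_irange normrN -mem_irange.
      by rewrite mem_irange normrN -mem_irange.
  by lra.
apply/eqP; rewrite eq_complex; apply/andP; split; apply/eqP.
  by rewrite cRe_sum.
by rewrite cIm_sum /= sym.
Qed.

Lemma dker_root N Q (a : int) : (`|a| + N%:Z < Q%:Z) ->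
  \sum_(j < Q) ex (a%:~R * (j%:R / Q%:R)) * (dker N Q j)%:C =
  Q%:R * (a \in irange N)%:R.
Proof.
move=> aQ.
rewrite (eq_bigr (fun j : 'I_Q => \sum_(m <- irange N) ex ((a + m)%:~R * (j%:R / Q%:R)))); last first.
  move=> j _; rewrite dker_ex mulr_sumr; apply: eq_bigr => m _.
  by rewrite intrD mulrDl exD.
rewrite exchange_big /= (eq_big_seq (fun m => Q%:R * (m == - a)%:R)); last first.
  move=> m; rewrite mem_irange => mN; rewrite root_sum; last by lia.
  by rewrite addrC addr_eq0; case: eqP => _; rewrite ?mulr1 ?mulr0.
rewrite -mulr_sumr; congr (_ * _).
have -> : (a \in irange N) = (- a \in irange N) by rewrite !mem_irange normrN.
case: (boolP (- a \in irange N)) => aN.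
  rewrite (bigD1_seq (- a)) ?irange_uniq//= eqxx big1; first exact: addr0.
  by move=> m /negbTE ->.
rewrite big1_seq// => m /= mN; case: eqVneq => // E; by rewrite -E mN in aN.
Qed.

(** The closed form of the kernel, by telescoping: multiplied by the sine, each cosine is half a
    difference of sines at consecutive odd multiples of [t]. *)
Lemma dker_sin N Q j : sin (pi * (j%:R / Q%:R)) * dker N Q j =
  sin ((N.*2.+1)%:R * (pi * (j%:R / Q%:R))).
Proof.
set t := pi * _.
pose F (n : nat) : R := sin ((n.*2%:R - (N.*2.+1)%:R) * t) / 2.
rewrite /dker /irange big_map mulr_sumr -[iota 0 N.*2.+1]/(index_iota 0 N.*2.+1).
rewrite (eq_bigr (fun n : nat => F n.+1 - F n)); last first.
  move=> n _.
  have -> : 2 * pi * ((n%:Z - N%:Z)%:~R * (j%:R / Q%:R)) = (n%:R - N%:R) * t + (n%:R - N%:R) * t :> R.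
    by rewrite rmorphB /= /t; ring.
  rewrite /F.
  have -> : (n.+1.*2%:R - N.*2.+1%:R) * t = (n%:R - N%:R) * t + (n%:R - N%:R) * t + t.
    by rewrite -!addnn -!natr1 !natrD -!natr1; ring.
  have -> : (n.*2%:R - N.*2.+1%:R) * t = (n%:R - N%:R) * t + (n%:R - N%:R) * t - t.
    by rewrite -!addnn -!natr1 !natrD; ring.
  by set w := _ + _; rewrite !sinD cosN sinN; field.
rewrite (telescope_sumr F (leq0n _)) /F.
have -> : N.*2.+1.*2%:R - N.*2.+1%:R = N.*2.+1%:R :> R.
  by rewrite -[N.*2.+1.*2]addnn natrD addrK.
by rewrite sub0r mulNr sinN; field.
Qed.

(** The sine in the closed form is bounded below from the nearer end of the grid, [j] or [Q - j];
    keeping both terms avoids splitting the sum over [j] later. *)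
Lemma dker_bound N Q j : (0 < j < Q)%N ->
  `|dker N Q j| <= Q%:R / j%:R + Q%:R / (Q - j)%:R.
Proof.
move=> /andP[j0 jQ].
have Q0 : 0 < Q%:R :> R by rewrite ltr0n; lia.
have j0' : 0 < j%:R :> R by rewrite ltr0n.
have Qj0 : 0 < (Q - j)%:R :> R by rewrite ltr0n subn_gt0.
have pi0 : 0 < pi :> R by exact: pi_gt0.
pose t : R := pi * (j%:R / Q%:R).
have key (s : R) : 0 < s -> s <= sin t -> `|dker N Q j| <= s^-1.
  move=> s0 st; rewrite -[leRHS]mul1r ler_pdivlMr//.
  have E := dker_sin N Q j.
  rewrite (@le_trans _ _ (`|dker N Q j| * sin t))//; first by rewrite ler_wpM2l.
  rewrite -(gtr0_norm (lt_le_trans s0 st)) -normrM mulrC E.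
  by rewrite ler_norml sin_geN1 sin_le1.
have a1 : 0 < Q%:R / j%:R :> R by rewrite divr_gt0.
have a2 : 0 < Q%:R / (Q - j)%:R :> R by rewrite divr_gt0.
have [jh|jh] := leP (j.*2)%N Q.
  apply: (@le_trans _ _ (Q%:R / j%:R)); last by rewrite lerDl ltW.
  rewrite -invf_div; apply: key; first by rewrite divr_gt0.
  have := @sin_lower t; rewrite /t mulrAC mulfV ?lt0r_neq0// mul1r; apply.
  apply/andP; split; first by rewrite mulr_ge0 ?divr_ge0 // ltW.
rewrite ler_pM2l//.
  rewrite ler_pdivrMr// mulrC -[leRHS]/(_ / _) ler_pdivlMr// -natrM ler_nat.
  by rewrite muln2.
apply: (@le_trans _ _ (Q%:R / (Q - j)%:R)); last by rewrite lerDr ltW.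
rewrite -invf_div; apply: key; first by rewrite divr_gt0.
have E : t = pi - pi * ((Q - j)%:R / Q%:R).
  by rewrite /t natrB 1?ltnW//; field; exact: lt0r_neq0.
have -> : sin t = sin (pi * ((Q - j)%:R / Q%:R)).
  by rewrite E sinB sinpi cospi mul0r sub0r mulN1r opprK.
have := @sin_lower (pi * ((Q - j)%:R / Q%:R)); rewrite mulrAC mulfV ?lt0r_neq0// mul1r; apply.
apply/andP; split; first by rewrite mulr_ge0 ?divr_ge0 // ltW.
rewrite ler_pM2l//.
rewrite ler_pdivrMr// mulrC -[leRHS]/(_ / _) ler_pdivlMr// -natrM ler_nat.
by rewrite muln2; lia.
Qed.

(** The upper limit is excluded: this is the harmonic number of index [n - 1]. *)
Definition harm (n : nat) : R := \sum_(1 <= j < n) j%:R^-1.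

Lemma dker_l1 N Q : (N.*2.+1 <= Q)%N -> (0 < Q)%N ->
  \sum_(j < Q) `|dker N Q j| <= Q%:R * (1 + 2 * harm Q).
Proof.
move=> NQ Q0.
rewrite -(big_mkord xpredT (fun j => `|dker N Q j|)) big_ltn// mulrDr mulr1 lerD//.
  rewrite /dker (le_trans (ler_norm_sum _ _ _))//.
  rewrite (@le_trans _ _ (\sum_(m <- irange N) 1))//.
    by apply: ler_sum => m _; rewrite ler_norml cos_geN1 cos_le1.
  rewrite big_const_seq count_predT size_irange.
  have -> : iter N.*2.+1 (+%R 1) 0 = N.*2.+1%:R :> R.
    by elim: (_.+1) => //= n ->; rewrite -natr1 addrC.
  by rewrite ler_nat.
apply: (@le_trans _ _ (\sum_(1 <= j < Q) (Q%:R / j%:R + Q%:R / (Q - j)%:R))).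
  rewrite big_nat [leRHS]big_nat; apply: ler_sum => j jQ; exact: dker_bound.
rewrite big_split /= -!mulr_sumr.
have -> : \sum_(1 <= j < Q) (Q - j)%:R^-1 = harm Q.
  rewrite /harm big_nat_rev /= [in LHS]big_nat [in RHS]big_nat.
  by apply: eq_bigr => j /andP[j0 jQ]; congr (_%:R^-1); lia.
by rewrite -/(harm Q) [2 * _]mulr_natl mulr2n mulrDr.
Qed.

(** A bound of order log^2 N for the Lebesgue constant of the truncation to a square; there is one
    factor per coordinate, and [4 * N + 1] is the grid size of [dirichlet_bound]. *)
Definition dir_const (N : nat) : R := (1 + 2 * harm (4 * N).+1) ^+ 2.

(** The truncation is an exact finite average of translates of [tp L c] over a grid of [Q * Q]
    points, weighted by sampled Dirichlet kernels. There is no aliasing, because frequencies at most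
    [L <= 3 * N] and kernel frequencies at most [N] add up to less than [Q = 4 * N + 1]. The sum of
    the absolute weights is the constant. *)
Lemma dirichlet_bound N L (c : int * int -> R[i]) (B : R) : (L <= 3 * N)%N -> (N <= L)%N ->
  (forall x, `|tp L c x| <= B) -> forall x, `|tp N c x| <= dir_const N * B.
Proof.
move=> LN NL cB x; pose Q := (4 * N).+1.
pose y (i j : 'I_Q) : R * R := (i%:R / Q%:R, j%:R / Q%:R).
have Q0 : (Q%:R : R) != 0 by rewrite pnatr_eq0.
have eval : tp N c x = Q%:R^-1 ^+ 2 *
    \sum_(i < Q) \sum_(j < Q) tp L c (x + y i j) * (dker N Q i * dker N Q j).
  have emode k (i j : 'I_Q) : expi_mode k (y i j) =
      ex (k.1%:~R * (i%:R / Q%:R)) * ex (k.2%:~R * (j%:R / Q%:R)).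
    by rewrite -exD.
  have E (i j : 'I_Q) : tp L c (x + y i j) * (dker N Q i * dker N Q j) =
    \sum_(k <- box L) complex.Re (c k * expi_mode k x *
      ((ex (k.1%:~R * (i%:R / Q%:R)) * (dker N Q i)%:C) *
       (ex (k.2%:~R * (j%:R / Q%:R)) * (dker N Q j)%:C))).
    rewrite /tp mulr_suml; apply: eq_bigr => k _.
    rewrite expi_modeD emode mulrC -cReZ; congr complex.Re.
    by rewrite rmorphM; ring.
  have -> : \sum_(i < Q) \sum_(j < Q) tp L c (x + y i j) * (dker N Q i * dker N Q j) =
    \sum_(k <- box L) complex.Re (c k * expi_mode k x *
      ((\sum_(i < Q) ex (k.1%:~R * (i%:R / Q%:R)) * (dker N Q i)%:C) *
       (\sum_(j < Q) ex (k.2%:~R * (j%:R / Q%:R)) * (dker N Q j)%:C))).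
    under eq_bigr do under eq_bigr do rewrite E.
    under eq_bigr do rewrite exchange_big.
    rewrite exchange_big /=; apply: eq_bigr => k _.
    rewrite big_distrl /= mulr_sumr cRe_sum; apply: eq_bigr => i _.
    by rewrite -cRe_sum -mulr_sumr -mulr_sumr.
  rewrite mulr_sumr.
  transitivity (\sum_(k <- box N) (if k \in box N then complex.Re (c k * expi_mode k x) else 0)).
    by apply: eq_big_seq => k ->.
  rewrite -(@sum_box_widen _ N L)//; last by move=> k /negbTE ->.
  apply: eq_big_seq => k; rewrite mem_box => /andP[k1 k2].
  have bnd (a : int) : `|a| <= L%:Z -> `|a| + N%:Z < Q%:Z.
    by move: LN; rewrite /Q; clear; lia.
  rewrite !dker_root; [|exact: bnd|exact: bnd].
  rewrite mem_box !mem_irange; set z := c k * _.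
  case: (_ <= _); last by rewrite mulr0 mul0r mulr0 mulr0.
  case: (_ <= _); last by rewrite !mulr0.
  rewrite !mulr1 -natrM -(rmorph_nat (real_complex R)) [z * _]mulrC cReZ natrM.
  by field.
rewrite eval normrM ger0_norm ?exprn_ge0 ?invr_ge0//.
have D0 : 0 <= \sum_(j < Q) `|dker N Q j| by apply: sumr_ge0.
have B0 : 0 <= B by apply: le_trans (cB 0).
have DQ : \sum_(j < Q) `|dker N Q j| <= Q%:R * (1 + 2 * harm Q).
  by apply: dker_l1; rewrite /Q //; lia.
apply: (@le_trans _ _ (Q%:R^-1 ^+ 2 * ((\sum_(j < Q) `|dker N Q j|) ^+ 2 * B))).
  rewrite ler_wpM2l ?exprn_ge0 ?invr_ge0//.
  rewrite (le_trans (ler_norm_sum _ _ _))// expr2 -mulrA mulr_suml.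
  apply: ler_sum => i _; rewrite (le_trans (ler_norm_sum _ _ _))//.
  rewrite mulr_suml mulr_sumr; apply: ler_sum => j _.
  by rewrite normrM mulrC normrM -mulrA ler_wpM2l// ler_wpM2l.
rewrite mulrA ler_wpM2r// /dir_const -/Q -exprMn lerXn2r ?nnegrE//.
- by rewrite mulr_ge0// invr_ge0.
- by rewrite addr_ge0// mulr_ge0// sumr_ge0.
by rewrite mulrC ler_pdivrMr ?ltr0n// mulrC.
Qed.

End DirichletKernel.

(** * Lattice sums and smoothing of coefficient arrays *)

Section SumInequalities.
Context {R : realType} {I : eqType}.
Implicit Types (r : seq I) (x y b : I -> R).

Lemma cauchy_schwarz r x y :
  (\sum_(i <- r) x i * y i) ^+ 2 <= (\sum_(i <- r) x i ^+ 2) * (\sum_(i <- r) y i ^+ 2).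
Proof.
rewrite -subr_ge0.
have -> : (\sum_(i <- r) x i ^+ 2) * (\sum_(i <- r) y i ^+ 2) - (\sum_(i <- r) x i * y i) ^+ 2 =
  2^-1 * \sum_(i <- r) \sum_(j <- r) (x i * y j - x j * y i) ^+ 2.
  have E i : \sum_(j <- r) (x i * y j - x j * y i) ^+ 2 =
    x i ^+ 2 * (\sum_(j <- r) y j ^+ 2) - 2 * (x i * y i) * (\sum_(j <- r) x j * y j)
    + y i ^+ 2 * (\sum_(j <- r) x j ^+ 2).
    rewrite !mulr_sumr -sumrN -!big_split /=; apply: eq_bigr => j _; ring.
  rewrite (eq_bigr _ (fun i _ => E i)) !big_split /= sumrN -!mulr_suml.
  have -> : \sum_(i <- r) 2 * (x i * y i) = 2 * \sum_(i <- r) x i * y i by rewrite mulr_sumr.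
  by field.
by rewrite mulr_ge0 ?invr_ge0// sumr_ge0// => i _; rewrite sumr_ge0// => j _; rewrite sqr_ge0.
Qed.

Lemma cauchy_schwarz_weighted r b x : (forall i, i \in r -> 0 <= b i) ->
  (\sum_(i <- r) b i * x i) ^+ 2 <= (\sum_(i <- r) b i) * (\sum_(i <- r) b i * x i ^+ 2).
Proof.
move=> b0; rewrite (eq_big_seq (fun i => Num.sqrt (b i) * (Num.sqrt (b i) * x i))); last first.
  by move=> i ir; rewrite mulrA -expr2 sqr_sqrtr// b0.
apply: (le_trans (cauchy_schwarz _ _ _)).
rewrite (eq_big_seq b); last by move=> i ir; rewrite sqr_sqrtr// b0.
rewrite [X in _ * X](eq_big_seq (fun i => b i * x i ^+ 2))//.
by move=> i ir; rewrite exprMn sqr_sqrtr// b0.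
Qed.

Lemma ler_sum_seq r x y : (forall i, i \in r -> x i <= y i) ->
  \sum_(i <- r) x i <= \sum_(i <- r) y i.
Proof. by move=> H; rewrite big_seq [leRHS]big_seq; apply: ler_sum. Qed.

Lemma sumr_ge0_seq r x : (forall i, i \in r -> 0 <= x i) -> 0 <= \sum_(i <- r) x i.
Proof. by move=> H; rewrite big_seq; apply: sumr_ge0. Qed.

Lemma sum_const_seq r (a : R) : \sum_(i <- r) a = (size r)%:R * a.
Proof.
rewrite big_const_seq count_predT; elim: (size r) => [|n IH] /=; first by rewrite mul0r.
by rewrite IH -natr1 mulrDl mul1r addrC.
Qed.

End SumInequalities.

Section LatticeSums.
Context {R : realType}.

Lemma sum_box_sub (L M : nat) (g : int * int -> R) : (L <= M)%N -> (forall k, 0 <= g k) ->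
  \sum_(k <- box L) g k <= \sum_(k <- box M) g k.
Proof.
move=> LM g0; rewrite (@eq_sum_supp _ _ (box L) [seq k <- box M | k \in box L]).
- rewrite big_filter [leRHS](bigID (fun k => k \in box L)) /= lerDl.
  by rewrite sumr_ge0.
- exact: box_uniq.
- by rewrite filter_uniq// box_uniq.
- move=> k _; rewrite mem_filter; case: (boolP (k \in box L)) => //= kL.
  by rewrite (sub_box LM).
Qed.

Lemma sum_irange (L : nat) (g : nat -> R) :
  \sum_(a <- irange L) g (absz a) = g 0%N + 2 * \sum_(1 <= j < L.+1) g j.
Proof.
have P : perm_eq (irange L) (0 :: [seq j%:Z | j <- index_iota 1 L.+1] ++
    [seq - j%:Z | j <- index_iota 1 L.+1]).
  apply: uniq_perm; first exact: irange_uniq.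
    rewrite /= mem_cat cat_uniq !map_inj_uniq ?iota_uniq /=; try by move=> i j; lia.
    rewrite andbT; apply/andP; split.
      apply/norP; split; apply/mapP => -[j]; rewrite mem_index_iota; lia.
    apply/hasPn => _ /mapP[j + ->]; rewrite mem_index_iota => j1.
    by apply/mapP => -[m]; rewrite mem_index_iota; lia.
  move=> a; rewrite mem_irange in_cons mem_cat; apply/idP/idP.
    move=> aL; have [a0|] := eqVneq a 0; first by [].
    move=> a0 /=; have [ap|an] := leP 0 a.
      apply/orP; left; apply/mapP; exists (absz a); last by lia.
      by rewrite mem_index_iota; lia.
    apply/orP; right; apply/mapP; exists (absz a); last by lia.
    by rewrite mem_index_iota; lia.
  move=> /or3P[/eqP ->//|/mapP[j]|/mapP[j]]; rewrite mem_index_iota => j1 ->; lia.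
rewrite (perm_big _ P) /= big_cons big_cat !big_map /=; congr (_ + _).
rewrite mulr_natl mulr2n; congr (_ + _).
by apply: eq_bigr => j _; rewrite abszN.
Qed.

Lemma lam_lower k : (k.1%:~R ^+ 2 + k.2%:~R ^+ 2 : R) <= lam k.
Proof.
rewrite lamE -[leLHS]mul1r ler_wpM2r ?addr_ge0 ?sqr_ge0//.
have := @pi_ge2 R; nra.
Qed.

Lemma lam_ge1 k : k != 0 -> 1 <= lam k :> R.
Proof.
move=> k0; apply: (le_trans _ (lam_lower k)).
rewrite -!rmorphXn -rmorphD /= -[1]/(1%:~R) ler_int.
have : (k.1 != 0) || (k.2 != 0).
  by apply: contraR k0 => /norP[/negPn/eqP k1 /negPn/eqP k2]; apply/eqP; case: k k1 k2 => a b /= -> ->.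
by move: (k.1) (k.2) => a b; move=> /orP[|]; nia.
Qed.

Lemma lam_gt0 k : k != 0 -> 0 < lam k :> R.
Proof. by move=> /lam_ge1; apply: lt_le_trans. Qed.

Lemma lam00 : lam 0 = 0 :> R.
Proof. by rewrite lamE /= expr0n /= addr0 mulr0. Qed.

Lemma telescope_le (u v : nat -> R) (m n : nat) : (m <= n)%N ->
  (forall j, (m <= j < n)%N -> u j <= v j - v j.+1) -> 0 <= v n ->
  \sum_(m <= j < n) u j <= v m.
Proof.
move=> mn H v0; apply: (@le_trans _ _ (\sum_(m <= j < n) (v j - v j.+1))).
  by rewrite big_nat [leRHS]big_nat; apply: ler_sum.
rewrite -[leLHS]opprK -sumrN (eq_bigr (fun j => v j.+1 - v j)); last by move=> j _; rewrite opprB.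
by rewrite telescope_sumr// opprB gerBl.
Qed.

(** The discrete counterpart of [t ^ (-3/2)] being the derivative of [- 2 * t ^ (-1/2)], with the
    decreasing function taken at the right end. It serves both the lattice sums and the summation in
    time. *)
Lemma sqrt_step (a b : R) : 0 < a -> a <= b ->
  (b - a) / (b * Num.sqrt b) <= 2 * (Num.sqrt a)^-1 - 2 * (Num.sqrt b)^-1.
Proof.
move=> a0 ab; have b0 : 0 < b := lt_le_trans a0 ab.
set x := Num.sqrt a; set y := Num.sqrt b.
have x0 : 0 < x by rewrite sqrtr_gt0.
have y0 : 0 < y by rewrite sqrtr_gt0.
have xy : x <= y by rewrite ler_sqrt// ltW.
have ax : a = x * x by rewrite -expr2 sqr_sqrtr// ltW.
have by_ : b = y * y by rewrite -expr2 sqr_sqrtr// ltW.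
rewrite ax by_ -subr_ge0.
have -> : 2 * x^-1 - 2 * y^-1 - (y * y - x * x) / (y * y * y) =
  (y - x) * (2 * y ^+ 2 - x * (x + y)) / (x * y ^+ 3).
  by field; rewrite !lt0r_neq0.
by rewrite divr_ge0 ?mulr_ge0 ?exprn_ge0 ?subr_ge0 ?(ltW x0) ?(ltW y0)//; nra.
Qed.

Lemma sum_three_halves (L : nat) : \sum_(1 <= j < L.+1) (j%:R * Num.sqrt j%:R)^-1 <= 3 :> R.
Proof.
case: L => [|L]; first by rewrite big_geq.
rewrite big_ltn// mul1r sqrtr1 invr1 -[3]/(1 + 2) lerD2l.
apply: (@le_trans _ _ (2 * (Num.sqrt 1%:R)^-1)); last by rewrite sqrtr1 invr1 mulr1.
rewrite -[2%N]/(1.+1) big_add1 /=.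
apply: (@telescope_le _ (fun j => 2 * (Num.sqrt j%:R)^-1)) => //.
move=> j /andP[j1 _].
have := @sqrt_step j%:R j.+1%:R; rewrite ltr0n ler_nat j1 leqnSn => /(_ isT isT).
by rewrite -{1}natr1 addrAC subrr add0r mul1r.
Qed.

(** The absolute value with [0] replaced by [1], so that [nu k.1 * nu k.2 <= lam k] off the origin
    and lattice sums factor into one-dimensional ones. *)
Definition nu (a : int) : R := if a == 0 then 1 else `|a|%N%:R.

Lemma nu_ge1 a : 1 <= nu a.
Proof. by rewrite /nu; case: eqVneq => // a0; rewrite ler1n; lia. Qed.

Lemma nu_mul_lam k : k != 0 -> nu k.1 * nu k.2 <= lam k.
Proof.
move=> k0; apply: (le_trans _ (lam_lower k)).
have E (a : int) : (a%:~R ^+ 2 : R) = (`|a|%N ^ 2)%N%:R.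
  by rewrite natrX natr_absz intr_norm real_normK// num_real.
rewrite !E -natrD /nu.
have : (k.1 != 0) || (k.2 != 0).
  by apply: contraR k0 => /norP[/negPn/eqP k1 /negPn/eqP k2]; apply/eqP; case: k k1 k2 => a b /= -> ->.
case: eqVneq => [->|a0]; case: eqVneq => [->|b0] //= _; rewrite ?mul1r ?mulr1 -?natrM ler_nat.
- by rewrite -mulnn; nia.
- by rewrite -mulnn; nia.
- by rewrite -!mulnn; nia.
Qed.

Lemma sum_nu (L : nat) : \sum_(a <- irange L) (nu a * Num.sqrt (nu a))^-1 <= 7.
Proof.
pose g (n : nat) : R := if n == 0%N then 1 else (n%:R * Num.sqrt n%:R)^-1.
have -> : \sum_(a <- irange L) (nu a * Num.sqrt (nu a))^-1 = \sum_(a <- irange L) g (absz a).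
  apply: eq_bigr => a _; rewrite /nu /g absz_eq0.
  by case: eqVneq => // _; rewrite mul1r sqrtr1 invr1.
rewrite (sum_irange L g) /g /= -[7]/(1 + 6) lerD2l.
rewrite big_nat (eq_bigr (fun j => (j%:R * Num.sqrt j%:R)^-1)); last by case.
by rewrite -big_nat; have := sum_three_halves L; lra.
Qed.

(** After factoring through [nu] the sum is at most the square of a one-dimensional sum of
    [n ^ (-3/2)]; here [49 = 7 ^ 2] and [7 = 1 + 2 * 3]. *)
Lemma lattice_three_halves (L : nat) :
  \sum_(k <- box L | k != 0) (lam k * Num.sqrt (lam k))^-1 <= 49 :> R.
Proof.
apply: (@le_trans _ _ (\sum_(k <- box L) (nu k.1 * Num.sqrt (nu k.1))^-1 * (nu k.2 * Num.sqrt (nu k.2))^-1)).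
  rewrite [leRHS](bigID (fun k => k != 0)) /= -[leLHS]addr0 lerD//; last first.
    by apply: sumr_ge0 => k _; rewrite mulr_ge0// invr_ge0 mulr_ge0 ?sqrtr_ge0// (le_trans _ (nu_ge1 _)).
  apply: ler_sum => k k0.
  have n1 : 0 < nu k.1 := lt_le_trans ltr01 (nu_ge1 _).
  have n2 : 0 < nu k.2 := lt_le_trans ltr01 (nu_ge1 _).
  have l0 := lam_gt0 k0.
  rewrite -invfM lef_pV2 ?posrE ?mulr_gt0 ?sqrtr_gt0//.
  rewrite mulrACA -sqrtrM ?(ltW n1)// ler_pM ?mulr_ge0 ?sqrtr_ge0 ?(ltW n1) ?(ltW n2)//.
    exact: nu_mul_lam.
  by rewrite ler_sqrt ?(ltW l0)// nu_mul_lam.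
apply: (@le_trans _ _ ((\sum_(a <- irange L) (nu a * Num.sqrt (nu a))^-1) * (\sum_(a <- irange L) (nu a * Num.sqrt (nu a))^-1))).
  by rewrite -(sum_box_prod L (fun a => (nu a * Num.sqrt (nu a))^-1) (fun a => (nu a * Num.sqrt (nu a))^-1)).
have S0 : 0 <= \sum_(a <- irange L) (nu a * Num.sqrt (nu a))^-1.
  by apply: sumr_ge0 => a _; rewrite invr_ge0 mulr_ge0 ?sqrtr_ge0// (le_trans _ (nu_ge1 _)).
have := sum_nu L; nra.
Qed.

Lemma lattice_two (L : nat) : \sum_(k <- box L | k != 0) (lam k ^+ 2)^-1 <= 49 :> R.
Proof.
apply: (le_trans _ (lattice_three_halves L)); apply: ler_sum => k k0.
have l0 := lam_gt0 k0; have l1 := lam_ge1 k0.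
rewrite lef_pV2 ?posrE ?mulr_gt0 ?sqrtr_gt0 ?exprn_gt0//.
have s1 : 1 <= Num.sqrt (lam k) :> R by rewrite -[1]sqrtr1 ler_sqrt// ltW.
have sl : Num.sqrt (lam k) * Num.sqrt (lam k) = lam k :> R by rewrite -expr2 sqr_sqrtr// ltW.
rewrite expr2 ler_wpM2l ?(ltW l0)//.
by rewrite -{2}sl ler_peMl// (le_trans ler01).
Qed.

Lemma sum_resolvent (t : R) (L : nat) : 0 < t ->
  \sum_(1 <= j < L.+1) (1 + t * j%:R ^+ 2)^-1 <= 2 / Num.sqrt t.
Proof.
move=> t0; set h := Num.sqrt t.
have h0 : 0 < h by rewrite sqrtr_gt0.
have th : t = h ^+ 2 by rewrite sqr_sqrtr// ltW.
rewrite big_add1 /=.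
have := @telescope_le (fun j => (1 + t * j.+1%:R ^+ 2)^-1) (fun j => 2 / h / (1 + h * j%:R)) 0 L.
rewrite mulr0 addr0 divr1; apply => // [j _|]; last first.
  by rewrite !divr_ge0 ?addr_ge0 ?mulr_ge0 ?(ltW h0).
rewrite -natr1; set x : R := j%:R; have x0 : 0 <= x by rewrite /x.
have d1 : 0 < 1 + h * x by rewrite ltr_wpDr// mulr_ge0// ltW.
have d2 : 0 < 1 + h * (x + 1) by rewrite ltr_wpDr// mulr_ge0 ?addr_ge0// ltW.
have -> : 2 / h / (1 + h * x) - 2 / h / (1 + h * (x + 1)) = 2 / ((1 + h * x) * (1 + h * (x + 1))).
  by field; rewrite !lt0r_neq0.
rewrite -[leLHS]div1r ler_pdivlMr ?mulr_gt0// mulrC mulrA mulr1.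
rewrite ler_pdivrMr; last by rewrite ltr_wpDr// mulr_ge0 ?sqr_ge0// ltW.
rewrite th; set y := h * x; have y0 : 0 <= y by rewrite mulr_ge0// ltW.
have -> : h ^+ 2 * (x + 1) ^+ 2 = (y + h) ^+ 2 by rewrite /y; ring.
have -> : h * (x + 1) = y + h by rewrite /y; ring.
have := sqr_ge0 (1 - (y + h)); nra.
Qed.

(** The sum factors since [(1 + t * lam k) ^ 2] dominates the product of the two one-dimensional
    denominators. In each factor [t <= 1] lets the zero mode be absorbed into [5 / sqrt t]. *)
Lemma lattice_resolvent (t : R) (L : nat) : 0 < t -> t <= 1 ->
  \sum_(k <- box L) ((1 + t * lam k) ^+ 2)^-1 <= 25 / t.
Proof.
move=> t0 t1.
apply: (@le_trans _ _ (\sum_(k <- box L) (1 + t * k.1%:~R ^+ 2)^-1 * (1 + t * k.2%:~R ^+ 2)^-1)).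
  apply: ler_sum => k _.
  have p1 : 0 <= t * k.1%:~R ^+ 2 by rewrite mulr_ge0 ?sqr_ge0// ltW.
  have p2 : 0 <= t * k.2%:~R ^+ 2 by rewrite mulr_ge0 ?sqr_ge0// ltW.
  have p3 : t * k.1%:~R ^+ 2 + t * k.2%:~R ^+ 2 <= t * lam k.
    by rewrite -mulrDr ler_pM2l// lam_lower.
  have d1 : 0 < 1 + t * k.1%:~R ^+ 2 by exact: ltr_wpDr.
  have d2 : 0 < 1 + t * k.2%:~R ^+ 2 by exact: ltr_wpDr.
  have d3 : 0 < 1 + t * lam k by apply: ltr_wpDr => //; exact: le_trans (addr_ge0 p1 p2) p3.
  rewrite -invfM lef_pV2 ?posrE; [|exact: exprn_gt0|exact: mulr_gt0].
  by rewrite expr2; nra.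
apply: (@le_trans _ _ ((\sum_(a <- irange L) (1 + t * a%:~R ^+ 2)^-1) * (\sum_(a <- irange L) (1 + t * a%:~R ^+ 2)^-1))).
  by rewrite -(sum_box_prod L (fun a => (1 + t * a%:~R ^+ 2)^-1) (fun a => (1 + t * a%:~R ^+ 2)^-1)).
have S : \sum_(a <- irange L) (1 + t * a%:~R ^+ 2)^-1 <= 5 / Num.sqrt t.
  pose g (n : nat) : R := (1 + t * n%:R ^+ 2)^-1.
  have -> : \sum_(a <- irange L) (1 + t * a%:~R ^+ 2)^-1 = \sum_(a <- irange L) g (absz a).
    by apply: eq_bigr => a _; rewrite /g natr_absz intr_norm real_normK// num_real.
  rewrite (sum_irange L g) /g expr0n /= mulr0 addr0 invr1.
  have h0 : 0 < Num.sqrt t by rewrite sqrtr_gt0.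
  have h1 : 1 <= (Num.sqrt t)^-1 by rewrite invf_ge1// -[1]sqrtr1 ler_sqrt.
  by have := sum_resolvent L t0; lra.
have S0 : 0 <= \sum_(a <- irange L) (1 + t * a%:~R ^+ 2)^-1.
  by apply: sumr_ge0 => a _; rewrite invr_ge0 addr_ge0// mulr_ge0 ?sqr_ge0// ltW.
have -> : 25 / t = (5 / Num.sqrt t) * (5 / Num.sqrt t).
  have h0 : 0 < Num.sqrt t by rewrite sqrtr_gt0.
  by rewrite -{1}[t]sqr_sqrtr ?ltW//; field; exact: lt0r_neq0.
exact: ler_pM.
Qed.

End LatticeSums.

Section Arrays.
Context {R : realType}.
Implicit Types (a b g : int * int -> R) (N s : nat).

Definition lrt (k : int * int) : R := Num.sqrt (lam k).

Lemma lrt_ge0 k : 0 <= lrt k. Proof. exact: sqrtr_ge0. Qed.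
Lemma lrt_sqr k : lrt k ^+ 2 = lam k. Proof. by rewrite sqr_sqrtr// lam_ge0. Qed.
Lemma lrt_gt0 k : k != 0 -> 0 < lrt k. Proof. by move=> k0; rewrite sqrtr_gt0 lam_gt0. Qed.
Lemma lrt0 : lrt 0 = 0. Proof. by rewrite /lrt lam00 sqrtr0. Qed.

Definition bb a k : R := a k / lrt k.
(* [UU N a] bounds the velocity uniformly (velocity_le_UU), and [XX N s a] is the
   squared homogeneous Sobolev norm of order [s] of the vorticity. *)
Definition UU N a : R := \sum_(k <- box N) bb a k.
Definition XX N s a : R := \sum_(k <- box N) lam k ^+ s * a k ^+ 2.
(** The convolution of velocity moduli with vorticity moduli; [lrt k * qq N a k] dominates the
    modulus of the advection coefficient ([adv_le]). *)
Definition qq N a k : R := \sum_(l <- box N) bb a l * a (k - l).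

Lemma lam_triangle k l : lam k <= 2 * (lam l + lam (k - l)) :> R.
Proof.
rewrite !lamE /= -mulrDr mulrCA ler_wpM2l ?sqr_ge0//.
rewrite !rmorphB /=; move: (k.1%:~R) (k.2%:~R) (l.1%:~R) (l.2%:~R) => k1 k2 l1 l2.
have := sqr_ge0 (k1 - 2 * l1 : R); have := sqr_ge0 (k2 - 2 * l2 : R); nra.
Qed.

Lemma XX_ge0 N s a : 0 <= XX N s a.
Proof. by apply: sumr_ge0 => k _; rewrite mulr_ge0 ?sqr_ge0 ?exprn_ge0 ?lam_ge0. Qed.

Lemma bb_ge0 a : (forall k, 0 <= a k) -> forall k, 0 <= bb a k.
Proof. by move=> a0 k; rewrite divr_ge0 ?lrt_ge0. Qed.

Lemma UU_ge0 N a : (forall k, 0 <= a k) -> 0 <= UU N a.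
Proof. by move=> a0; apply: sumr_ge0 => k _; exact: bb_ge0. Qed.

Lemma young N b g : (forall l, 0 <= b l) -> supp N g ->
  \sum_(k <- box (N + N)) (\sum_(l <- box N) b l * g (k - l)) ^+ 2 <=
  (\sum_(l <- box N) b l) ^+ 2 * \sum_(k <- box N) g k ^+ 2.
Proof.
move=> b0 sg.
apply: (@le_trans _ _ (\sum_(k <- box (N + N)) (\sum_(l <- box N) b l) *
    \sum_(l <- box N) b l * g (k - l) ^+ 2)).
  by apply: ler_sum => k _; apply: cauchy_schwarz_weighted.
rewrite -mulr_sumr exchange_big /= expr2 -mulrA ler_wpM2l ?sumr_ge0//.
rewrite mulr_suml le_eqVlt; apply/orP; left; apply/eqP; apply: eq_big_seq => l lN.
rewrite -mulr_sumr (@sum_box_shift _ (N + N) N N l (fun k => g k ^+ 2))//.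
by move=> k kN; rewrite sg// expr0n.
Qed.

(** Of the frequencies [l] and [k - l] one has at least half the length of [k]. Exchanging them lets
    this be [k - l], at the price of the factor 2: the exchange moves the division by [lrt] to the
    smaller frequency, which only increases the term. *)
Lemma qq_half N a k : (forall k, 0 <= a k) -> supp N a -> a 0 = 0 ->
  qq N a k <= 2 * \sum_(l <- box N) bb a l * (a (k - l) * (lam k <= 4 * lam (k - l) :> R)%:R).
Proof.
move=> a0 sa a00; have b0 := bb_ge0 a0.
pose F l := bb a l * (a (k - l) * (lam k <= 4 * lam (k - l) :> R)%:R).
have F0 l : 0 <= F l by rewrite /F mulr_ge0 ?b0// mulr_ge0.
rewrite mulr_natl mulr2n /qq.
pose P l := (lam l <= lam (k - l) :> R).
rewrite (eq_bigr (fun l => (P l)%:R * (bb a l * a (k - l)) + (~~ P l)%:R * (bb a l * a (k - l)))); last first.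
  by move=> l _; case: (P l); rewrite ?mul1r ?mul0r ?addr0 ?add0r.
rewrite big_split /=; apply: lerD.
  apply: ler_sum => l _; case: (boolP (P l)) => Pl; last by rewrite mul0r F0.
  rewrite mul1r /F; have -> : lam k <= 4 * lam (k - l) :> R.
    by have := lam_triangle k l; move: Pl; rewrite /P; lra.
  by rewrite mulr1.
pose G l := (~~ P l)%:R * (bb a l * a (k - l)).
have -> : \sum_(l <- box N) G l = \sum_(l <- [seq k - l | l <- box N]) G l.
  apply: eq_sum_supp; first exact: box_uniq.
    by rewrite map_inj_uniq ?box_uniq// => l m /addrI /oppr_inj.
  move=> l; rewrite /G !mulf_eq0 !negb_or => /andP[_ /andP[/andP[al _] akl]].
  rewrite (supp_neq0 sa al); apply/esym/mapP; exists (k - l); first exact: (supp_neq0 sa akl).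
  by rewrite opprB addrC subrK.
have kk l : k - (k - l) = l by rewrite opprB addrC subrK.
rewrite big_map; apply: ler_sum => l _; rewrite /G kk.
case: (boolP (P (k - l))) => Pl; first by rewrite mul0r F0.
rewrite mul1r; move: Pl; rewrite /P kk -ltNge => Pl.
have h4 : lam k <= 4 * lam (k - l) :> R by have := lam_triangle k l; lra.
rewrite h4 mulr1 [leRHS]mulrC.
have [->|l0] := eqVneq l 0; first by rewrite a00 mulr0 mulr_ge0// bb_ge0.
rewrite /bb mulrAC [leRHS]mulrA ler_wpM2l ?mulr_ge0//.
have ll := lrt_gt0 l0.
have lkl : lrt l <= lrt (k - l) by rewrite ler_sqrt ?lam_ge0// ltW.
by rewrite lef_pV2 ?posrE// (lt_le_trans ll).
Qed.

(** By [qq_half] all derivatives may be put on the vorticity factor, so that the velocity enters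
    only through [UU]: the factor [4 ^ s] is the cost of that transfer, the remaining 4 is the
    square of the 2 in [qq_half]. *)
Lemma qq_level N s a : (forall k, 0 <= a k) -> supp N a -> a 0 = 0 ->
  \sum_(k <- box (N + N)) lam k ^+ s * qq N a k ^+ 2 <= 4 ^+ s.+1 * UU N a ^+ 2 * XX N s a.
Proof.
move=> a0 sa a00; have b0 := bb_ge0 a0.
have q0 k : 0 <= qq N a k by apply: sumr_ge0 => l _; rewrite mulr_ge0.
apply: (@le_trans _ _ (\sum_(k <- box (N + N)) 4 * (UU N a *
   \sum_(l <- box N) bb a l * (4 ^+ s * (lam (k - l) ^+ s * a (k - l) ^+ 2))))).
  apply: ler_sum => k _.
  apply: (@le_trans _ _ (lam k ^+ s * (2 * \sum_(l <- box N) bb a l *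
      (a (k - l) * (lam k <= 4 * lam (k - l) :> R)%:R)) ^+ 2)).
    rewrite ler_wpM2l ?exprn_ge0 ?lam_ge0//.
    have H := qq_half k a0 sa a00.
    by rewrite lerXn2r ?nnegrE ?q0// (le_trans (q0 k)).
  have e4 : 2 ^+ 2 = 4 :> R by ring.
  rewrite [(2 * _) ^+ 2]exprMn mulrCA e4 ler_wpM2l//.
  apply: (@le_trans _ _ (lam k ^+ s * (UU N a * \sum_(l <- box N) bb a l *
      (a (k - l) * (lam k <= 4 * lam (k - l) :> R)%:R) ^+ 2))).
    rewrite ler_wpM2l ?exprn_ge0 ?lam_ge0//.
    by apply: cauchy_schwarz_weighted.
  rewrite mulrCA ler_wpM2l ?UU_ge0// mulr_sumr; apply: ler_sum => l _.
  rewrite mulrCA ler_wpM2l// exprMn mulrA.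
  case: (boolP (lam k <= 4 * lam (k - l) :> R)) => h; last first.
    by rewrite expr0n /= mulr0 !mulr_ge0 ?sqr_ge0 ?exprn_ge0 ?lam_ge0.
  rewrite expr1n mulr1 mulrA ler_wpM2r ?sqr_ge0// -exprMn.
  by rewrite lerXn2r ?nnegrE ?mulr_ge0 ?lam_ge0.
rewrite -!mulr_sumr exchange_big /=.
have E l : l \in box N -> \sum_(k <- box (N + N)) bb a l * (4 ^+ s * (lam (k - l) ^+ s * a (k - l) ^+ 2)) =
    bb a l * (4 ^+ s * XX N s a).
  move=> lN; rewrite -mulr_sumr -mulr_sumr.
  rewrite (@sum_box_shift _ (N + N) N N l (fun k => lam k ^+ s * a k ^+ 2))//.
  by move=> k kN; rewrite sa// expr0n mulr0.
rewrite (eq_big_seq _ E) -mulr_suml -/(UU N a) le_eqVlt; apply/orP; left; apply/eqP.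
by rewrite [4 ^+ s.+1]exprS expr2; ring.
Qed.

(** With [q = qq N a k], the difference [(1 + tau * lam) * (a ^ 2 + tau * q ^ 2) - (a + tau * lrt *
    q) ^ 2] is the square [tau * (q - lrt * a) ^ 2]. Hence implicit diffusion absorbs the derivative
    on the advection at every level, without any relation between [tau] and [N]. *)
Lemma step_level N s a a' (tau : R) : 0 <= tau ->
  (forall k, 0 <= a k) -> (forall k, 0 <= a' k) -> supp N a -> a 0 = 0 ->
  (forall k, k \in box N -> (1 + tau * lam k) * a' k <= a k + tau * lrt k * qq N a k) ->
  XX N s a' + tau * XX N s.+1 a' <= XX N s a * (1 + tau * (4 ^+ s.+1 * UU N a ^+ 2)).
Proof.
move=> t0 a0 a0' sa a00 H.
have q0 k : 0 <= qq N a k by apply: sumr_ge0 => l _; rewrite mulr_ge0 ?bb_ge0.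
have step k : k \in box N -> (1 + tau * lam k) * a' k ^+ 2 <= a k ^+ 2 + tau * qq N a k ^+ 2.
  move=> /H Hk; have D0 := den_gt0 k t0; set D := 1 + tau * lam k in Hk D0 *.
  rewrite -(ler_pM2l D0) mulrA -expr2 -exprMn.
  apply: (@le_trans _ _ ((a k + tau * lrt k * qq N a k) ^+ 2)).
    rewrite lerXn2r ?nnegrE// ?(mulr_ge0 (ltW D0))//.
    by rewrite addr_ge0// !mulr_ge0// lrt_ge0.
  rewrite -subr_ge0 /D -lrt_sqr.
  have -> : (1 + tau * lrt k ^+ 2) * (a k ^+ 2 + tau * qq N a k ^+ 2) - (a k + tau * lrt k * qq N a k) ^+ 2
     = tau * (qq N a k - lrt k * a k) ^+ 2 by ring.
  by rewrite mulr_ge0 ?sqr_ge0.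
rewrite /XX mulr_sumr -big_split /=.
apply: (@le_trans _ _ (\sum_(k <- box N) (lam k ^+ s * a k ^+ 2 + tau * (lam k ^+ s * qq N a k ^+ 2)))).
  apply: ler_sum_seq => k kN.
  have -> : lam k ^+ s * a' k ^+ 2 + tau * (lam k ^+ s.+1 * a' k ^+ 2) =
    lam k ^+ s * ((1 + tau * lam k) * a' k ^+ 2) by rewrite [lam k ^+ s.+1]exprS; ring.
  have -> : lam k ^+ s * a k ^+ 2 + tau * (lam k ^+ s * qq N a k ^+ 2) =
    lam k ^+ s * (a k ^+ 2 + tau * qq N a k ^+ 2) by ring.
  by rewrite ler_wpM2l ?exprn_ge0 ?lam_ge0//; exact: step.
rewrite big_split /= -mulr_sumr mulrDr mulr1 lerD2l [leRHS]mulrCA ler_wpM2l// [leRHS]mulrC.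
apply: (le_trans _ (qq_level s a0 sa a00)); apply: sum_box_sub; first exact: leq_addr.
by move=> k; rewrite mulr_ge0 ?sqr_ge0 ?exprn_ge0 ?lam_ge0.
Qed.

Lemma UU_le_XX1 N a : (forall k, 0 <= a k) -> UU N a ^+ 2 <= 49 * XX N 1 a.
Proof.
move=> a0; have E : UU N a = \sum_(k <- box N) (if k != 0 then (lam k)^-1 else 0) * (lrt k * a k).
  apply: eq_bigr => k _; rewrite /bb; case: eqVneq => [->|k0] /=.
    by rewrite lrt0 invr0 mulr0 mul0r.
  have := lrt_gt0 k0; rewrite -lrt_sqr => l0; field; exact: lt0r_neq0.
rewrite E; apply: (le_trans (cauchy_schwarz _ _ _)); apply: ler_pM.
- by apply: sumr_ge0 => k _; rewrite sqr_ge0.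
- by apply: sumr_ge0 => k _; rewrite sqr_ge0.
- apply: (le_trans _ (lattice_two N)); rewrite [leRHS]big_mkcond /=.
  apply: ler_sum => k _; case: eqVneq => _ /=; first by rewrite expr0n.
  by rewrite exprVn.
- by apply: ler_sum => k _; rewrite exprMn lrt_sqr expr1.
Qed.

(** Interpolation with the weight [lam ^ (-3/4)], whose square is summable over the nonzero lattice.
    Combined with [t * XX 1] bounded, it yields velocities of size [t ^ (-1/4)]. *)
Lemma UU_le_XX01 N a : (forall k, 0 <= a k) -> UU N a ^+ 4 <= 49 ^+ 2 * (XX N 0 a * XX N 1 a).
Proof.
move=> a0; pose W := \sum_(k <- box N) (a k * (lrt k * a k)).
have W0 : 0 <= W by apply: sumr_ge0 => k _; rewrite !mulr_ge0 ?lrt_ge0.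
have E : UU N a = \sum_(k <- box N) (if k != 0 then (lrt k * Num.sqrt (lrt k))^-1 else 0) * (Num.sqrt (lrt k) * a k).
  apply: eq_bigr => k _; rewrite /bb; case: eqVneq => [->|k0] /=.
    by rewrite lrt0 invr0 mulr0 mul0r.
  have l0 := lrt_gt0 k0; have s0 : 0 < Num.sqrt (lrt k) by rewrite sqrtr_gt0.
  by field; rewrite !lt0r_neq0.
have H : UU N a ^+ 2 <= 49 * W.
  rewrite E; apply: (le_trans (cauchy_schwarz _ _ _)); apply: ler_pM.
  - by apply: sumr_ge0 => k _; rewrite sqr_ge0.
  - by apply: sumr_ge0 => k _; rewrite sqr_ge0.
  - apply: (le_trans _ (lattice_three_halves N)); rewrite [leRHS]big_mkcond /=.
    apply: ler_sum => k _; case: eqVneq => _ /=; first by rewrite expr0n.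
    rewrite exprVn exprMn (sqr_sqrtr (lrt_ge0 k)) lrt_sqr.
    by rewrite /lrt.
  - apply: ler_sum => k _; rewrite exprMn (sqr_sqrtr (lrt_ge0 k)).
    by rewrite expr2 mulrCA.
have H2 : W ^+ 2 <= XX N 0 a * XX N 1 a.
  apply: (le_trans (cauchy_schwarz _ _ _)); rewrite le_eqVlt; apply/orP; left; apply/eqP.
  by congr (_ * _); apply: eq_bigr => k _; rewrite ?expr0 ?mul1r// exprMn lrt_sqr expr1.
rewrite (_ : 4%N = (2 * 2)%N)// exprM.
apply: (@le_trans _ _ ((49 * W) ^+ 2)).
  by rewrite lerXn2r ?nnegrE ?sqr_ge0// mulr_ge0.
by rewrite exprMn ler_wpM2l// exprn_ge0.
Qed.

(** Cauchy-Schwarz against the weight [1 / (1 + t * lam)], whose squares sum to order [1 / t], the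
    number of modes below frequency [t ^ (-1/2)] in the plane. For [t > 1] the spectral gap makes
    the weight [1 / lam] sufficient, and [t ^ 3 <= t ^ 4]. *)
Lemma hessian_bound N a (t C : R) : (forall k, 0 <= a k) -> a 0 = 0 -> 0 < t -> 0 <= C ->
  t ^+ 2 * XX N 2 a <= C -> t ^+ 4 * XX N 4 a <= C ->
  (\sum_(k <- box N) lam k * a k) ^+ 2 <= 100 * C / t ^+ 3.
Proof.
move=> a0 a00 t0 C0 H2 H4.
have t3 : 0 < t ^+ 3 by rewrite exprn_gt0.
have [t1|t1] := leP t 1.
  have -> : \sum_(k <- box N) lam k * a k =
      \sum_(k <- box N) (1 + t * lam k)^-1 * ((1 + t * lam k) * (lam k * a k)).
    apply: eq_bigr => k _; rewrite mulKf//.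
    by apply: lt0r_neq0; apply: den_gt0; exact: ltW.
  apply: (le_trans (cauchy_schwarz _ _ _)).
  apply: (@le_trans _ _ (25 / t * (4 * C / t ^+ 2))); last first.
    rewrite le_eqVlt; apply/orP; left; apply/eqP; field; exact: lt0r_neq0.
  apply: ler_pM.
  - by apply: sumr_ge0 => k _; rewrite sqr_ge0.
  - by apply: sumr_ge0 => k _; rewrite sqr_ge0.
  - apply: (le_trans _ (lattice_resolvent N t0 t1)).
    by apply: ler_sum => k _; rewrite exprVn.
  apply: (@le_trans _ _ (2 * XX N 2 a + 2 * (t ^+ 2 * XX N 4 a))).
    rewrite /XX !mulr_sumr -big_split /=; apply: ler_sum => k _.
    have := lam_ge0 (R := R) k; set l := lam k => l0.
    rewrite -subr_ge0; have -> : 2 * (l ^+ 2 * a k ^+ 2) + 2 * (t ^+ 2 * (l ^+ 4 * a k ^+ 2)) -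
      ((1 + t * l) * (l * a k)) ^+ 2 = (l * a k * (1 - t * l)) ^+ 2 by ring.
    exact: sqr_ge0.
  rewrite ler_pdivlMr ?exprn_gt0//.
  have -> : (2 * XX N 2 a + 2 * (t ^+ 2 * XX N 4 a)) * t ^+ 2 =
    2 * (t ^+ 2 * XX N 2 a) + 2 * (t ^+ 4 * XX N 4 a) by ring.
  lra.
have -> : \sum_(k <- box N) lam k * a k =
    \sum_(k <- box N) (if k != 0 then (lam k)^-1 else 0) * (lam k ^+ 2 * a k).
  apply: eq_bigr => k _; case: eqVneq => [->|k0] /=; first by rewrite lam00 !mul0r.
  have := lam_gt0 (R := R) k0 => l0; field; exact: lt0r_neq0.
apply: (le_trans (cauchy_schwarz _ _ _)).
apply: (@le_trans _ _ (49 * XX N 4 a)).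
  apply: ler_pM.
  - by apply: sumr_ge0 => k _; rewrite sqr_ge0.
  - by apply: sumr_ge0 => k _; rewrite sqr_ge0.
  - apply: (le_trans _ (lattice_two N)); rewrite [leRHS]big_mkcond /=.
    apply: ler_sum => k _; case: eqVneq => _ /=; first by rewrite expr0n.
    by rewrite exprVn.
  - by apply: ler_sum => k _; rewrite exprMn -exprM.
rewrite ler_pdivlMr//.
have X0 := XX_ge0 N 4 a.
have : t ^+ 3 * XX N 4 a <= t ^+ 4 * XX N 4 a.
  by rewrite ler_wpM2r// (exprS t 3) ler_peMl// ltW.
move: H4 X0; set x := XX N 4 a; set u := t ^+ 3; set v := t ^+ 4 => *; nra.
Qed.

Lemma lam_outside N k : k \notin box N -> N%:R ^+ 2 <= lam k :> R.
Proof.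
move=> kN; apply: (le_trans _ (lam_lower k)).
rewrite -natrX -!rmorphXn -rmorphD /= -[(N ^ 2)%N%:R]/((N ^ 2)%N%:Z%:~R) ler_int.
move: kN; rewrite mem_box; move: (k.1) (k.2) => p q; rewrite -mulnn PoszM => /nandP[|] h; nia.
Qed.

(** Off [box N] one has [lrt >= N], so [lrt <= N ^ (-3) * lam ^ 2]; Cauchy-Schwarz over at most
    [25 * N ^ 2] modes gives back one power of [N], and [qq_level] is used at level 4. The constant
    satisfies [160 ^ 2 = 25 * 4 ^ 5]. *)
Lemma tail_bound N a : (0 < N)%N -> (forall k, 0 <= a k) -> supp N a -> a 0 = 0 ->
  (\sum_(k <- box (N + N) | k \notin box N) lrt k * qq N a k) ^+ 2 <=
  (160 * UU N a / N%:R ^+ 2) ^+ 2 * XX N 4 a.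
Proof.
move=> N0 a0 sa a00.
have q0 k : 0 <= qq N a k by apply: sumr_ge0 => l _; rewrite mulr_ge0 ?bb_ge0.
have n0 : 0 < N%:R :> R by rewrite ltr0n.
have lamN := @lam_outside N.
have termb k : k \notin box N -> lrt k * qq N a k <= (N%:R ^+ 3)^-1 * (lam k ^+ 2 * qq N a k).
  move=> kN; have hk := lamN k kN.
  rewrite [leRHS]mulrA ler_wpM2r// mulrC ler_pdivlMr ?exprn_gt0//.
  have nl : N%:R <= lrt k by rewrite -(ger0_norm (ltW n0)) -sqrtr_sqr ler_sqrt ?lam_ge0.
  have -> : lam k ^+ 2 = lrt k * lrt k ^+ 3 by rewrite -lrt_sqr; ring.
  rewrite ler_wpM2l ?lrt_ge0// lerXn2r ?nnegrE ?(ltW n0) ?lrt_ge0//.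
apply: (@le_trans _ _ ((\sum_(k <- box (N + N)) (N%:R ^+ 3)^-1 * (lam k ^+ 2 * qq N a k)) ^+ 2)).
  rewrite lerXn2r ?nnegrE.
  - by [].
  - by apply: sumr_ge0 => k _; rewrite mulr_ge0 ?lrt_ge0.
  - by apply: sumr_ge0 => k _; rewrite !mulr_ge0 ?invr_ge0 ?exprn_ge0 ?lam_ge0 ?(ltW n0).
  rewrite [leRHS](bigID (fun k => k \in box N)) /= -[leLHS]add0r lerD//.
    by apply: sumr_ge0 => k _; rewrite !mulr_ge0 ?invr_ge0 ?exprn_ge0 ?lam_ge0 ?(ltW n0).
  by apply: ler_sum.
apply: (le_trans (cauchy_schwarz _ _ _)).
rewrite sum_const_seq size_box.
apply: (@le_trans _ _ ((25 * N%:R ^+ 2) / N%:R ^+ 6 * (4 ^+ 5 * UU N a ^+ 2 * XX N 4 a))).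
  apply: ler_pM.
  - by rewrite mulr_ge0 ?sqr_ge0.
  - by apply: sumr_ge0 => k _; rewrite sqr_ge0.
  - rewrite exprVn -exprM ler_wpM2r ?invr_ge0 ?exprn_ge0 ?(ltW n0)//.
    by rewrite -natrX -natrM ler_nat -!mulnn; nia.
  rewrite (eq_bigr (fun k => lam k ^+ 4 * qq N a k ^+ 2)); last first.
    by move=> k _; rewrite exprMn -exprM.
  exact: qq_level.
rewrite le_eqVlt; apply/orP; left; apply/eqP.
by move: (UU N a) (XX N 4 a) => u x; field; exact: lt0r_neq0.
Qed.

End Arrays.

(** * Parabolic smoothing with time weights *)

Section Smoothing.
Context {R : realType}.

Lemma gronwall (x y g r : nat -> R) (m0 : nat) :
  (forall n, 0 <= x n) -> (forall n, 0 <= y n) -> (forall n, 0 <= g n) -> (forall n, 0 <= r n) ->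
  (forall n, (m0 <= n)%N -> x n.+1 + y n.+1 <= x n * (1 + g n) + r n) ->
  forall n, (m0 <= n)%N -> x n + \sum_(m0.+1 <= j < n.+1) y j <=
    expR (\sum_(m0 <= j < n) g j) * (x m0 + \sum_(m0 <= j < n) r j).
Proof.
move=> x0 y0 g0 r0 H; elim => [|n IH].
  by rewrite leqn0 => /eqP ->; rewrite !big_geq// expR0 mul1r !addr0.
rewrite leq_eqVlt => /orP[/eqP <-|].
  by rewrite !big_geq// expR0 mul1r !addr0.
rewrite ltnS => mn; rewrite big_nat_recr//= [in leRHS]big_nat_recr//= [X in _ * (_ + X)]big_nat_recr//=.
have {}IH := IH mn; have {}H := H n mn.
rewrite expRD; set S := \sum_(_ <= j < n.+1) _ in IH *; set e := expR _ in IH *.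
set rho := \sum_(_ <= j < n) r j in IH *; set eg := expR (g n).
have S0 : 0 <= S by apply: sumr_ge0.
have rho0 : 0 <= rho by apply: sumr_ge0.
have e1 : 1 <= e by rewrite -expR0 ler_expR sumr_ge0.
have h1 : 1 + g n <= eg by exact: expR_ge1Dx.
have eg1 : 1 <= eg by rewrite -expR0 ler_expR.
apply: (@le_trans _ _ ((1 + g n) * (x n + S) + r n)).
  have := g0 n; have := x0 n; nra.
apply: (@le_trans _ _ (eg * (e * (x m0 + rho)) + r n)).
  rewrite lerD2r ler_pM ?addr_ge0//; exact: g0.
rewrite mulrA [eg * e]mulrC addrA [leRHS]mulrDr lerD2l.
by rewrite ler_peMl// mulr_ege1.
Qed.

(* All that parabolic smoothing uses about the moduli [a n k] of the Fourier
   coefficients of the solution. *)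
Definition dynamics (N : nat) (tau : R) (a : nat -> int * int -> R) (E : R) :=
  [/\ 0 < tau, (forall n k, 0 <= a n k), (forall n, supp N (a n)) & (forall n, a n 0 = 0)] /\
  [/\ (forall n k, k \in box N -> (1 + tau * lam k) * a n.+1 k <=
         a n k + tau * lrt k * qq N (a n) k),
      (forall n, (0 < n)%N -> XX N 0 (a n) <= E) &
      (forall n, \sum_(1 <= m < n.+1) tau * XX N 1 (a m) <= E)].

Lemma pow_step (t u : R) (m : nat) : 0 <= u -> 0 <= t ->
  (t + u) ^+ m.+1 - t ^+ m.+1 <= m.+1%:R * u * (t + u) ^+ m.
Proof.
move=> u0 t0; elim: m => [|m IH]; first by rewrite !expr1 expr0 mulr1 mul1r addrAC subrr add0r.
have tu0 : 0 <= t + u by rewrite addr_ge0.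
have E : (t + u) ^+ m.+2 - t ^+ m.+2 = (t + u) * ((t + u) ^+ m.+1 - t ^+ m.+1) + u * t ^+ m.+1.
  by rewrite !(exprS _ m.+1); ring.
rewrite E -natr1 [leRHS](_ : _ = (t + u) * (m.+1%:R * u * (t + u) ^+ m) + u * (t + u) ^+ m.+1); last first.
  by rewrite (exprS (t + u) m); ring.
rewrite lerD// ler_wpM2l// lerXn2r ?nnegrE// lerDl//.
Qed.

(** Induction on the level. The increments of the weight [t ^ (s + 1)] cost [t ^ s * XX (s + 1)],
    summable as the dissipation of level [s]. The growth rates [tau * UU ^ 2] have a bounded sum by
    [UU_le_XX1] and the energy dissipation, so a single constant serves all times, all [N] and all
    [tau]. *)
Lemma smoothing (E : R) (s : nat) : 0 <= E -> exists2 C : R, 0 <= C &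
  forall N tau a, dynamics N tau a E -> forall n, (s <= n)%N -> (0 < n)%N ->
    (n%:R * tau) ^+ s * XX N s (a n) <= C /\
    \sum_(s.+1 <= j < n.+1) tau * ((j%:R * tau) ^+ s * XX N s.+1 (a j)) <= C.
Proof.
move=> E0; elim: s => [|s [C C0 IH]].
  exists E => // N tau a [_ [_ h1 h2]] n _ n0; rewrite expr0 mul1r h1//; split => //.
  by under eq_bigr do rewrite expr0 mul1r.
have [d4 Ed4 d40] : exists2 d : R, d = 4 ^+ s.+2 & 0 <= d.
  by exists (4 ^+ s.+2) => //; exact: exprn_ge0.
pose G := d4 * 49 * E.
pose K := (1 + G) * (s.+1%:R * 2 ^+ s).
have G0 : 0 <= G by rewrite /G mulr_ge0// mulr_ge0.
have K0 : 0 <= K by apply: mulr_ge0; [exact: addr_ge0|apply: mulr_ge0 => //; exact: exprn_ge0].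
have B0 : 0 <= expR G * (s.+1%:R * C + K * C).
  apply: mulr_ge0; first exact: expR_ge0.
  by apply: addr_ge0; apply: mulr_ge0.
exists (expR G * (s.+1%:R * C + K * C)) => // N tau a D n sn n0.
have [[t0 a0 sa a00] [st h1 h2]] := D.
have {}IH m := IH N tau a D m.
have t0' := ltW t0.
pose T (m : nat) := m%:R * tau.
have T0 m : 0 <= T m by rewrite mulr_ge0.
have TS m : T m.+1 = T m + tau by rewrite /T -natr1 mulrDl mul1r.
pose x m := T m ^+ s.+1 * XX N s.+1 (a m).
pose y m := tau * (T m ^+ s.+1 * XX N s.+2 (a m)).
pose g m := tau * (d4 * UU N (a m) ^+ 2).
pose r m := (T m.+1 ^+ s.+1 - T m ^+ s.+1) * XX N s.+1 (a m) * (1 + g m).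
have x0 m : 0 <= x m by rewrite mulr_ge0 ?XX_ge0// exprn_ge0.
have y0 m : 0 <= y m by rewrite !mulr_ge0 ?XX_ge0// exprn_ge0.
have g0 m : 0 <= g m by rewrite /g mulr_ge0// mulr_ge0// sqr_ge0.
have d0 m : 0 <= T m.+1 ^+ s.+1 - T m ^+ s.+1.
  by rewrite subr_ge0 lerXn2r ?nnegrE// TS lerDl.
have r0 m : 0 <= r m.
  by apply: mulr_ge0; [apply: mulr_ge0 => //; exact: XX_ge0|exact: addr_ge0].
have gX m : g m <= d4 * 49 * (tau * XX N 1 (a m)).
  rewrite /g mulrCA -mulrA ler_wpM2l//.
  by rewrite [leRHS]mulrCA ler_wpM2l// UU_le_XX1.
have sumg m : \sum_(s.+1 <= j < m) g j <= G.
  apply: (@le_trans _ _ (d4 * 49 * \sum_(1 <= j < m.+1) tau * XX N 1 (a j))); last first.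
    by rewrite /G ler_wpM2l// mulr_ge0 ?exprn_ge0//.
  have [sm|sm] := leqP s.+1 m; last first.
    rewrite big_geq ?(ltnW sm)// mulr_ge0 ?mulr_ge0 ?exprn_ge0// sumr_ge0// => j _.
    by rewrite mulr_ge0 ?XX_ge0.
  rewrite mulr_sumr [leRHS](@big_cat_nat _ _ _ s.+1) ?(leqW sm)//= [X in _ <= _ + X]big_nat_recr//=.
  apply: (@le_trans _ _ (\sum_(s.+1 <= j < m) d4 * 49 * (tau * XX N 1 (a j)))).
    exact: ler_sum.
  rewrite addrCA lerDl addr_ge0//.
    by apply: sumr_ge0 => j _; rewrite mulr_ge0 ?(mulr_ge0 t0') ?XX_ge0// mulr_ge0.
  by rewrite mulr_ge0 ?(mulr_ge0 t0') ?XX_ge0// mulr_ge0.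
have g1 m : (s.+1 <= m)%N -> g m <= G.
  move=> sm; apply: (le_trans _ (sumg m.+1)); rewrite big_nat_recr//= lerDr.
  exact: sumr_ge0.
have step m : (s.+1 <= m)%N -> x m.+1 + y m.+1 <= x m * (1 + g m) + r m.
  move=> _; have := step_level s.+1 t0' (a0 m) (a0 m.+1) (sa m) (a00 m) (st m).
  rewrite -Ed4 -/(g m) => H.
  have -> : x m * (1 + g m) + r m = T m.+1 ^+ s.+1 * (XX N s.+1 (a m) * (1 + g m)).
    by rewrite /x /r; ring.
  have -> : x m.+1 + y m.+1 = T m.+1 ^+ s.+1 * (XX N s.+1 (a m.+1) + tau * XX N s.+2 (a m.+1)).
    by rewrite /x /y; ring.
  by rewrite ler_wpM2l// exprn_ge0.
have rb m : (s.+1 <= m)%N -> r m <= K * (tau * (T m ^+ s * XX N s.+1 (a m))).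
  move=> sm; have m0 : (0 < m)%N by exact: leq_trans sm.
  have h3 : T m.+1 ^+ s.+1 - T m ^+ s.+1 <= s.+1%:R * tau * (2 ^+ s * T m ^+ s).
    rewrite TS; apply: (le_trans (pow_step s t0' (T0 m))).
    rewrite ler_wpM2l ?mulr_ge0// -exprMn lerXn2r ?nnegrE ?addr_ge0 ?mulr_ge0//.
    rewrite mulr_natl mulr2n lerD2l /T -[leLHS]mul1r ler_wpM2r//.
    by rewrite ler1n.
  rewrite /r; apply: (@le_trans _ _ (s.+1%:R * tau * (2 ^+ s * T m ^+ s) * XX N s.+1 (a m) * (1 + G))).
    apply: ler_pM.
    - exact: mulr_ge0 (d0 m) (XX_ge0 _ _ _).
    - exact: addr_ge0.
    - exact: ler_wpM2r (XX_ge0 _ _ _) _ _ h3.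
    - by rewrite lerD2l g1.
  by rewrite le_eqVlt; apply/orP; left; apply/eqP; rewrite /K; ring.
have sumr m : (s.+1 <= m)%N -> \sum_(s.+1 <= j < m) r j <= K * C.
  move=> sm; have m0 : (0 < m)%N by exact: leq_trans sm.
  apply: (@le_trans _ _ (\sum_(s.+1 <= j < m.+1) K * (tau * (T j ^+ s * XX N s.+1 (a j))))).
    rewrite [leRHS]big_nat_recr//= -[leLHS]addr0 lerD//.
      by rewrite big_nat [leRHS]big_nat; apply: ler_sum => j /andP[sj _]; exact: rb.
    apply: mulr_ge0 => //; apply: mulr_ge0 => //.
    by apply: mulr_ge0; [exact: exprn_ge0|exact: XX_ge0].
  rewrite -mulr_sumr ler_wpM2l//; exact: (IH m (ltnW sm) m0).2.
(* Up to the factor [s.+1], the starting value is the single term at index [s.+1] of the dissipation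
   sum of level [s]. Each level thus uses up one time step. *)
have x1 : x s.+1 <= s.+1%:R * C.
  have [_] := IH s.+1 (leqnSn s) (ltn0Sn s).
  rewrite big_nat1 => H.
  have -> : x s.+1 = s.+1%:R * (tau * (T s.+1 ^+ s * XX N s.+1 (a s.+1))).
    by rewrite /x (exprS _ s) {1}/T; ring.
  by rewrite ler_wpM2l.
have := gronwall x0 y0 g0 r0 step sn.
have S0 : 0 <= \sum_(s.+2 <= j < n.+1) y j by apply: sumr_ge0.
have RB : expR (\sum_(s.+1 <= j < n) g j) * (x s.+1 + \sum_(s.+1 <= j < n) r j) <=
    expR G * (s.+1%:R * C + K * C).
  apply: ler_pM; rewrite ?expR_ge0 ?addr_ge0 ?sumr_ge0//.
    by rewrite ler_expR.
  by rewrite lerD// sumr.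
move=> /le_trans/(_ RB) H; split; apply: (le_trans _ H); first by rewrite lerDl.
by rewrite lerDr.
Qed.

(** Smoothing is used at levels 1, 2 and 4, whence [4 <= n]. The bound on [tau * UU ^ 4] needs none:
    [tau * XX 1] is one term of the dissipation sum, so velocities are of size [tau ^ (-1/4)] from
    the first step on. *)
Lemma late_estimates (E : R) : 0 <= E -> exists2 C : R, 0 < C &
  forall N tau a, dynamics N tau a E -> (0 < N)%N ->
  (forall n, (0 < n)%N -> tau * UU N (a n) ^+ 4 <= C) /\
  forall n, (4 <= n)%N -> let t := n%:R * tau in
    [/\ \sum_(k <- box N) lam k * a n k <= C / (t * Num.sqrt t),
        \sum_(k <- box (N + N) | k \notin box N) lrt k * qq N (a n) k <= C * UU N (a n) / (N%:R ^+ 2 * t ^+ 2) &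
        t * UU N (a n) ^+ 4 <= C].
Proof.
move=> E0.
have [C1 C10 H1] := smoothing 1 E0.
have [C2 C20 H2] := smoothing 2 E0.
have [C4 C40 H4] := smoothing 4 E0.
pose B := C2 + C4.
have B0 : 0 <= B by rewrite addr_ge0.
pose sB := Num.sqrt (100 * B); pose sC := 160 * Num.sqrt C4.
have sB0 : 0 <= sB by exact: sqrtr_ge0.
have sC0 : 0 <= sC by rewrite mulr_ge0 ?sqrtr_ge0.
pose K1 := 49 ^+ 2 * (E * E); pose K2 := 49 ^+ 2 * (E * C1).
have K10 : 0 <= K1 by rewrite !mulr_ge0 ?exprn_ge0//.
have K20 : 0 <= K2 by rewrite !mulr_ge0 ?exprn_ge0//.
have aux (p q r s : R) : 0 <= p -> 0 <= q -> 0 <= r -> 0 <= s ->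
    [/\ p <= 1 + p + q + r + s, q <= 1 + p + q + r + s, r <= 1 + p + q + r + s,
      s <= 1 + p + q + r + s & 0 < 1 + p + q + r + s].
  by move=> *; split; lra.
have [i1 i2 i3 i4 i5] := aux sB sC K1 K2 sB0 sC0 K10 K20.
exists (1 + sB + sC + K1 + K2) => //.
move=> N tau a D N0; have [[t0 a0 sa a00] [st h1 h2]] := D.
have N0' : 0 < N%:R :> R by rewrite ltr0n.
split.
  move=> n n0; apply: (@le_trans _ _ K1); last exact: i3.
  have U := @UU_le_XX01 _ N (a n) (a0 n).
  have X1 : tau * XX N 1 (a n) <= E.
    apply: (le_trans _ (h2 n)); rewrite big_nat_recr//= lerDr sumr_ge0// => j _.
    by rewrite mulr_ge0 ?XX_ge0// ltW.
  apply: (@le_trans _ _ (tau * (49 ^+ 2 * (XX N 0 (a n) * XX N 1 (a n))))).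
    by rewrite ler_wpM2l// ltW.
  rewrite /K1 mulrCA ler_wpM2l ?exprn_ge0// mulrCA ler_pM ?XX_ge0 ?h1//.
  by rewrite mulr_ge0 ?XX_ge0// ltW.
move=> n n4 t; have n0 : (0 < n)%N by exact: leq_trans n4.
have T0 : 0 < t by rewrite mulr_gt0// ltr0n.
have sT0 : 0 < Num.sqrt t by rewrite sqrtr_gt0.
have X1 := (H1 N tau a D n n0 n0).1; rewrite expr1 in X1.
have X2 := (H2 N tau a D n (leq_trans _ n4) n0).1; rewrite -/t in X1 X2.
have X4 := (H4 N tau a D n n4 n0).1; rewrite -/t in X4.
have {}X2 := X2 isT.
clearbody t.
split.
- apply: (@le_trans _ _ (sB / (t * Num.sqrt t))); last first.
    by rewrite ler_wpM2r// invr_ge0 mulr_ge0// ltW.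
  have X2B : t ^+ 2 * XX N 2 (a n) <= B by rewrite (le_trans X2)// lerDl.
  have X4B : t ^+ 4 * XX N 4 (a n) <= B by rewrite (le_trans X4)// lerDr.
  have Y := hessian_bound (a0 n) (a00 n) T0 B0 X2B X4B.
  rewrite -(@ler_pXn2r _ 2) ?nnegrE//; last 2 first.
  + by apply: sumr_ge0 => k _; rewrite mulr_ge0 ?lam_ge0.
  + by rewrite divr_ge0 ?mulr_ge0 ?(ltW T0) ?(ltW sT0).
  apply: (le_trans Y); rewrite exprMn exprVn [(t * _) ^+ 2]exprMn !sqr_sqrtr ?mulr_ge0 ?(ltW T0)//.
  by rewrite -exprSr.
- have := @tail_bound _ N (a n) N0 (a0 n) (sa n) (a00 n) => Z.
  apply: (@le_trans _ _ (sC * UU N (a n) / (N%:R ^+ 2 * t ^+ 2))); last first.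
    rewrite ler_wpM2r// ?ler_wpM2r ?UU_ge0//.
    by rewrite invr_ge0 mulr_ge0// exprn_ge0// ltW.
  rewrite -(@ler_pXn2r _ 2) ?nnegrE//; last 2 first.
  + apply: sumr_ge0 => k _; rewrite mulr_ge0 ?lrt_ge0// sumr_ge0// => l _.
    by rewrite mulr_ge0 ?bb_ge0.
  + by rewrite !mulr_ge0 ?UU_ge0 ?invr_ge0 ?mulr_ge0 ?exprn_ge0 ?sqrtr_ge0 ?(ltW T0) ?(ltW N0').
  apply: (le_trans Z).
  have X4' : XX N 4 (a n) <= C4 / t ^+ 4 by rewrite ler_pdivlMr ?exprn_gt0// mulrC.
  apply: (@le_trans _ _ ((160 * UU N (a n) / N%:R ^+ 2) ^+ 2 * (C4 / t ^+ 4))).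
    by rewrite ler_wpM2l// sqr_ge0.
  have sq : Num.sqrt C4 ^+ 2 = C4 by rewrite sqr_sqrtr.
  rewrite /sC -{1}sq le_eqVlt; apply/orP; left; apply/eqP.
  by move: (Num.sqrt C4) (UU N (a n)) => c u; field; rewrite !lt0r_neq0.
- apply: (@le_trans _ _ K2); last exact: i4.
  have U := @UU_le_XX01 _ N (a n) (a0 n).
  apply: (@le_trans _ _ (t * (49 ^+ 2 * (XX N 0 (a n) * XX N 1 (a n))))).
    by rewrite ler_wpM2l// ltW.
  rewrite /K2 mulrCA ler_wpM2l ?exprn_ge0// mulrCA ler_pM ?XX_ge0 ?h1//.
  by rewrite mulr_ge0 ?XX_ge0// ltW.
Qed.

End Smoothing.

(** * The scheme in Fourier coefficients *)

Section Galerkin.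
Context {R : realType}.
Implicit Types (c : int * int -> R[i]) (k l : int * int) (x : R * R).

(** The symbol of transport: the Biot-Savart velocity of the mode [l] against the gradient of
    another mode. It is a cross product, so [k] and [k - l] give the same value ([Kc_sub]). *)
Definition Kc l k : R := (l.1%:~R * k.2%:~R - l.2%:~R * k.1%:~R) / (l.1%:~R ^+ 2 + l.2%:~R ^+ 2).

(* [adv N c] are the coefficients of the advection term [u . grad w]
   (tp_advection), and [pc c] those of the stream function. The division by
   zero in [Kc 0 k] and [pc c 0] gives [0]. *)
Definition adv (N : nat) c k : R[i] := \sum_(l <- box N) (Kc l k)%:C * (c l * c (k - l)).

Definition pc c : int * int -> R[i] := rs (fun k => - (lam k)^-1) c.

(* Fourier coefficients of the two components of [grad_perp psi]. *)
Definition uc (j : bool) c k : R[i] := if j then dcoef false (pc c) k else - dcoef true (pc c) k.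

Definition trunc (N : nat) c k : R[i] := if k \in box N then c k else 0.

Lemma supp_trunc N c : supp N (trunc N c).
Proof. by move=> k /negbTE kN; rewrite /trunc kN. Qed.

Lemma tp_trunc N c : tp N (trunc N c) = tp N c.
Proof. by apply: eq_tp => k kN; rewrite /trunc kN. Qed.

Lemma herm_trunc N c : herm c -> herm (trunc N c).
Proof. by move=> hc k; rewrite /trunc mem_boxN; case: ifP => _; rewrite ?hc// conjc0. Qed.

Lemma lamN k : lam (- k) = lam k :> R.
Proof. by rewrite !lamE /= !rmorphN /= !sqrrN. Qed.

Lemma herm_rs (a : int * int -> R) c : (forall k, a (- k) = a k) -> herm c -> herm (rs a c).
Proof. by move=> ha hc k; rewrite /rs ha hc conjcZ. Qed.

Lemma herm_dcoef j c : herm c -> herm (dcoef j c).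
Proof.
move=> hc k; rewrite /dcoef hc.
have -> : (co j (- k))%:~R = - (co j k)%:~R :> R by rewrite /co; case: j; rewrite /= rmorphN.
case: (c k) => p q; apply/eqP; rewrite eq_complex /=.
by apply/andP; split; apply/eqP; ring.
Qed.

Lemma herm_opp c : herm c -> herm (fun k => - c k).
Proof.
move=> hc k; rewrite hc; case: (c k) => p q.
by apply/eqP; rewrite eq_complex /= !eqxx.
Qed.

Lemma herm_sub c c' : herm c -> herm c' -> herm (c - c').
Proof.
move=> hc hc' k; rewrite -[(c - c') (- k)]/(c (- k) - c' (- k)) hc hc' -[(c - c') k]/(c k - c' k).
case: (c k) (c' k) => p q [p' q'].
by apply/eqP; rewrite eq_complex /=; apply/andP; split; apply/eqP; ring.
Qed.

Lemma herm_pc c : herm c -> herm (pc c).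
Proof. by apply: herm_rs => k; rewrite lamN. Qed.

Lemma herm_uc j c : herm c -> herm (uc j c).
Proof.
move=> hc; rewrite /uc; case: j; first exact/herm_dcoef/herm_pc.
exact/herm_opp/herm_dcoef/herm_pc.
Qed.

Lemma supp_rs N (a : int * int -> R) c : supp N c -> supp N (rs a c).
Proof. by move=> sc k /sc; rewrite /rs => ->; rewrite mulr0. Qed.

Lemma supp_dcoef N j c : supp N c -> supp N (dcoef j c).
Proof. by move=> sc k /sc; rewrite /dcoef => ->; rewrite mulr0. Qed.

(** The velocity is divergence free, so the advection is also the divergence of the flux [u * w].
    This form feeds the Duhamel sums and the first energy step, that of [adv_conv] the transport
    argument. The term [l = 0] is treated apart because of the division. *)
Lemma adv_flux N c k :
  adv N c k = dcoef false (conv N (uc false c) c) k + dcoef true (conv N (uc true c) c) k.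
Proof.
rewrite /dcoef /conv !mulr_sumr -big_split /=; apply: eq_bigr => l _.
rewrite /uc /pc /dcoef /rs lamE /Kc /co.
have [->|l0] := eqVneq l 0.
  rewrite /= !mulr0z !mul0r subrr mul0r !mulr0.
  move: (- _^-1) (c 0) (c (k - 0)) => s [a b] [d e].
  by apply/eqP; rewrite eq_complex /=; apply/andP; split; apply/eqP; ring.
have d0 : l.1%:~R ^+ 2 + l.2%:~R ^+ 2 != 0 :> R.
  have := lam_gt0 (R := R) l0; rewrite lamE => /lt0r_neq0.
  by rewrite mulf_eq0 negb_or => /andP[].
have p0 : pi != 0 :> R by rewrite lt0r_neq0// pi_gt0.
move: (pi : R) (l.1%:~R : R) (l.2%:~R : R) d0 p0 => p x y d0 p0.
move: (c l) (c (k - l)) => [a b] [d e].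
by apply/eqP; rewrite eq_complex /=; apply/andP; split; apply/eqP; field; rewrite ?d0 ?p0.
Qed.

Lemma herm_add c c' : herm c -> herm c' -> herm (fun k => c k + c' k).
Proof.
move=> hc hc' k; rewrite hc hc'; case: (c k) (c' k) => p q [p' q'].
by apply/eqP; rewrite eq_complex /=; apply/andP; split; apply/eqP; ring.
Qed.

Lemma herm_adv N c : herm c -> herm (adv N c).
Proof.
move=> hc k; rewrite !adv_flux; move: k.
by apply: herm_add; apply: herm_dcoef; apply: herm_conv => //; exact: herm_uc.
Qed.

Lemma adv_conv N c k : adv N c k =
  conv N (uc false c) (dcoef false c) k + conv N (uc true c) (dcoef true c) k.
Proof.
rewrite /conv -big_split /=; apply: eq_bigr => l _.
rewrite /uc /pc /dcoef /rs lamE /Kc /co.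
have [->|l0] := eqVneq l 0.
  rewrite /= !mulr0z !mul0r subrr mul0r !mulr0.
  move: (- _^-1) (c 0) (c (k - 0)) => s [a b] [d e].
  by apply/eqP; rewrite eq_complex /=; apply/andP; split; apply/eqP; ring.
have d0 : l.1%:~R ^+ 2 + l.2%:~R ^+ 2 != 0 :> R.
  have := lam_gt0 (R := R) l0; rewrite lamE => /lt0r_neq0.
  by rewrite mulf_eq0 negb_or => /andP[].
have p0 : pi != 0 :> R by rewrite lt0r_neq0// pi_gt0.
rewrite /= !rmorphB /=.
move: (pi : R) (l.1%:~R : R) (l.2%:~R : R) d0 p0 => p x y d0 p0.
move: (c l) (c (k - l)) => [a b] [d e].
by apply/eqP; rewrite eq_complex /=; apply/andP; split; apply/eqP; field; rewrite ?d0 ?p0.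
Qed.

Lemma tp_advection N c x : herm c -> supp N c ->
  tp N (uc false c) x * tp N (dcoef false c) x + tp N (uc true c) x * tp N (dcoef true c) x =
  tp (N + N) (adv N c) x.
Proof.
move=> hc sc; rewrite !tp_mul; try exact: herm_uc; try exact: supp_dcoef.
by rewrite -tpD; congr (_ x); apply: eq_tp => k _; rewrite adv_conv.
Qed.

Lemma tp_flux N j c x : herm c -> supp N c ->
  tp N (uc j c) x * tp N c x = tp (N + N) (conv N (uc j c) c) x.
Proof. by move=> hc sc; rewrite tp_mul//; exact: herm_uc. Qed.

Lemma fourier_proj_tp N L c : herm c -> (N <= L)%N -> fourier_proj N (tp L c) = tp N c.
Proof.
move=> hc NL; apply/funext => x; rewrite /fourier_proj /fourier_sum sum_modes cRe_sum.
apply: eq_big_seq => k kN; rewrite fourier_coef_tp//; exact: sub_box kN.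
Qed.

Lemma fourier_projE N (f : R * R -> R) : fourier_proj N f = tp N (fourier_coef f).
Proof. by apply/funext => x; rewrite /fourier_proj /fourier_sum sum_modes cRe_sum. Qed.

(** The scheme solved mode by mode. Every solution coincides with it ([scheme_traj]), so all later
    estimates concern this sequence. *)
Fixpoint traj (tau : R) (N : nat) (c0 : int * int -> R[i]) (n : nat) : int * int -> R[i] :=
  if n is m.+1 then
    trunc N (sv tau (traj tau N c0 m - rs (fun=> tau) (adv N (traj tau N c0 m))))
  else trunc N c0.

Lemma traj_supp tau N c0 n : supp N (traj tau N c0 n).
Proof. by case: n => [|n]; exact: supp_trunc. Qed.

Lemma herm_sv tau c : herm c -> herm (sv tau c).
Proof. by apply: herm_rs => k; rewrite lamN. Qed.

Lemma traj_herm tau N c0 n : herm c0 -> herm (traj tau N c0 n).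
Proof.
move=> h0; elim: n => [|n IH]; first exact: herm_trunc.
by apply/herm_trunc/herm_sv/herm_sub => //; apply: herm_rs => //; exact: herm_adv.
Qed.

Lemma adv0 N c : adv N c 0 = 0.
Proof.
rewrite /adv big1// => l _; rewrite /Kc /= !mulr0 subrr mul0r.
by rewrite mul0r.
Qed.

Lemma traj_mean tau N c0 n : c0 0 = 0 -> traj tau N c0 n 0 = 0.
Proof.
move=> h0; elim: n => [|n IH] /=; rewrite /trunc box0//.
by rewrite /sv /rs -[(_ - _) 0]/(_ - _) adv0 IH mulr0 subr0 mulr0.
Qed.

Lemma tp_trajS tau N c0 n : tp N (traj tau N c0 n.+1) =
  tp N (sv tau (traj tau N c0 n - rs (fun=> tau) (adv N (traj tau N c0 n)))).
Proof. exact: tp_trunc. Qed.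

(** [psi] is known only as a [C2] function with the right Laplacian. Its difference from the
    explicit trigonometric polynomial is harmonic, hence has zero gradient. *)
Lemma stream_function N c (psi : R * R -> R) : c 0 = 0 -> inverse_laplacian (tp N c) psi ->
  forall j, dd j psi = tp N (dcoef j (pc c)).
Proof.
move=> c00 [[pp C2p _] lp] j.
have rp : reg psi := reg_C2 pp C2p.
have rc : reg (tp N (pc c)) by exact: reg_tp.
have lz x : laplacian (psi - tp N (pc c)) x = 0.
  rewrite (laplacianB x rp rc) lp laplacian_tp -tpB.
  rewrite /tp big1// => k _; rewrite -[(_ - _) k]/(c k - _) /pc /rs.
  have [->|k0] := eqVneq k 0; first by rewrite c00 !mulr0 subrr mul0r.
  have l0 := lt0r_neq0 (lam_gt0 (R := R) k0).
  suff -> : c k - (- lam k)%:C * ((- (lam k)^-1)%:C * c k) = 0 by rewrite mul0r.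
  case: (c k) => p q; apply/eqP; rewrite eq_complex /=.
  by apply/andP; split; apply/eqP; field.
have H := harmonic_grad0 j (reg_sub rp rc) lz.
apply/funext => x; have := H x; rewrite (ddB j rp rc) dd_tp.
by rewrite -[(_ - _) x]/(dd j psi x - tp N (dcoef j (pc c)) x) => /eqP; rewrite subr_eq0 => /eqP.
Qed.

Lemma fourier_coef_herm (f : R * R -> R) : herm (fourier_coef f).
Proof. by move=> k; exact: fourier_coefN. Qed.

Lemma fourier_coef_mean0 (f : R * R -> R) : mean_zero f -> fourier_coef f 0 = 0.
Proof.
move=> mf; have p0 (x : R * R) : phase 0 x = 0 :> R by rewrite /phase /= !mul0r addr0 mulr0.
rewrite /fourier_coef.
have -> : (fun x => f x * cos (phase 0 x)) = f by apply/funext => x; rewrite p0 cos0 mulr1.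
have -> : (fun x => f x * sin (phase 0 x)) = cst 0 by apply/funext => x; rewrite p0 sin0 mulr0.
rewrite mf Rintegral_cst// mul0r oppr0.
by apply/eqP; rewrite eq_complex /= eqxx.
Qed.

(** Uniqueness of the implicit step: [w n.+1] is only known to be [C2], but its difference from the
    trigonometric polynomial solves the homogeneous resolvent equation, and the maximum principle
    with bound 0 applies. *)
Lemma scheme_traj (tau : R) N (f : R * R -> R) (w : nat -> R * R -> R) : 0 < tau ->
  mean_zero f -> scheme_solution tau N f w ->
  forall n, w n = tp N (traj tau N (fourier_coef f) n).
Proof.
move=> t0 mf [wC w0 [psi Hpsi]]; set c0 := fourier_coef f.
have c00 : c0 0 = 0 by exact: fourier_coef_mean0.
have hc0 : herm c0 by exact: fourier_coef_herm.
elim=> [|n IH]; first by rewrite w0 fourier_projE tp_trunc.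
pose c := traj tau N c0 n; have hc : herm c by exact: traj_herm.
have sc : supp N c by exact: traj_supp.
have cm : c 0 = 0 by exact: traj_mean.
have [iL Heq] := Hpsi n.
rewrite IH -/c in iL; have sf := stream_function cm iL.
have advE : advection (grad_perp (psi n)) (w n) = tp (N + N) (adv N c).
  apply/funext => x; rewrite -tp_advection// /advection /grad_perp /= IH -/c.
  rewrite -[d1 (tp N c)]/(dd false (tp N c)) -[d2 (tp N c)]/(dd true (tp N c)) !dd_tp.
  rewrite -[d1 (psi n)]/(dd false (psi n)) -[d2 (psi n)]/(dd true (psi n)) !sf.
  by congr (_ * _ + _); rewrite -tpN.
have [wp wC2 _] := wC n.+1; have rw := reg_C2 wp wC2.
rewrite tp_trajS -/c; set c' := sv _ _.
have rc : reg (tp N c') by exact: reg_tp.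
apply/funext => x; apply/eqP; rewrite -subr_eq0 -normr_le0.
move: x; apply: (@max_principle_norm _ (w n.+1 - tp N c') tau 0 (reg_sub rw rc) (ltW t0)) => x.
rewrite (laplacianB x rw rc) normr_le0.
have E1 := Heq x; rewrite advE fourier_proj_tp ?leq_addr//  in E1; last exact: herm_adv.
have E2 := tp_sv N (c - rs (fun=> tau) (adv N c)) x (ltW t0); rewrite -/c' tpB tpZ in E2.
rewrite -[(w n.+1 - tp N c') x]/(w n.+1 x - tp N c' x).
have E3 : w n.+1 x - tau * laplacian (w n.+1) x = tp N c x - tau * tp N (adv N c) x.
  rewrite -E1 mulrDr mulrC divfK ?lt0r_neq0// [w n]IH -/c.
  by move: (w n.+1 x) (tp N c x) (tp N _ x) => p q r; ring.
move: E2 E3; move: (w n.+1 x) (laplacian _ _) (laplacian _ _) (tp N c' x) (tp N c x) (tp N _ x).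
by move=> p q r s t u E2 E3; apply/eqP; lra.
Qed.

End Galerkin.

(** * Energy inequality of the semi-implicit step *)

Section Energy.
Context {R : realType}.
Implicit Types (c : int * int -> R[i]) (k l : int * int) (tau : R).

Lemma Kc_sub l k : Kc l (k - l) = Kc l k :> R.
Proof. by rewrite /Kc /= !rmorphB /=; congr (_ / _); ring. Qed.

Lemma Kc_le l k : `|Kc l k| <= lrt k / lrt l :> R.
Proof.
have [->|l0] := eqVneq l 0.
  rewrite /Kc lrt0 invr0 mulr0 /=.
  by rewrite !mulr0z !mul0r subrr mul0r normr0.
have L0 := lam_gt0 (R := R) l0.
rewrite -[leRHS]ger0_norm ?divr_ge0 ?lrt_ge0// -ler_sqr ?nnegrE ?normr_ge0// !real_normK ?num_real//.
rewrite [leRHS]expr_div_n !lrt_sqr ler_pdivlMr; last exact: L0.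
rewrite /Kc !lamE in L0 *.
have p2 : 0 < (2 * pi : R) ^+ 2 by rewrite exprn_gt0// mulr_gt0// pi_gt0.
have d0 : l.1%:~R ^+ 2 + l.2%:~R ^+ 2 != 0 :> R.
  by move: L0 => /lt0r_neq0; rewrite mulf_eq0 negb_or => /andP[].
move: (l.1%:~R : R) (l.2%:~R : R) (k.1%:~R : R) (k.2%:~R : R) ((2 * pi : R) ^+ 2) p2 d0 {L0}.
move=> x y u v p p0 d0.
have -> : ((x * v - y * u) / (x ^+ 2 + y ^+ 2)) ^+ 2 * (p * (x ^+ 2 + y ^+ 2)) =
  p * (x * v - y * u) ^+ 2 / (x ^+ 2 + y ^+ 2) by field.
have dp : 0 < x ^+ 2 + y ^+ 2 by rewrite lt_def d0 addr_ge0 ?sqr_ge0.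
rewrite ler_pdivrMr// -mulrA ler_pM2l//.
by have := sqr_ge0 (x * u + y * v); nra.
Qed.

Lemma adv_le N c k : cmod (adv N c k) <= lrt k * qq N (fun l => cmod (c l)) k.
Proof.
apply: (le_trans (cmod_sum _ _ _)); rewrite /qq mulr_sumr; apply: ler_sum_seq => l _.
rewrite !cmodM cmodr /bb.
apply: (le_trans (ler_wpM2r _ (Kc_le l k))).
  by apply: mulr_ge0; exact: cmod_ge0.
by rewrite le_eqVlt; apply/orP; left; apply/eqP; ring.
Qed.

(** The cross product of [l] with [k] equals that with [k - l], so the derivative can be charged to
    the transported vorticity instead of the output mode. *)
Lemma adv_le_shift N c k : cmod (adv N c k) <=
  \sum_(l <- box N) bb (fun l => cmod (c l)) l * (lrt (k - l) * cmod (c (k - l))).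
Proof.
apply: (le_trans (cmod_sum _ _ _)); apply: ler_sum_seq => l _.
rewrite !cmodM cmodr /bb -Kc_sub.
apply: (le_trans (ler_wpM2r _ (Kc_le l (k - l)))).
  by apply: mulr_ge0; exact: cmod_ge0.
by rewrite le_eqVlt; apply/orP; left; apply/eqP; ring.
Qed.

Lemma adv_L2 N c : supp N c -> \sum_(k <- box N) cmod (adv N c k) ^+ 2 <=
  UU N (fun k => cmod (c k)) ^+ 2 * XX N 1 (fun k => cmod (c k)).
Proof.
move=> sc; set a := fun k => cmod (c k).
have -> : XX N 1 a = \sum_(k <- box N) (lrt k * a k) ^+ 2.
  by apply: eq_bigr => k _; rewrite exprMn lrt_sqr expr1.
have sg : supp N (fun k => lrt k * a k) by move=> k /sc ck; rewrite /a ck cmod0 mulr0.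
have a0 k : 0 <= a k by exact: cmod_ge0.
apply: le_trans (young (bb_ge0 a0) sg).
apply: (@le_trans _ _ (\sum_(k <- box (N + N)) cmod (adv N c k) ^+ 2)).
  by apply: sum_box_sub => [|k]; [exact: leq_addr|exact: sqr_ge0].
apply: ler_sum_seq => k _.
by rewrite ler_sqr ?nnegrE ?cmod_ge0//; [exact: adv_le_shift|exact: le_trans (cmod_ge0 _) (adv_le_shift _ _ _)].
Qed.

(** For fixed [l] the summand changes sign under [k -> l - k]: the discrete form of the antisymmetry
    of transport by a divergence free field. *)
Lemma adv_orthogonal N c : herm c -> supp N c ->
  \sum_(k <- box N) complex.Re ((c k)^*%C * adv N c k) = 0.
Proof.
move=> hc sc.
pose f l k : R := Kc l k * complex.Re ((c k)^*%C * (c l * c (k - l))).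
transitivity (\sum_(k <- box N) \sum_(l <- box N) f l k).
  apply: eq_bigr => k _; rewrite /adv mulr_sumr cRe_sum; apply: eq_bigr => l _.
  by rewrite mulrCA cReZ.
rewrite exchange_big big1_seq// => l /= lN.
have sf : supp N (f l).
  by move=> k /sc ck; rewrite /f ck conjc0 mul0r mulr0.
have sf' : supp N (fun k => f l (- k)) by move=> k kN; rewrite sf// mem_boxN.
have fN k : f l (- (k - l)) = - f l k.
  have -> : - (k - l) = - k + l by rewrite opprB addrC.
  have -> : f l (- k + l) = Kc l (- k + l) * complex.Re ((c (- (k - l)))^*%C * (c l * c (- k))).
    by rewrite /f opprB addrK [- k + l]addrC.
  rewrite !hc.
  have -> : Kc l (- k + l) = - Kc l k :> R.
    by rewrite /Kc /= !rmorphD /= !rmorphN /=; move: (_ ^-1) => d; ring.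
  rewrite /f mulNr; congr (- (_ * _)).
  case: (c (k - l)) (c l) (c k) => p q [p1 q1] [p2 q2] /=.
  by ring.
have E : \sum_(k <- box N) f l k = - \sum_(k <- box N) f l k.
  rewrite -{1}(sum_box_opp N (f l)) -(sum_box_shift sf' lN (leqnn _)).
  under eq_bigr => k _ do rewrite fN.
  by rewrite sumrN (sum_box_widen sf (leq_addr _ _)).
by move: E; move: (\sum_(_ <- _) _) => s E; lra.
Qed.

Section Step.
Variables (N : nat) (tau : R) (c c' : int * int -> R[i]).
Hypotheses (t0 : 0 < tau) (hc : herm c) (sc : supp N c).
Hypothesis (stepE : forall k, k \in box N -> (1 + tau * lam k)%:C * c' k = c k - tau%:C * adv N c k).
Let a k := cmod (c k).
Let a' k := cmod (c' k).

Lemma step_cmod k : k \in box N -> (1 + tau * lam k) * a' k = cmod (c k - tau%:C * adv N c k).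
Proof. by move=> kN; rewrite -stepE// cmodM cmodr ger0_norm// ltW// den_gt0// ltW. Qed.

Lemma step_le k : k \in box N -> (1 + tau * lam k) * a' k <= a k + tau * lrt k * qq N a k.
Proof.
move=> kN; rewrite step_cmod//; apply: (le_trans (cmodD _ _)).
rewrite cmodN cmodM cmodr gtr0_norm// lerD2l -mulrA ler_pM2l//.
exact: adv_le.
Qed.

(** Orthogonality removes the cross term of [|c - tau * adv| ^ 2]; what the explicit advection
    leaves is [tau ^ 2] times its squared L2 norm. The factor 2 on the left comes from
    [(1 + tau * lam) ^ 2 >= 1 + 2 * tau * lam]. *)
Lemma energy_step : XX N 0 a' + 2 * tau * XX N 1 a' <= XX N 0 a + tau ^+ 2 * (UU N a ^+ 2 * XX N 1 a).
Proof.
have -> : XX N 0 a = \sum_(k <- box N) a k ^+ 2 by apply: eq_bigr => k _; rewrite expr0 mul1r.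
apply: (@le_trans _ _ (\sum_(k <- box N) ((1 + tau * lam k) * a' k) ^+ 2)).
  rewrite /XX mulr_sumr -big_split /=; apply: ler_sum_seq => k _.
  rewrite expr0 expr1 exprMn.
  have := sqr_ge0 (a' k); have : 0 <= (tau * lam k) ^+ 2 by exact: sqr_ge0.
  move: (a' k ^+ 2) (lam k) => s l h1 h2.
  by have := mulr_ge0 h1 h2; nra.
have adv2 := adv_L2 sc.
apply: (@le_trans _ _ (\sum_(k <- box N) a k ^+ 2 + tau ^+ 2 * \sum_(k <- box N) cmod (adv N c k) ^+ 2)); last first.
  by rewrite lerD2l ler_pM2l// exprn_gt0.
suff E k : k \in box N -> ((1 + tau * lam k) * a' k) ^+ 2 =
    a k ^+ 2 + tau ^+ 2 * cmod (adv N c k) ^+ 2 - 2 * tau * complex.Re ((c k)^*%C * adv N c k).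
  rewrite (eq_big_seq _ E) sumrB big_split /= -!mulr_sumr adv_orthogonal//.
  by rewrite mulr0 subr0.
move=> kN; rewrite step_cmod// /a !cmod_sqr.
case: (c k) (adv N c k) => p q [p' q'] /=.
by ring.
Qed.

(** [energy_step] does not help at the start, since [XX N 1] of truncated bounded data may grow with
    [N]. Here the advection is the divergence of a flux whose L2 norm is at most [V] times that of
    the vorticity, and the same square as in [step_level] is completed. *)
Lemma first_step (V : R) : (forall j x, `|tp N (uc j c) x| <= V) ->
  XX N 0 a' + tau * XX N 1 a' <= XX N 0 a * (1 + 2 * tau * V ^+ 2).
Proof.
move=> HV.
pose p j := conv N (uc j c) c.
have P2 j : \sum_(k <- box (N + N)) cmod (p j k) ^+ 2 <= V ^+ 2 * \sum_(k <- box N) cmod (c k) ^+ 2.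
  apply: parseval_le => //; first by apply: herm_conv => //; exact: herm_uc.
    exact: supp_conv.
  by move=> x; rewrite -tp_flux// normrM ler_wpM2r.
have P1 j : \sum_(k <- box N) cmod (p j k) ^+ 2 <= V ^+ 2 * XX N 0 a.
  apply: (@le_trans _ _ (\sum_(k <- box (N + N)) cmod (p j k) ^+ 2)).
    by apply: sum_box_sub => [|k]; [exact: leq_addr|exact: sqr_ge0].
  apply: le_trans (P2 j) _; rewrite ler_wpM2l ?sqr_ge0//.
  by apply: ler_sum_seq => k _; rewrite expr0 mul1r.
have A k : cmod (adv N c k) ^+ 2 <= lam k * (cmod (p false k) ^+ 2 + cmod (p true k) ^+ 2).
  rewrite adv_flux -/(p false) -/(p true) !cmod_sqr /dcoef lamE /co.
  case: (p false k) (p true k) => x y [u v] /=.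
  move: (k.1%:~R : R) (k.2%:~R : R) (pi : R) => m n q.
  have := sqr_ge0 (m * u - n * x); have := sqr_ge0 (m * v - n * y).
  rewrite -subr_ge0 => h1; rewrite -subr_ge0 => h2; rewrite -subr_ge0.
  set rhs := _ - _.
  have -> : rhs = (2 * q) ^+ 2 * ((m * u - n * x) ^+ 2 + (m * v - n * y) ^+ 2) by rewrite /rhs; ring.
  by rewrite mulr_ge0 ?sqr_ge0// addr_ge0 ?sqr_ge0.
apply: (@le_trans _ _ (\sum_(k <- box N) (a k ^+ 2 + tau * (cmod (p false k) ^+ 2 + cmod (p true k) ^+ 2)))).
  rewrite /XX mulr_sumr -big_split /=; apply: ler_sum_seq => k kN.
  have -> : lam k ^+ 0 * a' k ^+ 2 + tau * (lam k ^+ 1 * a' k ^+ 2) = (1 + tau * lam k) * a' k ^+ 2 by ring.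
  have D := den_gt0 k (ltW t0).
  rewrite -(ler_pM2l D) mulrA -expr2.
  have -> : (1 + tau * lam k) ^+ 2 * a' k ^+ 2 = ((1 + tau * lam k) * a' k) ^+ 2 by rewrite exprMn.
  rewrite step_cmod//.
  have le1 : cmod (c k - tau%:C * adv N c k) <= a k + tau * cmod (adv N c k).
    by apply: (le_trans (cmodD _ _)); rewrite cmodN cmodM cmodr gtr0_norm.
  apply: (@le_trans _ _ ((a k + tau * cmod (adv N c k)) ^+ 2)).
    by rewrite ler_sqr ?nnegrE ?cmod_ge0// (le_trans (cmod_ge0 _) le1).
  move: (A k) (lam_ge0 (R := R) k) (cmod_ge0 (c k)) (cmod_ge0 (adv N c k)); rewrite -/(a k).
  have : 0 <= cmod (p false k) ^+ 2 + cmod (p true k) ^+ 2 by rewrite addr_ge0 ?sqr_ge0.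
  move: (cmod (p false k) ^+ 2 + cmod (p true k) ^+ 2) (cmod (adv N c k)) (a k) (lam k).
  move=> s d b l s0 ds l0 b0 d0.
  have d1 : d <= Num.sqrt l * Num.sqrt s.
    by rewrite -sqrtrM// -[leLHS](ger0_norm d0) -sqrtr_sqr; exact: ler_wsqrtr.
  have l1 := sqr_sqrtr l0; have s1 := sqr_sqrtr s0.
  move: (Num.sqrt l) (Num.sqrt s) (sqrtr_ge0 l) (sqrtr_ge0 s) d1 l1 s1 => r z r0 z0 d1 <- <-.
  apply: (@le_trans _ _ ((b + tau * (r * z)) ^+ 2)).
    by rewrite ler_sqr ?nnegrE ?addr_ge0 ?mulr_ge0 ?(ltW t0)// lerD2l ler_pM2l.
  rewrite -subr_ge0; set rhs := _ - _.
  have -> : rhs = tau * (z - r * b) ^+ 2 by rewrite /rhs; ring.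
  by rewrite mulr_ge0 ?sqr_ge0// ltW.
rewrite big_split /= -mulr_sumr big_split /=.
have -> : \sum_(k <- box N) a k ^+ 2 = XX N 0 a by apply: eq_bigr => k _; rewrite expr0 mul1r.
have := P1 false; have := P1 true.
move: (XX N 0 a) (V ^+ 2) (\sum_(_ <- _) _) (\sum_(_ <- _) _) => s v s1 s2 h1 h2.
have : tau * (s1 + s2) <= tau * (2 * (v * s)) by rewrite ler_pM2l//; lra.
by nra.
Qed.

End Step.

Lemma traj_step tau N c0 n : 0 < tau -> forall k, k \in box N ->
  (1 + tau * lam k)%:C * traj tau N c0 n.+1 k =
  traj tau N c0 n k - tau%:C * adv N (traj tau N c0 n) k.
Proof.
move=> t0 k kN /=; rewrite /trunc kN /sv /rs.
rewrite -[(_ - _) k]/(traj tau N c0 n k - tau%:C * adv N (traj tau N c0 n) k).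
by rewrite mulrA -rmorphM /= divff ?mul1r// lt0r_neq0// den_gt0// ltW.
Qed.

(** Bootstrap on [E n <= e]. While it holds, [UU_le_XX01] and the smallness of [tau] give
    [tau * UU ^ 2 <= 1], so the explicit error is at most the term [tau * XX 1] carried in [E n],
    and half of the new dissipation is left over to be summed. The first dissipation term is bounded
    by [E 1] separately, whence [2 * e]. *)
Lemma dynamics_traj tau N c0 (V e : R) : 0 < tau -> herm c0 -> c0 0 = 0 ->
  (forall j x, `|tp N (uc j (trunc N c0)) x| <= V) ->
  XX N 0 (fun k => cmod (trunc N c0 k)) * (1 + 2 * tau * V ^+ 2) <= e ->
  tau * (49 * e) ^+ 2 <= 1 ->
  dynamics N tau (fun n k => cmod (traj tau N c0 n k)) (2 * e).
Proof.
move=> t0 h0 c00 HV He te.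
pose a n k := cmod (traj tau N c0 n k); rewrite -/a.
have a0 n k : 0 <= a n k by exact: cmod_ge0.
pose E n := XX N 0 (a n) + tau * XX N 1 (a n).
have E1 : E 1%N <= e.
  apply: le_trans He; apply: first_step => //; first exact: herm_trunc.
    exact: supp_trunc.
  by move=> k kN; rewrite (traj_step _ _ t0).
have XE n s : 0 <= tau * XX N s (a n) by apply: mulr_ge0; [exact: ltW|exact: XX_ge0].
have e0 : 0 <= e by apply: le_trans E1; apply: addr_ge0 (XX_ge0 _ _ _) (XE _ _).
have Estep n : (0 < n)%N -> E n <= e -> E n.+1 + tau * XX N 1 (a n.+1) <= E n.
  move=> n0 En.
  have U1 : tau * UU N (a n) ^+ 2 <= 1.
    have h := UU_le_XX01 N (a0 n).
    have x0 := XX_ge0 N 0 (a n); have x1 := XE n 1%N; rewrite /E in En.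
    have U0 := UU_ge0 N (a0 n).
    rewrite -(ler_pXn2r (n := 2)) ?nnegrE ?ler01 ?mulr_ge0 ?sqr_ge0 ?(ltW t0)// expr1n.
    apply: le_trans te.
    rewrite exprMn -exprM.
    apply: (@le_trans _ _ (tau ^+ 2 * (49 ^+ 2 * (XX N 0 (a n) * XX N 1 (a n))))).
      by rewrite ler_pM2l// exprn_gt0.
    have -> : tau ^+ 2 * (49 ^+ 2 * (XX N 0 (a n) * XX N 1 (a n))) =
      tau * (49 ^+ 2 * (XX N 0 (a n) * (tau * XX N 1 (a n)))) by ring.
    rewrite ler_pM2l// exprMn ler_pM2l ?exprn_gt0// expr2.
    by apply: ler_pM => //; lra.
  have S := energy_step t0 (traj_herm tau N n h0) (@traj_supp _ tau N c0 n) (traj_step c0 n t0).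
  rewrite -/(a n) -/(a n.+1) in S.
  have : tau ^+ 2 * (UU N (a n) ^+ 2 * XX N 1 (a n)) <= tau * XX N 1 (a n).
    have -> : tau ^+ 2 * (UU N (a n) ^+ 2 * XX N 1 (a n)) = (tau * UU N (a n) ^+ 2) * (tau * XX N 1 (a n)) by ring.
    by rewrite -[leRHS]mul1r ler_wpM2r.
  by move: S; rewrite /E; lra.
have EB n : (0 < n)%N -> E n + \sum_(2 <= m < n.+1) tau * XX N 1 (a m) <= e.
  case: n => // n _; elim: n => [|n IH]; first by rewrite big_geq// addr0.
  have S0 : 0 <= \sum_(2 <= m < n.+2) tau * XX N 1 (a m) by rewrite sumr_ge0.
  rewrite big_nat_recr//=; have := @Estep n.+1 isT; have : E n.+1 <= e by lra.
  by move=> h1 h2; have := h2 h1; lra.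
have S0 n : 0 <= \sum_(2 <= m < n.+1) tau * XX N 1 (a m) by rewrite sumr_ge0.
split; [split => // n|split => [n k kN|n n0|n]].
- by move=> k /(traj_supp tau c0 n) ck; rewrite /a ck cmod0.
- by rewrite /a traj_mean// cmod0.
- exact: step_le t0 (traj_step c0 n t0) _ kN.
- have := EB n n0; have := XE n 1%N; have := S0 n; rewrite /E; lra.
- case: n => [|n]; first by rewrite big_geq// mulr_ge0.
  rewrite big_nat_recl// -/(a 1%N).
  have := EB n.+1 isT; have := E1; rewrite /E.
  have := XX_ge0 N 0 (a 1%N); have := XX_ge0 N 0 (a n.+1); have := XE n.+1 1%N.
  rewrite [\sum_(2 <= m < n.+2) _]big_add1 /=; lra.
Qed.

End Energy.

(** * Supremum estimates *)

Section SupEstimates.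
Context {R : realType}.
Implicit Types (c h : int * int -> R[i]) (k l : int * int) (tau : R) (x : R * R).

Lemma sum_cmod_le L c (V : R) : 0 <= V -> \sum_(k <- box L) cmod (c k) ^+ 2 <= V ^+ 2 ->
  \sum_(k <- box L) cmod (c k) <= (L.*2.+1)%:R * V.
Proof.
move=> V0 H; have := cauchy_schwarz (box L) (fun=> 1) (fun k => cmod (c k)).
under eq_bigr => k _ do rewrite mul1r.
under [X in _ <= X * _]eq_bigr => k _ do rewrite expr1n.
rewrite sum_const_seq mulr1 size_box natrX => h.
have W0 : 0 <= (L.*2.+1)%:R * V by apply: mulr_ge0.
rewrite -ler_sqr ?nnegrE ?sumr_ge0_seq// => [|k _]; last exact: cmod_ge0.
by apply: (le_trans h); rewrite exprMn ler_wpM2l ?sqr_ge0.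
Qed.

(* The gradient bound at the scale [sigma = 1 / N], where the high modes have
   [1 / lam <= 1 / N ^ 2]. *)
Lemma tail_gradient N L j h (m : int * int -> R) (gam : R) : (0 < N)%N -> (L <= 3 * N)%N ->
  herm h -> supp L h -> (forall k, k \in box N -> h k = 0) -> 0 <= gam ->
  (forall x, `|tp L h x| <= gam) -> (forall k, k \notin box N -> `|m k| <= (lam k)^-1) ->
  (forall x, `|tp L (rs (fun k => lam k * m k) h) x| <= 2 * gam) ->
  forall x, `|tp L (dcoef j (rs m h)) x| <= 18 * gam / Num.sqrt N%:R.
Proof.
move=> N0 LN hh sh hN g0 Hh Hm Hlm x.
have n0 : 0 < N%:R :> R by rewrite ltr0n.
have n1 : 1 <= N%:R :> R by rewrite ler1n.
have P := parseval_sup hh sh Hh.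
have l1 := sum_cmod_le g0 P.
(* As [2 * L + 1 <= 7 * N], passing from l2 to l1 costs [7 * N], against the gain [N ^ (-2)] from
   [m]. The constant 18 of the conclusion is [2 * (7 + 2)]. *)
have zb y : `|tp L (rs m h) y| <= 7 * gam / N%:R.
  apply: (le_trans (tp_bound _ _ _)).
  apply: (@le_trans _ _ (\sum_(k <- box L) (N%:R ^+ 2)^-1 * cmod (h k))).
    apply: ler_sum_seq => k _; rewrite /rs cmodM cmodr.
    have [kN|kN] := boolP (k \in box N); first by rewrite hN// cmod0 !mulr0.
    rewrite ler_wpM2r ?cmod_ge0//; apply: (le_trans (Hm k kN)).
    by rewrite lef_pV2 ?posrE ?exprn_gt0// ?lam_outside// (lt_le_trans _ (lam_outside kN))// exprn_gt0.
  rewrite -mulr_sumr ler_pdivlMr// mulrAC.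
  apply: (@le_trans _ _ ((N%:R ^+ 2)^-1 * N%:R * ((L.*2.+1)%:R * gam))).
    by rewrite ler_wpM2l// mulr_ge0 ?invr_ge0 ?exprn_ge0// ltW.
  have -> : (N%:R ^+ 2)^-1 * N%:R * ((L.*2.+1)%:R * gam) = gam * ((L.*2.+1)%:R / N%:R) :> R.
    by field; rewrite lt0r_neq0.
  rewrite [leRHS]mulrC ler_wpM2l// ler_pdivrMr// -natrM ler_nat; lia.
have s0 : 0 < (N%:R)^-1 :> R by rewrite invr_gt0.
have H y : `|tp L (rs m h) y + N%:R^-1 * tp L (rs lam (rs m h)) y| <= 9 * gam / N%:R.
  have -> : tp L (rs lam (rs m h)) = tp L (rs (fun k => lam k * m k) h).
    by apply: eq_tp => k _; rewrite /rs mulrA -rmorphM.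
  apply: (le_trans (ler_normD _ _)); rewrite normrM (gtr0_norm s0).
  have := zb y; have : N%:R^-1 * `|tp L (rs (fun k => lam k * m k) h) y| <= N%:R^-1 * (2 * gam).
    by rewrite ler_pM2l.
  move: (`|tp L _ _|) (`|tp L _ _|) (N%:R^-1 : R) => p q r; lra.
have g9 : 0 <= 9 * gam / N%:R by rewrite divr_ge0 ?mulr_ge0// ltW.
have := tp_gradient_bound j s0 g9 H x.
congr (_ <= _).
rewrite sqrtrV ?ltW//.
have sq := sqr_sqrtr (ltW n0); have q0 : Num.sqrt N%:R != 0 :> R by rewrite lt0r_neq0// sqrtr_gt0.
rewrite -{1}sq; move: (Num.sqrt _) q0 => q q0.
by field.
Qed.

Lemma velocity_le_UU N j c x : `|tp N (uc j c) x| <= UU N (fun k => cmod (c k)).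
Proof.
apply: (le_trans (tp_bound _ _ _)); apply: ler_sum_seq => k _; rewrite /bb.
have [->|k0] := eqVneq k 0.
  have -> : uc j c 0 = 0.
    by rewrite /uc /dcoef /co; case: j; rewrite /= mulr0z mulr0 mul0r ?oppr0.
  by rewrite cmod0 divr_ge0 ?cmod_ge0 ?lrt_ge0.
have L0 := lam_gt0 (R := R) k0; have r0 := lrt_gt0 (R := R) k0.
have E i : cmod (dcoef i (pc c) k) = `|2 * pi * (co i k)%:~R| / lam k * cmod (c k).
  by rewrite /dcoef /pc /rs !cmodM cmodi cmodr normrN normfV (gtr0_norm L0) mulrA.
have le_lrt i : `|2 * pi * (co i k)%:~R| <= lrt k :> R.
  rewrite -sqrtr_sqr ler_wsqrtr// lamE exprMn ler_wpM2l ?sqr_ge0//.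
  by case: i; rewrite /co /= ?lerDr ?lerDl sqr_ge0.
suff F i : cmod (dcoef i (pc c) k) <= cmod (c k) / lrt k.
  by rewrite /uc; case: j; rewrite ?cmodN; exact: F.
rewrite E mulrC ler_wpM2l ?cmod_ge0// -lrt_sqr expr2 invfM mulrA ler_pdivrMr// mulVf ?lt0r_neq0//.
by rewrite ler_pdivrMr// mul1r.
Qed.

Lemma sum_inv_lam N (a : int * int -> R) (e : R) : (forall k, 0 <= a k) -> 0 <= e -> XX N 0 a <= e ^+ 2 ->
  \sum_(k <- box N) (lam k)^-1 * a k <= 7 * e.
Proof.
move=> a0 e0 He.
have S0 : 0 <= \sum_(k <- box N) (lam k)^-1 * a k.
  by apply: sumr_ge0_seq => k _; rewrite mulr_ge0 ?invr_ge0 ?lam_ge0.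
rewrite -ler_sqr ?nnegrE ?mulr_ge0//.
apply: (le_trans (cauchy_schwarz _ _ _)); rewrite exprMn.
apply: ler_pM; try by apply: sumr_ge0_seq => k _; exact: sqr_ge0.
  rewrite (_ : 7 ^+ 2 = 49); last by ring.
  apply: le_trans (lattice_two N); rewrite [leRHS]big_mkcond/=; apply: ler_sum_seq => k _.
  by case: eqP => [->|_] /=; rewrite ?lam00 ?invr0 ?expr0n// exprVn.
by apply: le_trans He; apply: ler_sum_seq => k _; rewrite expr0 mul1r.
Qed.

(** The gradient bound at scale 1 for the stream function [pc c], whose Laplacian is the vorticity;
    the stream function itself is at most [7 * e] because [1 / lam] is square summable. The bound is
    linear in [A] and free of logarithms. *)
Lemma velocity_le_sup N j c (e A : R) : c 0 = 0 -> 0 <= e -> XX N 0 (fun k => cmod (c k)) <= e ^+ 2 ->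
  (forall x, `|tp N c x| <= A) -> forall x, `|tp N (uc j c) x| <= 2 * (7 * e + A).
Proof.
move=> c00 e0 He HA.
have A0 : 0 <= A by exact: le_trans (HA (0, 0)).
have B x : `|tp N (pc c) x + 1 * tp N (rs lam (pc c)) x| <= 7 * e + A.
  have -> : tp N (rs lam (pc c)) x = - tp N c x.
    rewrite -tpN; congr (_ x); apply: eq_tp => k _; rewrite -[(- c) k]/(- c k) /pc /rs.
    have [->|k0] := eqVneq k 0; first by rewrite c00 !mulr0 oppr0.
    by rewrite mulrA -rmorphM mulrN divff ?lt0r_neq0 ?lam_gt0// rmorphN1 mulN1r.
  rewrite mul1r; apply: (le_trans (ler_normB _ _)); apply: lerD => //.
  apply: (le_trans (tp_bound _ _ _)).
  apply: le_trans (sum_inv_lam (fun k => cmod_ge0 (c k)) e0 He).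
  by apply: ler_sum_seq => k _; rewrite /pc /rs cmodM cmodr normrN ger0_norm// invr_ge0 lam_ge0.
have g0 : 0 <= 7 * e + A by rewrite addr_ge0 ?mulr_ge0.
have G i x : `|tp N (dcoef i (pc c)) x| <= 2 * (7 * e + A).
  by have := tp_gradient_bound i ltr01 g0 B x; rewrite sqrtr1 divr1.
move=> x; rewrite /uc; case: j; first exact: G.
have -> : tp N (fun k => - dcoef true (pc c) k) x = - tp N (dcoef true (pc c)) x by rewrite -tpN.
by rewrite normrN.
Qed.

Definition tail N c k : R[i] := if k \in box N then 0 else c k.

Lemma tailE N c k : tail N c k = c k - trunc N c k.
Proof. by rewrite /tail /trunc; case: ifP; rewrite ?subrr ?subr0. Qed.

Lemma herm_tail N c : herm c -> herm (tail N c).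
Proof. by move=> hc k; rewrite /tail mem_boxN; case: ifP => _; rewrite ?conjc0. Qed.

Lemma supp_tail N L c : supp L c -> supp L (tail N c).
Proof. by move=> sc k /sc ck; rewrite /tail ck; case: ifP. Qed.

Lemma tail_box N c k : k \in box N -> tail N c k = 0.
Proof. by rewrite /tail => ->. Qed.

Lemma tp_trunc_widen N L c : (N <= L)%N -> tp L (trunc N c) = tp N c.
Proof.
move=> NL; rewrite -[RHS]tp_trunc; apply/funext => x; apply: sum_box_widen => // k kN.
by rewrite supp_trunc// mul0r.
Qed.

Lemma tp_tail N L c x : (N <= L)%N -> tp L (tail N c) x = tp L c x - tp N c x.
Proof.
move=> NL; rewrite -(tp_trunc_widen c NL) -tpB; congr (_ x); apply: eq_tp => k _.
by rewrite tailE.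
Qed.

Lemma tail_sup N L c (B : R) : (N <= L)%N -> (L <= 3 * N)%N -> (forall x, `|tp L c x| <= B) ->
  forall x, `|tp L (tail N c) x| <= B * (1 + dir_const N).
Proof.
move=> NL LN HB x; rewrite tp_tail// (le_trans (ler_normB _ _))// mulrDr mulr1 lerD//.
by rewrite mulrC; exact: (dirichlet_bound LN NL HB).
Qed.

Section Initial.
Variables (N : nat) (F c0 : int * int -> R[i]) (M : R).
Hypotheses (N0 : (0 < N)%N) (hF : herm F) (sF : supp (3 * N) F) (HM : forall x, `|tp (3 * N) F x| <= M).
Hypotheses (Fc : forall k, k \in box N -> F k = c0 k) (c00 : c0 0 = 0).

Let M0 : 0 <= M. Proof. exact: le_trans (HM (0, 0)). Qed.
Let N3 : (N <= 3 * N)%N. Proof. by rewrite leq_pmull. Qed.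
Let F0 : F 0 = 0. Proof. by rewrite Fc ?box0. Qed.
Let FE : \sum_(k <- box (3 * N)) cmod (F k) ^+ 2 <= M ^+ 2. Proof. exact: parseval_sup. Qed.

Lemma initial_energy : XX N 0 (fun k => cmod (trunc N c0 k)) <= M ^+ 2.
Proof.
apply: le_trans FE; apply: (@le_trans _ _ (\sum_(k <- box N) cmod (F k) ^+ 2)).
  by rewrite le_eqVlt; apply/orP; left; apply/eqP/eq_big_seq => k kN; rewrite expr0 mul1r /trunc kN Fc.
by apply: sum_box_sub => // k; exact: sqr_ge0.
Qed.

Lemma initial_sup x : `|tp N (trunc N c0) x| <= dir_const N * M.
Proof.
rewrite tp_trunc -(eq_tp (c1 := F)) => [|k kN]; last exact: Fc.
exact: (dirichlet_bound (leqnn _) N3 HM).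
Qed.

(** Truncation harms the velocity much less than the vorticity. The velocity of [F] is bounded by
    [velocity_le_sup], with [16 = 2 * (7 + 1)]; that of the removed modes by [tail_gradient] with
    symbol [- 1 / lam], where [1 / sqrt N] beats the logarithms. *)
Lemma initial_velocity j x :
  `|tp N (uc j (trunc N c0)) x| <= 16 * M + 18 * (M * (1 + dir_const N)) / Num.sqrt N%:R.
Proof.
have X3 : XX (3 * N) 0 (fun k => cmod (F k)) <= M ^+ 2.
  by apply: le_trans FE; apply: ler_sum_seq => k _; rewrite expr0 mul1r.
have B1 y : `|tp (3 * N) (uc j F) y| <= 16 * M.
  by have := velocity_le_sup j F0 M0 X3 HM y; lra.
have dc0 : 0 <= dir_const N :> R by rewrite /dir_const sqr_ge0.
have B2 y : `|tp (3 * N) (uc j (tail N F)) y| <= 18 * (M * (1 + dir_const N)) / Num.sqrt N%:R.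
  have T i z : `|tp (3 * N) (dcoef i (pc (tail N F))) z| <= 18 * (M * (1 + dir_const N)) / Num.sqrt N%:R.
    have g0 : 0 <= M * (1 + dir_const N) by rewrite mulr_ge0// addr_ge0.
    have Ht := tail_sup N3 (leqnn _) HM.
    apply: (@tail_gradient N (3 * N) i (tail N F)) => //.
    - exact: herm_tail.
    - exact: supp_tail.
    - exact: tail_box.
    - by move=> k _; rewrite normrN ger0_norm// invr_ge0 lam_ge0.
    move=> w; have -> : tp (3 * N) (rs (fun k => lam k * - (lam k)^-1) (tail N F)) w = - tp (3 * N) (tail N F) w.
      rewrite -tpN; congr (_ w); apply: eq_tp => k _; rewrite /rs -[(- tail N F) k]/(- tail N F k).
      have [->|k0] := eqVneq k 0; first by rewrite tail_box ?box0// mulr0 oppr0.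
      by rewrite mulrN divff ?lt0r_neq0 ?lam_gt0// rmorphN1 mulN1r.
    by rewrite normrN; have := Ht w; lra.
  rewrite /uc; case: j {B1}; first exact: T.
  have -> : tp (3 * N) (fun k => - dcoef true (pc (tail N F)) k) y = - tp (3 * N) (dcoef true (pc (tail N F))) y by rewrite -tpN.
  by rewrite normrN.
have -> : tp N (uc j (trunc N c0)) x = tp (3 * N) (uc j F) x - tp (3 * N) (uc j (tail N F)) x.
  rewrite -tpB -(tp_trunc_widen _ N3); congr (_ x); apply: eq_tp => k _.
  rewrite -[(_ - _) k]/(uc j F k - uc j (tail N F) k).
  rewrite /trunc /uc /dcoef /pc /rs /tail /trunc.
  have [kN|kN] := boolP (k \in box N); last by rewrite subrr.
  by rewrite Fc//; case: j {B1 B2}; rewrite !(mulr0, oppr0, subr0).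
apply: (le_trans (ler_normB _ _)); exact: lerD.
Qed.

(** On [box N] the data agree with [F], whose resolvent stays below [M]. The modes of [F] off
    [box N] are damped by [1 / (tau * N ^ 2)], while their l1 norm is at most [7 * N * M]; with
    [tau * N >= 1] they contribute at most [7 * M]. *)
Lemma initial_resolvent tau x : 0 < tau -> 1 <= tau * N%:R ->
  `|tp N (sv tau (trunc N c0)) x| <= 8 * M.
Proof.
move=> t0 tN.
have n0 : 0 < N%:R :> R by rewrite ltr0n.
have -> : tp N (sv tau (trunc N c0)) x = tp (3 * N) (sv tau F) x - tp (3 * N) (sv tau (tail N F)) x.
  rewrite -tpB -(tp_trunc_widen _ N3); congr (_ x); apply: eq_tp => k _.
  rewrite -[(_ - _) k]/(sv tau F k - sv tau (tail N F) k).
  rewrite /sv /rs /trunc /tail; have [kN|kN] := boolP (k \in box N); last by rewrite subrr.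
  by rewrite Fc// mulr0 subr0.
apply: (le_trans (ler_normB _ _)).
have B1 := sv_bound (ltW t0) HM x.
suff : `|tp (3 * N) (sv tau (tail N F)) x| <= 7 * M by lra.
apply: (le_trans (tp_bound _ _ _)).
apply: (@le_trans _ _ (\sum_(k <- box (3 * N)) (tau * N%:R ^+ 2)^-1 * cmod (F k))).
  apply: ler_sum_seq => k _; rewrite /sv /rs /tail cmodM cmodr.
  case: ifPn => kN.
    by rewrite cmod0 mulr0 mulr_ge0 ?cmod_ge0// invr_ge0 mulr_ge0 ?sqr_ge0 ?ltW.
  rewrite ler_wpM2r ?cmod_ge0// ger0_norm ?invr_ge0 ?(ltW (den_gt0 _ (ltW t0)))//.
  have h := lam_outside (R := R) kN.
  rewrite lef_pV2 ?posrE ?den_gt0 ?mulr_gt0 ?exprn_gt0 ?(ltW t0)//.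
  by have : tau * N%:R ^+ 2 <= tau * lam k by [rewrite ler_pM2l]; lra.
rewrite -mulr_sumr mulrC ler_pdivrMr ?mulr_gt0 ?exprn_gt0//.
apply: (le_trans (sum_cmod_le M0 FE)).
have h1 : ((3 * N).*2.+1)%:R <= 7 * N%:R :> R by rewrite -natrM ler_nat; lia.
apply: (@le_trans _ _ (7 * N%:R * M)); first by rewrite ler_wpM2r.
have -> : 7 * M * (tau * N%:R ^+ 2) = 7 * N%:R * M * (tau * N%:R) by ring.
by rewrite -[leLHS]mulr1 ler_wpM2l// !mulr_ge0// ltW.
Qed.

End Initial.

End SupEstimates.

Section Steps.
Context {R : realType}.
Implicit Types (c h : int * int -> R[i]) (k l : int * int) (tau : R) (x : R * R).

Lemma tp_sub_le N L c x : (N <= L)%N ->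
  `|tp L c x - tp N c x| <= \sum_(k <- box L | k \notin box N) cmod (c k).
Proof.
move=> NL; rewrite -tp_tail//; apply: (le_trans (tp_bound _ _ _)).
rewrite [leRHS]big_mkcond; apply: ler_sum_seq => k _; rewrite /tail.
by case: ifP => _; rewrite ?cmod0.
Qed.

Lemma phase_shift k x (a b : R) : phase k (x.1 - a, x.2 - b) =
  phase k x - 2 * pi * (k.1%:~R * a + k.2%:~R * b).
Proof. by rewrite /phase /=; ring. Qed.

(* Up to second order in [tau], an explicit transport step evaluates [tp N c]
   at the shifted point [x - tau * (u, v)]. *)
Lemma transport_bound N c tau (A u v V x1 x2 : R) : 0 <= tau ->
  (forall x, `|tp N c x| <= A) -> `|u| <= V -> `|v| <= V ->
  `|tp N c (x1, x2) - tau * (u * tp N (dcoef false c) (x1, x2) + v * tp N (dcoef true c) (x1, x2))| <=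
  A + 4 * tau ^+ 2 * V ^+ 2 * \sum_(k <- box N) lam k * cmod (c k).
Proof.
move=> t0 HA Hu Hv; set x := (x1, x2).
pose y : R * R := (x.1 - tau * u, x.2 - tau * v).
(* The phase by which the shift rotates the mode [k]. The comparison leaves [1 - cos] and [sin - id]
   of it, both at most [th ^ 2]. *)
pose th k : R := 2 * pi * (k.1%:~R * (tau * u) + k.2%:~R * (tau * v)).
have e k : complex.Re (c k * expi_mode k x) -
    tau * (u * complex.Re (dcoef false c k * expi_mode k x) + v * complex.Re (dcoef true c k * expi_mode k x)) -
    complex.Re (c k * expi_mode k y) =
    complex.Re (c k * expi_mode k x) * (1 - cos (th k)) - complex.Im (c k * expi_mode k x) * (sin (th k) - th k).
  have E : expi_mode k y = (cos (th k) -i* sin (th k)) * expi_mode k x.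
    rewrite /expi_mode phase_shift cosB sinB -/(th k).
    by apply/eqP; rewrite eq_complex /=; apply/andP; split; apply/eqP; ring.
  rewrite E mulrCA /dcoef -!mulrA; have := erefl (th k); rewrite {2}/th.
  move: (c k * expi_mode k x) (cos (th k)) (sin (th k)) (th k) => [p q] cs sn t tE.
  by rewrite /co /= tE; ring.
have E : tp N c x - tau * (u * tp N (dcoef false c) x + v * tp N (dcoef true c) x) =
    tp N c y + \sum_(k <- box N) (complex.Re (c k * expi_mode k x) * (1 - cos (th k)) -
      complex.Im (c k * expi_mode k x) * (sin (th k) - th k)).
  rewrite -(eq_bigr _ (fun k _ => e k)) !sumrB -mulr_sumr big_split /= -!mulr_sumr -!/(tp N _ _).
  by ring.
rewrite E; apply: (le_trans (ler_normD _ _)); apply: lerD => //.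
apply: (le_trans (ler_norm_sum _ _ _)); rewrite mulr_sumr; apply: ler_sum_seq => k _.
have V0 : 0 <= V by exact: le_trans Hu.
have th2 : th k ^+ 2 <= 2 * tau ^+ 2 * V ^+ 2 * lam k.
  rewrite /th lamE.
  have u2 : u ^+ 2 <= V ^+ 2 by rewrite -(real_normK (num_real u)) ler_sqr ?nnegrE.
  have v2 : v ^+ 2 <= V ^+ 2 by rewrite -(real_normK (num_real v)) ler_sqr ?nnegrE.
  move: (k.1%:~R : R) (k.2%:~R : R) => m n.
  have -> : (2 * pi * (m * (tau * u) + n * (tau * v))) ^+ 2 = (2 * pi) ^+ 2 * (tau ^+ 2 * (m * u + n * v) ^+ 2) by ring.
  have -> : 2 * tau ^+ 2 * V ^+ 2 * ((2 * pi) ^+ 2 * (m ^+ 2 + n ^+ 2)) =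
    (2 * pi) ^+ 2 * (tau ^+ 2 * (2 * V ^+ 2 * (m ^+ 2 + n ^+ 2))) by ring.
  rewrite ler_wpM2l ?sqr_ge0// ler_wpM2l ?sqr_ge0//.
  apply: (@le_trans _ _ ((m ^+ 2 + n ^+ 2) * (u ^+ 2 + v ^+ 2))).
    by rewrite -subr_ge0; set r := _ - _; rewrite (_ : r = (m * v - n * u) ^+ 2) ?sqr_ge0// /r; ring.
  rewrite mulrC ler_wpM2r ?addr_ge0 ?sqr_ge0//.
  by move: u2 v2; lra.
have c0 := one_sub_cos_ge0 (th k); have c2 := one_sub_cos_le2 (th k); have s2 := sin_sub_id (th k).
have hr := normRe_le (c k * expi_mode k x); have hi := normIm_le (c k * expi_mode k x).
rewrite cmodM cmod_expi mulr1 in hr hi.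
apply: (le_trans (ler_normB _ _)); rewrite !normrM (ger0_norm c0).
have a0 := cmod_ge0 (c k).
apply: (@le_trans _ _ (cmod (c k) * (th k ^+ 2 / 2) + cmod (c k) * th k ^+ 2)).
  by apply: lerD; apply: ler_pM.
have : cmod (c k) * th k ^+ 2 <= cmod (c k) * (2 * tau ^+ 2 * V ^+ 2 * lam k) by rewrite ler_wpM2l.
have : 0 <= tau ^+ 2 * V ^+ 2 * (lam k * cmod (c k)).
  by rewrite !mulr_ge0 ?sqr_ge0 ?lam_ge0.
move: (th k ^+ 2) (tau ^+ 2) (V ^+ 2) => p q r; nra.
Qed.

Section Traj.
Variables (tau : R) (N : nat) (c0 : int * int -> R[i]).
Hypotheses (t0 : 0 < tau) (h0 : herm c0).
Let c n := traj tau N c0 n.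

Lemma late_step n (A V : R) : (forall x, `|tp N (c n) x| <= A) ->
  (forall j x, `|tp N (uc j (c n)) x| <= V) -> forall x, `|tp N (c n.+1) x| <=
  A + 4 * tau ^+ 2 * V ^+ 2 * \sum_(k <- box N) lam k * cmod (c n k) +
  tau * \sum_(k <- box (N + N) | k \notin box N) lrt k * qq N (fun l => cmod (c n l)) k.
Proof.
move=> HA HV x; rewrite /c tp_trajS; move: x; apply: sv_bound; first exact: ltW.
move=> [x1 x2]; rewrite tpB tpZ -/(c n); set x := (x1, x2).
have hc : herm (c n) by exact: traj_herm.
have sc : supp N (c n) by exact: traj_supp.
have -> : tp N (c n) x - tau * tp N (adv N (c n)) x =
    (tp N (c n) x - tau * tp (N + N) (adv N (c n)) x) +
    tau * (tp (N + N) (adv N (c n)) x - tp N (adv N (c n)) x) by ring.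
apply: (le_trans (ler_normD _ _)); apply: lerD.
  rewrite -tp_advection//; apply: transport_bound => //; exact: ltW.
rewrite normrM gtr0_norm// ler_pM2l//.
apply: (le_trans (tp_sub_le _ _ (leq_addr _ _))).
by apply: ler_sum => k _; exact: adv_le.
Qed.

(* [sum_(m < n) tau * S ^ (n - m) g_m] with [S] the resolvent. *)
Fixpoint duhamel (g : nat -> int * int -> R[i]) n : int * int -> R[i] :=
  if n is m.+1 then sv tau (duhamel g m + rs (fun=> tau) (g m)) else 0.

Let g j n := conv N (uc j (c n)) (c n).

Lemma flux_sup n (V B : R) : (forall j x, `|tp N (uc j (c n)) x| <= V) ->
  (forall x, `|tp N (c n) x| <= B) -> forall j x, `|tp (N + N) (g j n) x| <= V * B.
Proof.
move=> HV HB j x; rewrite -tp_flux; [|exact: traj_herm|exact: traj_supp].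
by rewrite normrM; apply: ler_pM.
Qed.

Lemma traj_duhamel n k : k \in box N -> c n k = iter n (sv tau) (trunc N c0) k -
  (dcoef false (duhamel (g false) n) k + dcoef true (duhamel (g true) n) k).
Proof.
move=> kN; elim: n => [|n IH].
  by rewrite /= /dcoef -[(0 : int * int -> R[i]) k]/(0 : R[i]) !mulr0 addr0 subr0.
rewrite /c /= -/(c n) /trunc kN /sv /rs /dcoef -!/(sv tau _).
rewrite -[(_ - _) k]/(c n k - tau%:C * adv N (c n) k) IH adv_flux -/(g false n) -/(g true n) /dcoef.
rewrite -[(duhamel (g false) n + _) k]/(duhamel (g false) n k + tau%:C * g false n k).
rewrite -[(duhamel (g true) n + _) k]/(duhamel (g true) n k + tau%:C * g true n k).
by ring.
Qed.

(** Only modes in [box N] matter here, so the fluxes may be truncated before the barrier is applied,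
    at the cost of [dir_const N]. Each of the two flux components contributes
    [2 * gam * sqrt sigma]. *)
Lemma early_bound n (A V B sigma : R) :
  (forall x, `|tp N (iter n (sv tau) (trunc N c0)) x| <= A) ->
  (forall m, (m < n)%N -> forall j x, `|tp N (uc j (c m)) x| <= V) ->
  (forall m, (m < n)%N -> forall x, `|tp N (c m) x| <= B) ->
  (0 < N)%N -> 0 <= V -> 0 <= B -> 0 < sigma -> n%:R * tau <= sigma ->
  forall x, `|tp N (c n) x| <= A + 4 * (dir_const N * (V * B)) * Num.sqrt sigma.
Proof.
move=> HA HV HB N0 V0 B0 s0 ns x.
rewrite (eq_tp (traj_duhamel n)) -/(iter n (sv tau) (trunc N c0) - (dcoef false (duhamel (g false) n) + dcoef true (duhamel (g true) n))).
have dc0 : 0 <= dir_const N :> R by rewrite /dir_const sqr_ge0.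
have H j : `|tp N (dcoef j (duhamel (g j) n)) x| <= 2 * (dir_const N * (V * B)) * Num.sqrt sigma.
  apply: (@sv_barrier _ (duhamel (g j)) (g j) N j tau sigma) => //.
  - move=> m y mn; apply: (@dirichlet_bound _ N (N + N)).
    + by rewrite addnn -mul2n leq_mul2r orbT.
    + exact: leq_addr.
    by move=> z; exact: (flux_sup (HV m mn) (HB m mn)).
  - by apply: mulr_ge0 => //; apply: mulr_ge0.
  - exact: ltW.
rewrite tpB tpD; apply: (le_trans (ler_normB _ _)).
have := HA x; have := ler_normD (tp N (dcoef false (duhamel (g false) n)) x) (tp N (dcoef true (duhamel (g true) n)) x).
have := H false; have := H true.
rewrite -/(tp N _ x); move: (dir_const N * (V * B)) (Num.sqrt sigma) => K q.
move: (tp N (iter n _ _) x) (tp N (dcoef false _) x) (tp N (dcoef true _) x) => p r s h1 h2 h3 h4; lra.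
Qed.

(** Writing the truncation as the subtraction of a tail keeps the fluxes unprojected, so that the
    barrier can be applied to them without [dirichlet_bound]; the tail becomes a Duhamel sum of its
    own, and the identity holds at every mode. *)
Lemma traj_duhamel_tail n k : c n k = iter n (sv tau) (trunc N c0) k -
  (dcoef false (duhamel (g false) n) k + dcoef true (duhamel (g true) n) k) +
  duhamel (fun m => tail N (adv N (c m))) n k.
Proof.
elim: n => [|n IH].
  by rewrite /= /dcoef -[(0 : int * int -> R[i]) k]/(0 : R[i]) !mulr0 !addr0 subr0.
have E : c n.+1 k = ((1 + tau * lam k)^-1)%:C * (c n k - tau%:C * trunc N (adv N (c n)) k).
  rewrite /c /= -/(c n) /trunc /sv /rs; case: ifPn => kN //.
  by rewrite mulr0 subr0 [c n k](traj_supp tau c0 n kN) mulr0.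
rewrite E IH /= /sv /rs /dcoef -!/(sv tau _).
rewrite -[(duhamel (g false) n + _) k]/(duhamel (g false) n k + tau%:C * g false n k).
rewrite -[(duhamel (g true) n + _) k]/(duhamel (g true) n k + tau%:C * g true n k).
set T := duhamel (fun m => tail N (adv N (c m))) n; rewrite -[(T + _) k]/(T k + tau%:C * tail N (adv N (c n)) k).
by rewrite tailE adv_flux -/(g false n) -/(g true n) /dcoef; ring.
Qed.

(** In one step the discarded modes enter through the symbol [m = tau / (1 + tau * lam)]: it is at
    most [1 / lam], and [lam * m = 1 - (1 + tau * lam)^-1] at most doubles suprema, which is what
    [tail_gradient] asks for. The steps are added without using any decay, hence the factor [n],
    affordable over the short early phase. *)
Lemma duhamel_tail_bound n (V B : R) :
  (forall m, (m < n)%N -> forall j x, `|tp N (uc j (c m)) x| <= V) ->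
  (forall m, (m < n)%N -> forall x, `|tp N (c m) x| <= B) ->
  (0 < N)%N -> 0 <= V -> 0 <= B ->
  forall x, `|tp (N + N) (duhamel (fun m => tail N (adv N (c m))) n) x| <=
    n%:R * (36 * (V * B * (1 + dir_const N)) / Num.sqrt N%:R).
Proof.
move=> HV HB N0 V0 B0; elim: n HV HB => [|n IH] HV HB x.
  rewrite mul0r /= (_ : tp _ _ _ = 0) ?normr0// /tp big1// => k _.
  by rewrite -[(0 : int * int -> R[i]) k]/(0 : R[i]) mul0r.
rewrite /=; set T := duhamel (fun m => tail N (adv N (c m))) n in IH *.
pose m k : R := tau * (1 + tau * lam k)^-1.
pose h j := tail N (g j n).
have -> : tp (N + N) (sv tau (T + rs (fun=> tau) (tail N (adv N (c n))))) x =
    tp (N + N) (sv tau T) x + (tp (N + N) (dcoef false (rs m (h false))) x + tp (N + N) (dcoef true (rs m (h true))) x).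
  rewrite -!tpD; congr (_ x); apply: eq_tp => k _; rewrite /sv /rs.
  rewrite -[(T + _) k]/(T k + tau%:C * tail N (adv N (c n)) k).
  rewrite -[RHS]/(((1 + tau * lam k)^-1)%:C * T k + (dcoef false (rs m (h false)) k + dcoef true (rs m (h true)) k)).
  rewrite /dcoef /rs /m rmorphM /= /h /tail adv_flux -/(g false n) -/(g true n) /dcoef.
  by case: ifP => _; ring.
have IHn y : `|tp (N + N) (sv tau T) y| <= n%:R * (36 * (V * B * (1 + dir_const N)) / Num.sqrt N%:R).
  apply: sv_bound; first exact: ltW.
  by apply: IH => p pn; [apply: HV|apply: HB]; exact: ltn_trans (ltnSn n).
have hn j : herm (g j n).
  by apply: herm_conv; [apply: herm_uc|]; exact: traj_herm.
have sn j : supp (N + N) (g j n) by apply: supp_conv; exact: traj_supp.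
have dc0 : 0 <= dir_const N :> R by rewrite /dir_const sqr_ge0.
have g0 : 0 <= V * B * (1 + dir_const N) by rewrite mulr_ge0 ?addr_ge0//; exact: mulr_ge0.
have N3 : (N + N <= 3 * N)%N by rewrite addnn -mul2n leq_mul2r orbT.
have Hh j := tail_sup (leq_addr N N) N3 (flux_sup (HV n (ltnSn n)) (HB n (ltnSn n)) j).
have d1 k := den_gt0 k (ltW t0).
have G j y : `|tp (N + N) (dcoef j (rs m (h j))) y| <= 18 * (V * B * (1 + dir_const N)) / Num.sqrt N%:R.
  apply: (@tail_gradient _ N (N + N) j (h j)) => //.
  - exact: herm_tail.
  - exact: supp_tail.
  - by move=> k kN; exact: tail_box.
  - exact: Hh.
  - move=> k kN; have l0 : 0 < lam k :> R.
      by apply: lt_le_trans (lam_outside kN); rewrite exprn_gt0// ltr0n.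
    have m0 : 0 <= m k by rewrite /m mulr_ge0 ?invr_ge0 ?ltW.
    rewrite ger0_norm// /m ler_pdivrMr// mulrC ler_pdivlMr//; lra.
  move=> z; have -> : tp (N + N) (rs (fun k => lam k * m k) (h j)) z = tp (N + N) (h j) z - tp (N + N) (sv tau (h j)) z.
    rewrite -tpB; congr (_ z); apply: eq_tp => k _; rewrite -[RHS]/(h j k - sv tau (h j) k) /sv /rs /m.
    have -> : lam k * (tau * (1 + tau * lam k)^-1) = 1 - (1 + tau * lam k)^-1.
      by field; rewrite lt0r_neq0.
    by rewrite rmorphB /= mulrBl mul1r.
  apply: (le_trans (ler_normB _ _)).
  have h1 := Hh j z; have h2 := sv_bound (ltW t0) (Hh j) z.
  rewrite mulr2n mulrDl mul1r; exact: lerD.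
apply: (le_trans (ler_normD _ _)).
have := IHn x; have := ler_normD (tp (N + N) (dcoef false (rs m (h false))) x) (tp (N + N) (dcoef true (rs m (h true))) x).
have := G false x; have := G true x; rewrite -[n.+1%:R]natr1.
have -> : 36 * (V * B * (1 + dir_const N)) / Num.sqrt N%:R = 2 * (18 * (V * B * (1 + dir_const N)) / Num.sqrt N%:R) by ring.
move: (18 * (V * B * (1 + dir_const N)) / Num.sqrt N%:R) => K.
move: (tp _ (sv _ _) x) (tp _ (dcoef false _) x) (tp _ (dcoef true _) x) => p r s h1 h2 h3 h4; lra.
Qed.

Lemma early_bound_tail n (A V B sigma : R) :
  (forall x, `|tp N (iter n (sv tau) (trunc N c0)) x| <= A) ->
  (forall m, (m < n)%N -> forall j x, `|tp N (uc j (c m)) x| <= V) ->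
  (forall m, (m < n)%N -> forall x, `|tp N (c m) x| <= B) ->
  (0 < N)%N -> 0 <= V -> 0 <= B -> 0 < sigma -> n%:R * tau <= sigma ->
  forall x, `|tp N (c n) x| <= A + 4 * (V * B) * Num.sqrt sigma +
    n%:R * (36 * (V * B * (1 + dir_const N)) / Num.sqrt N%:R).
Proof.
move=> HA HV HB N0 V0 B0 s0 ns x.
have si m : supp N (iter m (sv tau) (trunc N c0)).
  by elim: m => [|m IH]; [exact: supp_trunc|exact: supp_rs].
have widen (d : int * int -> R[i]) : supp N d -> tp (N + N) d = tp N d.
  move=> sd; apply/funext => y; apply: sum_box_widen; last exact: leq_addr.
  by move=> k /sd ->; rewrite mul0r.
rewrite -(widen (c n)) => [|k kN]; last exact: traj_supp.
rewrite (eq_tp (fun k _ => traj_duhamel_tail n k)).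
have H j : `|tp (N + N) (dcoef j (duhamel (g j) n)) x| <= 2 * (V * B) * Num.sqrt sigma.
  apply: (@sv_barrier _ (duhamel (g j)) (g j) (N + N) j tau sigma) => //.
  - by move=> m y mn; exact: (flux_sup (HV m mn) (HB m mn)).
  - exact: mulr_ge0.
  - exact: ltW.
have E := duhamel_tail_bound HV HB N0 V0 B0 x.
rewrite -(widen _ (si n)) in HA.
move: E; set T := duhamel (fun m => tail N (adv N (c m))) n; set K := n%:R * _ => E.
set S := iter n _ _ in HA *.
rewrite -/(S - (dcoef false (duhamel (g false) n) + dcoef true (duhamel (g true) n)) + T).
rewrite tpD tpB tpD.
apply: (le_trans (ler_normD _ _)); apply: lerD => //.
apply: (le_trans (ler_normB _ _)).
have := HA x; have := ler_normD (tp (N + N) (dcoef false (duhamel (g false) n)) x) (tp (N + N) (dcoef true (duhamel (g true) n)) x).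
have := H false; have := H true.
move: (V * B) (Num.sqrt sigma) => L q.
move: (tp _ S x) (tp _ (dcoef false _) x) (tp _ (dcoef true _) x) => p r s h1 h2 h3 h4; lra.
Qed.

Lemma iter_sv_bound m n (A : R) : (m <= n)%N ->
  (forall x, `|tp N (iter m (sv tau) (trunc N c0)) x| <= A) ->
  forall x, `|tp N (iter n (sv tau) (trunc N c0)) x| <= A.
Proof.
move=> mn HA; rewrite -(subnK mn); elim: (n - m)%N => [|p IH] //.
by apply: sv_bound; first exact: ltW.
Qed.

End Traj.
End Steps.

(** * Early and late phases *)

Section Phases.
Context {R : realType}.
Variables (tau : R) (N : nat) (c0 : int * int -> R[i]).
Hypotheses (t0 : 0 < tau) (h0 : herm c0) (N0 : (0 < N)%N).
Let c n := traj tau N c0 n.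
Let a n k := cmod (c n k).
Definition supb n (B : R) := forall x, `|tp N (traj tau N c0 n) x| <= B.
Definition velb n (V : R) := forall j x, `|tp N (uc j (traj tau N c0 n)) x| <= V.
Variable C : R.
Hypothesis C0 : 0 < C.
Hypothesis late : forall n, (4 <= n)%N -> let t := n%:R * tau in
    [/\ \sum_(k <- box N) lam k * a n k <= C / (t * Num.sqrt t),
        \sum_(k <- box (N + N) | k \notin box N) lrt k * qq N (a n) k <= C * UU N (a n) / (N%:R ^+ 2 * t ^+ 2) &
        t * UU N (a n) ^+ 4 <= C].

(* The increments of the late phase are dominated by telescoping differences
   of [1 / sqrt t] and [1 / t]. *)
Lemma late_sup (n1 : nat) (t1 V W W' Um : R) : (4 <= n1)%N -> 0 < t1 -> t1 <= n1.-1%:R * tau ->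
  0 <= V -> (forall n, (n1 <= n)%N -> UU N (a n) <= Um) -> supb n1 W ->
  (forall n, (n1 <= n)%N -> supb n W' -> velb n V) ->
  W + 8 * tau * V ^+ 2 * C / Num.sqrt t1 + C * Um / (N%:R ^+ 2 * t1) <= W' ->
  forall n, (n1 <= n)%N -> supb n W'.
Proof.
move=> n14 t10 t1n V0 HU HW Hvel HW'.
have n0 : 0 < N%:R :> R by rewrite ltr0n.
have Um0 : 0 <= Um by apply: le_trans (HU _ (leqnn _)); apply: UU_ge0 => k; exact: cmod_ge0.
pose p : R := 4 * tau * V ^+ 2 * C; pose q : R := C * Um / N%:R ^+ 2.
have p0 : 0 <= p by rewrite /p; apply: mulr_ge0 (ltW C0); apply: mulr_ge0 (sqr_ge0 _); apply: mulr_ge0 => //; exact: ltW.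
have q0 : 0 <= q by rewrite /q; apply: divr_ge0; [apply: mulr_ge0 => //; exact: ltW|exact: sqr_ge0].
(* The bound at step [n] is [Phi] at time [(n - 1) * tau]: the estimates at time [n * tau] are
   compared with decreasing functions integrated from [(n - 1) * tau] to [n * tau]. *)
pose Phi (t : R) := W + p * (2 * (Num.sqrt t1)^-1 - 2 * (Num.sqrt t)^-1) + q * (t1^-1 - t^-1).
have PhiW t : 0 < t -> Phi t <= W'.
  move=> tt; apply: le_trans HW'; rewrite /Phi.
  have h1 : 0 <= p * (2 * (Num.sqrt t)^-1) by apply: mulr_ge0 => //; apply: mulr_ge0 => //; rewrite invr_ge0 sqrtr_ge0.
  have h2 : 0 <= q * t^-1 by apply: mulr_ge0 => //; rewrite invr_ge0 ltW.
  have -> : 8 * tau * V ^+ 2 * C / Num.sqrt t1 = p * (2 * (Num.sqrt t1)^-1) by rewrite /p; ring.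
  have -> : C * Um / (N%:R ^+ 2 * t1) = q * t1^-1 by rewrite /q invfM; ring.
  by lra.
suff H n : (n1 <= n)%N -> supb n (Phi (n.-1%:R * tau)).
  move=> n n1n x; apply: (le_trans (H n n1n x)); apply: PhiW.
  by rewrite mulr_gt0// ltr0n; move: n14 n1n; clear; lia.
elim: n => [|n IH] n1n; first by move: n14 n1n; clear; lia.
case: (ltnP n n1) => nn1.
  have -> : n.+1 = n1 by move: n1n nn1; clear; lia.
  move=> x; apply: (le_trans (HW x)); rewrite /Phi -addrA lerDl.
  have s1 : 0 < Num.sqrt t1 by rewrite sqrtr_gt0.
  apply: addr_ge0; apply: mulr_ge0 => //.
    by rewrite subr_ge0 ler_pM2l// lef_pV2 ?posrE ?ler_wsqrtr ?sqrtr_gt0 ?(lt_le_trans t10).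
  by rewrite subr_ge0 lef_pV2 ?posrE ?(lt_le_trans t10).
have tn : 0 < n.-1%:R * tau by rewrite mulr_gt0// ltr0n; move: n14 nn1; clear; lia.
have {}IH := IH nn1.
have Hv : velb n V by apply: Hvel => // x; exact: le_trans (IH x) (PhiW _ tn).
have n4 : (4 <= n)%N by exact: leq_trans nn1.
have [L1 L2 _] := late n4.
move=> x; apply: (le_trans (late_step t0 h0 IH Hv x)).
rewrite -[n.+1.-1]/n; have := sqrt_step tn (_ : n.-1%:R * tau <= n%:R * tau).
have nE : n%:R * tau = n.-1%:R * tau + tau.
  by rewrite -{1}(prednK (leq_trans (ltn0Sn 3) n4)) -natr1 mulrDl mul1r.
rewrite nE lerDl => /(_ (ltW t0)); rewrite [_ + tau - _]addrC addKr.
rewrite nE in L1 L2; move: tn L1 L2; set b := _ + tau; set a0 := n.-1%:R * tau.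
move=> a0p L1 L2 sq.
have b0 : 0 < b by rewrite addr_gt0.
have A1 : 4 * tau ^+ 2 * V ^+ 2 * \sum_(k <- box N) lam k * cmod (traj tau N c0 n k) <=
    p * (2 * (Num.sqrt a0)^-1 - 2 * (Num.sqrt b)^-1).
  apply: (@le_trans _ _ (p * (tau / (b * Num.sqrt b)))); last by rewrite ler_wpM2l.
  have -> : p * (tau / (b * Num.sqrt b)) = 4 * tau ^+ 2 * V ^+ 2 * (C / (b * Num.sqrt b)) by rewrite /p; ring.
  rewrite ler_wpM2l//; apply: mulr_ge0 (sqr_ge0 _); apply: mulr_ge0 (sqr_ge0 _) => //.
have A2 : tau * \sum_(k <- box (N + N) | k \notin box N) lrt k * qq N (a n) k <= q * (a0^-1 - b^-1).
  apply: (@le_trans _ _ (q * (tau / b ^+ 2))).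
    have -> : q * (tau / b ^+ 2) = tau * (C * Um / (N%:R ^+ 2 * b ^+ 2)).
      by rewrite /q; field; rewrite !lt0r_neq0.
    rewrite ler_pM2l//; apply: (le_trans L2); rewrite ler_pM2r ?invr_gt0 ?mulr_gt0 ?exprn_gt0//.
    by rewrite ler_pM2l//; exact: HU.
  rewrite ler_wpM2l// ler_pdivrMr ?exprn_gt0//.
  have -> : (a0^-1 - b^-1) * b ^+ 2 = tau * (b / a0).
    have -> : tau = b - a0 by rewrite /b addrC addKr.
    by field; rewrite !lt0r_neq0.
  by rewrite -[leLHS]mulr1 ler_pM2l// ler_pdivlMr// mul1r lerDl ltW.
move: A1 A2; have := PhiW _ a0p; rewrite /Phi => _.
set S1 := \sum_(_ <- _) _; set S2 := \sum_(_ <- _ | _) _ => A1 A2.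
move: (4 * tau ^+ 2 * V ^+ 2 * S1) (tau * S2) A1 A2 => y z.
move: (Num.sqrt a0)^-1 (Num.sqrt b)^-1 (Num.sqrt t1)^-1 (a0^-1) (b^-1) (t1^-1) => i1 i2 i3 i4 i5 i6.
by move=> A1 A2; lra.
Qed.

(* With [s = tau ^ (1/40)] and [r = N ^ (-1/40)] every power of [tau] and [N] of
   the proof is a monomial in [s] and [r]; [r >= s ^ 2] means [N <= tau ^ -2]. *)
Variables (s r Cd : R).
Hypotheses (s0 : 0 < s) (s1 : s <= 1) (r0 : 0 < r) (r1 : r <= 1).
Hypotheses (tauE : tau = s ^+ 40) (NE : N%:R * r ^+ 40 = 1).
Let D : R := dir_const N.
Hypotheses (D1 : 1 <= D) (Dr : D ^+ 3 * r <= Cd).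
Let C1 := 1 + C.
Let t1 := r ^+ 48 + s ^+ 36.
(** Adding 4 gives [4 <= n1], as the smoothed bounds require, and still leaves [n1.-1] steps
    reaching beyond [t1] ([start_le]). *)
Let n1 := (Num.truncn (t1 / tau)).+4.

Let rX (m n : nat) : (n <= m)%N -> r ^+ m <= r ^+ n.
Proof. by move=> nm; apply: ler_wiXn2l => //; exact: ltW. Qed.
Let sX (m n : nat) : (n <= m)%N -> s ^+ m <= s ^+ n.
Proof. by move=> nm; apply: ler_wiXn2l => //; exact: ltW. Qed.
Let rX0 m : 0 < r ^+ m. Proof. exact: exprn_gt0. Qed.
Let sX0 m : 0 < s ^+ m. Proof. exact: exprn_gt0. Qed.
Let t10 : 0 < t1. Proof. exact: addr_gt0. Qed.
Let n0 : 0 < N%:R :> R. Proof. by rewrite ltr0n. Qed.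

Lemma start_le : t1 <= n1.-1%:R * tau.
Proof.
rewrite -ler_pdivrMr//; apply: ltW; apply: lt_le_trans (truncnS_gt _) _.
by rewrite ler_nat /n1 /= ltnS ltnW. 
Qed.

Lemma start_ge : n1%:R * tau <= 5 * t1.
Proof.
have h : (Num.truncn (t1 / tau))%:R <= t1 / tau by rewrite truncn_le// ltW// divr_gt0.
have -> : n1%:R = (Num.truncn (t1 / tau))%:R + 4 :> R by rewrite -natrD /n1 addn4.
rewrite ler_pdivlMr// in h; rewrite mulrDl.
have : tau <= t1 by rewrite tauE /t1; have := sX (isT : (36 <= 40)%N); have := rX0 48; lra.
by move: h; lra.
Qed.

Lemma sqrt_start : Num.sqrt (5 * t1) <= 3 * (r ^+ 24 + s ^+ 18).
Proof.
have p0 : 0 <= 3 * (r ^+ 24 + s ^+ 18) by rewrite mulr_ge0// addr_ge0// ltW.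
rewrite -(ger0_norm p0) -sqrtr_sqr ler_wsqrtr// /t1.
have -> : r ^+ 48 = (r ^+ 24) ^+ 2 by rewrite -exprM.
have -> : s ^+ 36 = (s ^+ 18) ^+ 2 by rewrite -exprM.
move: (r ^+ 24) (s ^+ 18) (rX0 24) (sX0 18) => x y x0 y0.
by have := mulr_gt0 x0 y0; have := sqr_ge0 x; have := sqr_ge0 y; nra.
Qed.

Let C1_ge : C <= C1 ^+ 4.
Proof.
rewrite /C1; have h : 1 <= 1 + C by rewrite lerDl ltW.
apply: (@le_trans _ _ (1 + C)); first by rewrite lerDr.
by rewrite -[leLHS]expr1 ler_weXn2l.
Qed.

(** Extracts the velocity from its fourth power; [C1 = 1 + C] satisfies [C <= C1 ^ 4] and spares a
    fourth root of [C]. *)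
Lemma UU_scaled n (y z : R) : 0 < y -> y ^+ 4 <= z -> z * UU N (a n) ^+ 4 <= C -> UU N (a n) <= C1 / y.
Proof.
move=> y0 yz H; have U0 : 0 <= UU N (a n) by apply: UU_ge0 => k; exact: cmod_ge0.
have C10 : 0 <= C1 by rewrite /C1 addr_ge0// ltW.
rewrite ler_pdivlMr// -(ler_pXn2r (n := 4)) ?nnegrE ?mulr_ge0 ?(ltW y0)//.
apply: le_trans C1_ge; apply: le_trans H; rewrite exprMn mulrC ler_wpM2r// exprn_ge0//.
Qed.

(** [s ^+ 22] bounds [tau / sqrt t1], since [t1 >= s ^+ 36]. [r ^+ 20] comes from [1 / (N ^ 2 * t1)]
    times the velocity bound [C1 / r ^+ 12], since [t1 >= r ^+ 48]. The level [B] closes both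
    inductions: a strong one up to [n1], then that of [late_sup], where the velocity may be bounded
    using [B]. *)
Lemma two_phase (B V W : R) : 0 <= V ->
  (forall n, (n <= n1)%N -> (forall m, (m < n)%N -> supb m B) -> supb n B) ->
  ((forall m, (m < n1)%N -> supb m B) -> supb n1 W) ->
  (forall n, (n1 <= n)%N -> supb n B -> velb n V) ->
  W + 8 * s ^+ 22 * V ^+ 2 * C + C * C1 * r ^+ 20 <= B -> forall n, supb n B.
Proof.
move=> V0 He HW Hv HB.
have early n : (n <= n1)%N -> supb n B.
  elim/ltn_ind: n => n IH nn1; apply: He => // m mn; apply: IH => //.
  exact: leq_trans (ltnW mn) nn1.
have W1 : supb n1 W by apply: HW => m mn; apply: early; exact: ltnW.
move=> n; case: (leqP n n1) => [|/ltnW]; first exact: early.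
have tn m : (n1 <= m)%N -> t1 <= m%:R * tau.
  move=> n1m; apply: (le_trans start_le); rewrite ler_pM2r// ler_nat.
  by apply: leq_trans n1m; exact: leq_pred.
apply: (@late_sup n1 t1 V W B (C1 / r ^+ 12)) => //.
- exact: start_le.
- move=> m n1m; have [_ _ h] := late (leq_trans (isT : (4 <= n1)%N) n1m).
  apply: (UU_scaled (rX0 12) _ h); apply: le_trans (tn m n1m).
  by rewrite -exprM /t1 lerDl ltW.
apply: le_trans HB; apply: lerD; first (apply: lerD => //).
  rewrite tauE; have q0 : s ^+ 18 <= Num.sqrt t1.
    rewrite -(ger0_norm (ltW (sX0 18))) -sqrtr_sqr ler_wsqrtr// -exprM /t1 lerDr ltW//.
  have q1 : 0 < Num.sqrt t1 by rewrite sqrtr_gt0.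
  rewrite ler_pdivrMr//.
  have -> : 8 * s ^+ 40 * V ^+ 2 * C = 8 * s ^+ 22 * V ^+ 2 * C * s ^+ 18 by ring.
  rewrite ler_wpM2l//; apply: mulr_ge0 (ltW C0); apply: mulr_ge0 (sqr_ge0 _); apply: mulr_ge0 => //.
  exact: ltW.
rewrite ler_pdivrMr ?mulr_gt0 ?exprn_gt0//.
have C10 : 0 < C1 by rewrite /C1 addr_gt0.
have h : N%:R ^+ 2 * r ^+ 48 <= N%:R ^+ 2 * t1 by rewrite ler_pM2l ?exprn_gt0// /t1 lerDl ltW.
apply: (@le_trans _ _ (C * C1 * r ^+ 20 * (N%:R ^+ 2 * r ^+ 48))); last first.
  by rewrite ler_pM2l// !mulr_gt0.
have -> : C * C1 * r ^+ 20 * (N%:R ^+ 2 * r ^+ 48) = C * C1 * (N%:R * r ^+ 40) ^+ 2 / r ^+ 12.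
  by field; rewrite lt0r_neq0.
by rewrite NE expr1n mulr1 mulrA.
Qed.

Variables (eb : R).
Hypotheses (eb0 : 0 <= eb) (Hvel : forall n B, supb n B -> velb n (2 * (7 * eb + B))).

Let D0 : 0 <= D. Proof. exact: le_trans D1. Qed.
Let Cd0 : 0 <= Cd.
Proof. by apply: le_trans Dr; apply: mulr_ge0; [exact: exprn_ge0|exact: ltW]. Qed.
Let C10 : 0 < C1. Proof. by rewrite /C1 addr_gt0. Qed.

Lemma early_time n : (n <= n1)%N -> n%:R * tau <= 5 * t1.
Proof. by move=> nn1; apply: le_trans start_ge; rewrite ler_pM2r// ler_nat. Qed.

Lemma sv0_bound n (A : R) : supb 0 A -> forall x, `|tp N (iter n (sv tau) (trunc N c0)) x| <= A.
Proof. by move=> HA; apply: (iter_sv_bound t0 (leq0n n)); exact: HA. Qed.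

Let dist (x y : nat) (X : R) : 0 <= X -> (y <= x)%N -> X * s ^+ x <= X * s ^+ y.
Proof. by move=> X0 yx; rewrite ler_wpM2l// sX. Qed.

(** The bootstrap for the cases where the velocity is read off from the supremum through [Hvel]. At
    level [A + d] the number [V] bounds vorticity and velocity alike; [de] is the early error and
    [d] the total one. *)
Lemma case_bounded (A V de d : R) : 0 <= V -> 0 <= de -> A + d <= V -> 2 * (7 * eb + (A + d)) <= V ->
  (forall n, (n <= n1)%N -> (forall m, (m < n)%N -> supb m V) -> (forall m, (m < n)%N -> velb m V) ->
    supb n (A + de)) ->
  de + 8 * s ^+ 22 * V ^+ 2 * C + C * C1 * r ^+ 20 <= d -> forall n, supb n (A + d).
Proof.
move=> V0 de0 AdV vV He Hd.
have h1 : 0 <= 8 * s ^+ 22 * V ^+ 2 * C.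
  by apply: mulr_ge0 (ltW C0); apply: mulr_ge0 (sqr_ge0 _); apply: mulr_ge0 => //; exact: ltW.
have h2 : 0 <= C * C1 * r ^+ 20 by apply: mulr_ge0 (ltW (rX0 _)); apply: mulr_ge0; exact: ltW.
have ded : de <= d by apply: le_trans Hd; rewrite -addrA lerDl addr_ge0.
have vel m : supb m (A + d) -> velb m V.
  by move=> hm j x; exact: le_trans (Hvel hm j x) vV.
have early n : (n <= n1)%N -> (forall m, (m < n)%N -> supb m (A + d)) -> supb n (A + de).
  move=> nn1 H; apply: He => // m mn; last exact/vel/H.
  by move=> x; exact: le_trans (H m mn x) AdV.
apply: (@two_phase (A + d) V (A + de)) => //.
- by move=> n nn1 H x; apply: (le_trans (early n nn1 H x)); rewrite lerD2l.
- exact: early.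
- by move=> n _; exact: vel.
- by move: Hd; rewrite -!addrA lerD2l.
Qed.

(** The early error carries three powers of [D]: one from truncating the flux, two from a velocity
    and a vorticity of size [Kv * D]. They are absorbed by weakening [r ^+ 24] to [r ^+ 20] and
    [s ^+ 18] to [s ^+ 16], the latter because [D ^+ 3 * s ^+ 2 <= D ^+ 3 * r <= Cd]. *)
Lemma case_moderate (A Kv : R) : let al := 12 * Kv ^+ 2 * Cd + 8 * Kv ^+ 2 * C * Cd + C * C1 in
  0 <= Kv -> A + 1 <= Kv * D -> 2 * (7 * eb + (A + 1)) <= Kv * D -> s ^+ 2 <= r -> supb 0 A ->
  al * (r ^+ 20 + s ^+ 16) <= 1 -> forall n, supb n (A + al * (r ^+ 20 + s ^+ 16)).
Proof.
move=> al Kv0 AV vV sr HA al1.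
have d3 : D ^+ 3 * r ^+ 24 <= Cd * r ^+ 20.
  have -> : D ^+ 3 * r ^+ 24 = D ^+ 3 * r * r ^+ 23 by ring.
  by apply: ler_pM => //; [apply: mulr_ge0; [exact: exprn_ge0|exact: ltW]|exact: ltW|exact: rX].
have d3s : D ^+ 3 * s ^+ 18 <= Cd * s ^+ 16.
  have -> : D ^+ 3 * s ^+ 18 = D ^+ 3 * s ^+ 2 * s ^+ 16 by ring.
  rewrite ler_pM2r//; apply: le_trans Dr; rewrite ler_wpM2l//; exact: exprn_ge0.
have V0 : 0 <= Kv * D by exact: mulr_ge0.
have K2 : 0 <= Kv ^+ 2 by exact: sqr_ge0.
have rs0 : 0 <= r ^+ 20 + s ^+ 16 by apply: addr_ge0; exact: ltW.
apply: (@case_bounded A (Kv * D) (12 * Kv ^+ 2 * Cd * (r ^+ 20 + s ^+ 16))) => //.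
- by apply: mulr_ge0 => //; apply: mulr_ge0 => //; apply: mulr_ge0.
- by apply: le_trans AV; rewrite lerD2l.
- by apply: le_trans vV; rewrite ler_pM2l// !lerD2l.
- move=> n nn1 HB HV x.
  have s50 : 0 < 5 * t1 by rewrite mulr_gt0.
  apply: (le_trans (early_bound t0 h0 (sv0_bound n HA) HV HB N0 V0 V0 s50 (early_time nn1) x)).
  rewrite lerD2l -/D.
  apply: (@le_trans _ _ (4 * (D * (Kv * D * (Kv * D))) * (3 * (r ^+ 24 + s ^+ 18)))).
    rewrite ler_wpM2l ?sqrt_start//; apply: mulr_ge0 => //; apply: mulr_ge0 => //; exact: mulr_ge0.
  have -> : 4 * (D * (Kv * D * (Kv * D))) * (3 * (r ^+ 24 + s ^+ 18)) =
    12 * Kv ^+ 2 * (D ^+ 3 * r ^+ 24 + D ^+ 3 * s ^+ 18) by ring.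
  rewrite -[leRHS]mulrA ler_wpM2l//; first exact: mulr_ge0.
  by rewrite mulrDr; exact: lerD.
have e1 : 8 * s ^+ 22 * (Kv * D) ^+ 2 * C <= 8 * Kv ^+ 2 * C * Cd * s ^+ 16.
  have -> : 8 * s ^+ 22 * (Kv * D) ^+ 2 * C = 8 * Kv ^+ 2 * C * (D ^+ 2 * s ^+ 22) by ring.
  rewrite -[leRHS]mulrA ler_wpM2l//.
    by apply: mulr_ge0 (ltW C0); exact: mulr_ge0.
  apply: le_trans d3s; apply: ler_pM => //; [exact: exprn_ge0|exact: ltW|exact: ler_weXn2l|exact: sX].
have e2 : 0 <= 8 * Kv ^+ 2 * C * Cd * r ^+ 20.
  by apply: mulr_ge0 (ltW (rX0 _)); apply: mulr_ge0 => //; apply: mulr_ge0 (ltW C0); exact: mulr_ge0.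
have e3 : 0 <= C * C1 * s ^+ 16 by apply: mulr_ge0 (ltW (sX0 _)); apply: mulr_ge0; exact: ltW.
rewrite /al; move: e1 e2 e3.
move: (8 * s ^+ 22 * _ * C) (8 * Kv ^+ 2 * C * Cd) (12 * Kv ^+ 2 * Cd) (C * C1) (r ^+ 20) (s ^+ 16) => y z u v p q.
by move=> e1 e2 e3; lra.
Qed.

Hypothesis rs2 : r <= s ^+ 2.

Let rs_pow m : r ^+ m <= s ^+ (2 * m).
Proof. by rewrite exprM; apply: lerXn2r; rewrite ?nnegrE; [exact: ltW|exact/ltW/sX0|]. Qed.

(** The early phase has at most [10 * s ^ (-4)] steps, since [t1 <= 2 * s ^+ 36] and
    [tau = s ^+ 40]. Each costs [(1 + D) * r ^+ 20]; one power of [r] pays for [D] and the remaining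
    [r ^+ 19] is at most [s ^+ 38]. *)
Lemma tail_count n : (n <= n1)%N -> n%:R * ((1 + D) / Num.sqrt N%:R) <= 20 * Cd * s ^+ 34.
Proof.
move=> nn1.
have q : (Num.sqrt N%:R)^-1 = r ^+ 20.
  have -> : N%:R = ((r ^+ 20)^-1) ^+ 2 :> R.
    by apply: (mulIf (lt0r_neq0 (rX0 40))); rewrite NE exprVn -exprM mulVf// lt0r_neq0.
  by rewrite sqrtr_sqr normrV ?unitfE ?lt0r_neq0// gtr0_norm// invrK.
have tl : t1 <= 2 * s ^+ 36.
  rewrite /t1; have : r ^+ 48 <= s ^+ 36 by apply: le_trans (rs_pow 48) _; exact: sX.
  by move: (r ^+ 48) (s ^+ 36) => x y h; lra.
have ns : n%:R * s ^+ 4 <= 10.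
  rewrite -(ler_pM2r (sX0 36)) -mulrA -exprD -[(4 + 36)%N]/40%N -tauE.
  by apply: (le_trans (early_time nn1)); move: tl; move: (s ^+ 36) => y h; lra.
have Dr20 : (1 + D) * r ^+ 20 <= 2 * Cd * s ^+ 38.
  apply: (@le_trans _ _ (2 * (D ^+ 3 * r) * r ^+ 19)).
    have -> : 2 * (D ^+ 3 * r) * r ^+ 19 = (2 * D ^+ 3) * r ^+ 20 by ring.
    rewrite ler_pM2r//; have : D <= D ^+ 3 by rewrite -[leLHS]expr1 ler_weXn2l.
    by move: D1; move: D (D ^+ 3) => x y h1 h2; lra.
  rewrite -[leLHS](mulrA 2) -[leRHS](mulrA 2) ler_pM2l//; apply: ler_pM => //.
  - by apply: mulr_ge0; [exact: exprn_ge0|exact: ltW].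
  - exact: ltW.
rewrite q; apply: (@le_trans _ _ (n%:R * (2 * Cd * s ^+ 38))); first by rewrite ler_wpM2l.
have -> : n%:R * (2 * Cd * s ^+ 38) = (n%:R * s ^+ 4) * (2 * Cd * s ^+ 34) by ring.
have -> : 20 * Cd * s ^+ 34 = 10 * (2 * Cd * s ^+ 34) by ring.
by rewrite ler_wpM2r//; apply: mulr_ge0 (ltW (sX0 _)); exact: mulr_ge0.
Qed.

Lemma sqrt_start_small : Num.sqrt (5 * t1) <= 6 * s ^+ 18.
Proof.
apply: (le_trans sqrt_start); have : r ^+ 24 <= s ^+ 18 by apply: le_trans (rs_pow 24) _; exact: sX.
by move: (r ^+ 24) (s ^+ 18) => x y h; lra.
Qed.

Lemma early_small n (A V B : R) : (n <= n1)%N ->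
  (forall x, `|tp N (iter n (sv tau) (trunc N c0)) x| <= A) ->
  (forall m, (m < n)%N -> velb m V) -> (forall m, (m < n)%N -> supb m B) -> 0 <= V -> 0 <= B ->
  supb n (A + V * B * (24 * s ^+ 18 + 720 * Cd * s ^+ 34)).
Proof.
move=> nn1 HA HV HB V0 B0 x.
have s50 : 0 < 5 * t1 by rewrite mulr_gt0.
apply: (le_trans (early_bound_tail t0 h0 HA HV HB N0 V0 B0 s50 (early_time nn1) x)).
rewrite -addrA lerD2l -/D [leRHS]mulrDr; apply: lerD.
  have -> : V * B * (24 * s ^+ 18) = 4 * (V * B) * (6 * s ^+ 18) by ring.
  by rewrite ler_wpM2l ?sqrt_start_small//; apply: mulr_ge0 => //; exact: mulr_ge0.
have -> : n%:R * (36 * (V * B * (1 + D)) / Num.sqrt N%:R) = 36 * (V * B) * (n%:R * ((1 + D) / Num.sqrt N%:R)) by ring.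
have -> : V * B * (720 * Cd * s ^+ 34) = 36 * (V * B) * (20 * Cd * s ^+ 34) by ring.
by rewrite ler_wpM2l ?tail_count//; apply: mulr_ge0 => //; exact: mulr_ge0.
Qed.

Lemma case_small (A K : R) :
  let al := 24 * K ^+ 2 + 720 * K ^+ 2 * Cd + 8 * K ^+ 2 * C + C * C1 in
  0 <= K -> A + 1 <= K -> 2 * (7 * eb + (A + 1)) <= K -> supb 0 A ->
  al * (r ^+ 20 + s ^+ 16) <= 1 -> forall n, supb n (A + al * (r ^+ 20 + s ^+ 16)).
Proof.
move=> al K0 AV vV HA al1.
have K2 : 0 <= K ^+ 2 by exact: sqr_ge0.
have a1 := mulr_ge0 (ler0n R 24) K2.
have a2 := mulr_ge0 (mulr_ge0 (ler0n R 720) K2) Cd0.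
have a3 := mulr_ge0 (mulr_ge0 (ler0n R 8) K2) (ltW C0).
have e18 := dist (x := 18) (y := 16) a1 isT.
have e34 := dist (x := 34) (y := 16) a2 isT.
have e22 := dist (x := 22) (y := 16) a3 isT.
have al0 := addr_ge0 (addr_ge0 a1 a2) a3.
apply: (@case_bounded A K ((24 * K ^+ 2 + 720 * K ^+ 2 * Cd) * s ^+ 16)).
- exact: K0.
- exact: mulr_ge0 (addr_ge0 a1 a2) (ltW (sX0 _)).
- by apply: le_trans AV; rewrite lerD2l.
- by apply: le_trans vV; rewrite ler_pM2l// !lerD2l.
- move=> n nn1 HB HV x.
  apply: (le_trans (early_small nn1 (sv0_bound n HA) HV HB K0 K0 x)).
  rewrite lerD2l; move: e18 e34; rewrite -expr2.
  by move: (K ^+ 2) (s ^+ 18) (s ^+ 34) (s ^+ 16) => p x1 x2 x3 h1 h2; lra.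
have e3 : 0 <= C * C1 * s ^+ 16 by apply: mulr_ge0 (ltW (sX0 _)); apply: mulr_ge0; exact: ltW.
have e4 := mulr_ge0 al0 (ltW (rX0 20)).
rewrite /al; move: e22 e3 e4.
move: (C * C1) (K ^+ 2) (s ^+ 22) (s ^+ 16) (r ^+ 20) => v p y z u h1 h2 h3; lra.
Qed.

Variables (M V0 : R).
Hypotheses (M0 : 0 <= M) (HV0 : velb 0 V0) (V00 : 0 <= V0).
Hypothesis S0 : forall x, `|tp N (sv tau (trunc N c0)) x| <= 8 * M.
Hypothesis smooth : forall n, (0 < n)%N -> tau * UU N (a n) ^+ 4 <= C.

(* For [N > tau ^ -2] and a large initial supremum, the first resolvent already
   brings the solution down to [8 * M] plus an error of at most [A / 2]. *)
Lemma case_large (A : R) : (24 + 720 * Cd) * (C1 + V0) * s <= 2^-1 ->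
  16 * M + 16 * (C1 ^+ 2 * C) + 2 * (C * C1) <= A -> supb 0 A -> forall n, supb n A.
Proof.
move=> sm Al HA.
pose Cv := C1 + V0; have Cv0 : 0 <= Cv by apply: addr_ge0 => //; exact: ltW.
have CC0 : 0 <= C * C1 by apply: mulr_ge0; exact: ltW.
have CCC0 : 0 <= C1 ^+ 2 * C by apply: mulr_ge0 (ltW C0); exact: sqr_ge0.
have A0 : 0 <= A by apply: le_trans Al; move: CC0 CCC0 M0; move: (C * C1) (C1 ^+ 2 * C) => x y; lra.
(* [s ^+ 10] is [tau ^ (1/4)]. This velocity bound comes from the energy, and at step 0 from [V0],
   and not from [A]; the early error is therefore linear in [A], and a small [s] makes it at most
   [A / 2]. *)
have vel m : velb m (Cv / s ^+ 10).
  move=> j x; case: m => [|m].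
    apply: (le_trans (HV0 j x)); rewrite ler_pdivlMr//.
    apply: (@le_trans _ _ (V0 * 1)); last by rewrite mulr1 /Cv lerDr ltW.
    by rewrite ler_wpM2l// exprn_ile1// ltW.
  apply: (le_trans (velocity_le_UU _ _ _ _)).
  apply: (le_trans (UU_scaled (sX0 10) _ (smooth (ltn0Sn m)))); first by rewrite -exprM -tauE.
  by rewrite ler_pM2r ?invr_gt0// /Cv lerDl.
have early n : (0 < n)%N -> (n <= n1)%N -> (forall m, (m < n)%N -> supb m A) -> supb n (8 * M + A / 2).
  move=> n00 nn1 H x.
  have Sn := iter_sv_bound t0 (n00 : (1 <= n)%N) S0.
  have vm m : (m < n)%N -> velb m (Cv / s ^+ 10) by move=> _; exact: vel.
  have Vp : 0 <= Cv / s ^+ 10 by apply: divr_ge0 => //; exact: ltW.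
  apply: (le_trans (early_small nn1 Sn vm H Vp A0 x)); rewrite lerD2l.
  have -> : Cv / s ^+ 10 * A * (24 * s ^+ 18 + 720 * Cd * s ^+ 34) = A * (Cv * (24 * s ^+ 8 + 720 * Cd * s ^+ 24)).
    by field; rewrite lt0r_neq0.
  rewrite ler_wpM2l//; apply: le_trans sm; rewrite -/Cv.
  have -> : (24 + 720 * Cd) * Cv * s = Cv * (24 * s ^+ 1 + 720 * Cd * s ^+ 1) by ring.
  apply: (ler_wpM2l Cv0); apply: lerD; apply: ler_wpM2l.
  - exact: ler0n.
  - exact: sX.
  - exact: mulr_ge0 (ler0n _ _) Cd0.
  - exact: sX.
have half : 8 * M + A / 2 <= A.
  by move: Al CC0 CCC0; move: (C * C1) (C1 ^+ 2 * C) => x y; lra.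
apply: (@two_phase A (C1 / s ^+ 9) (8 * M + A / 2)).
- by apply: divr_ge0; exact: ltW.
- move=> [|n] nn1 H x; first exact: HA.
  exact: le_trans (early n.+1 isT nn1 H x) half.
- exact: early.
- move=> n n1n _ j x; apply: (le_trans (velocity_le_UU _ _ _ _)).
  have [_ _ h] := late (leq_trans (isT : (4 <= n1)%N) n1n).
  apply: (UU_scaled (sX0 9) _ h); rewrite -exprM.
  apply: (@le_trans _ _ t1); first by rewrite /t1 lerDr ltW.
  apply: (le_trans start_le); rewrite ler_pM2r// ler_nat.
  by apply: leq_trans n1n; exact: leq_pred.
have -> : 8 * s ^+ 22 * (C1 / s ^+ 9) ^+ 2 * C = 8 * (C1 ^+ 2 * C) * s ^+ 4.
  by field; rewrite lt0r_neq0.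
have s4 : s ^+ 4 <= 1 by apply: exprn_ile1 => //; exact: ltW.
have r20 : r ^+ 20 <= 1 by apply: exprn_ile1 => //; exact: ltW.
have e1 := ler_wpM2l (mulr_ge0 (ler0n R 8) CCC0) s4.
have e2 := ler_wpM2l CC0 r20.
move: e1 e2 Al CC0 CCC0.
by move: (C1 ^+ 2 * C) (C * C1) (s ^+ 4) (r ^+ 20) => p q y z; lra.
Qed.

End Phases.

(** * Choice of constants and assembly of the cases *)

Section Assembly.
Context {R : realType}.

Lemma harm_ge0 n : 0 <= harm n :> R.
Proof. by rewrite /harm sumr_ge0// => i _; rewrite invr_ge0. Qed.

Lemma harm_le n : harm n.+2 <= 1 + ln n.+1%:R :> R.
Proof.
elim: n => [|n IH]; first by rewrite /harm big_nat1 ln1 addr0 invr1.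
have {IH} : harm n.+3 <= 1 + ln n.+1%:R + n.+2%:R^-1 :> R.
  by rewrite /harm big_nat_recr//= lerD2r.
move=> /le_trans -> //; rewrite -addrA lerD2l -lerBrDl.
have p1 : 0 < n.+1%:R :> R by rewrite ltr0n.
have p2 : 0 < n.+2%:R :> R by rewrite ltr0n.
rewrite -opprB -ln_div ?posrE// lerNr.
have -> : n.+1%:R / n.+2%:R = 1 + - n.+2%:R^-1 :> R.
  by move: (lt0r_neq0 p2); rewrite -[n.+2%:R]natr1; move: (n.+1%:R : R) => x x0; field.
apply: le_ln1Dx; rewrite ltrN2 invf_lt1// ltr1n//.
Qed.

Lemma dir_const_ge1 N : 1 <= dir_const N :> R.
Proof.
have h : 1 <= 1 + 2 * harm (4 * N).+1 :> R by rewrite lerDl mulr_ge0 ?harm_ge0.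
by rewrite /dir_const exprn_ege1.
Qed.

(** Here [dir_const N ^+ 3] is a sixth power and [240 = 6 * 40], so it suffices to bound its base by
    [480 * expR y] with [y = ln N / 240]. The base is at most [1 + 2 * (1 + 3 + 240 * y)], which is
    below [480 * (1 + y)]. *)
Lemma dir_const_growth N : (0 < N)%N ->
  dir_const N ^+ 3 * expR (- ln N%:R / 40) <= 480 ^+ 6 :> R.
Proof.
move=> N0; have n0 : 0 < N%:R :> R by rewrite ltr0n.
pose y : R := ln N%:R / 240.
have y0 : 0 <= y by apply: divr_ge0; [apply: ln_ge0; rewrite ler1n|exact: ler0n].
have h : 1 + 2 * harm (4 * N).+1 <= 480 * expR y.
  have -> : (4 * N).+1 = (4 * N).-1.+2 by lia.
  have := harm_le (4 * N).-1; have -> : (4 * N).-1.+1 = (4 * N)%N by lia.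
  rewrite natrM lnM ?posrE// => h.
  have l4 : ln 4 <= 3 :> R.
    by have := @le_ln1Dx R 3; rewrite (_ : 1 + 3 = 4 :> R); [apply; lra|ring].
  have e1 := expR_ge1Dx y.
  have : ln N%:R = 240 * y by rewrite /y mulrC divfK ?pnatr_eq0.
  by move: h l4 e1; move: (harm _) (ln _) (ln _) (expR y) => p q u v; lra.
have -> : expR (- ln N%:R / 40) = (expR y ^+ 6)^-1 :> R.
  by rewrite -expRM_natl -expRN; congr expR; rewrite /y; lra.
rewrite ler_pdivrMr ?exprn_gt0 ?expR_gt0// /dir_const -exprM -exprMn.
apply: lerXn2r; rewrite ?nnegrE.
- exact: addr_ge0 ler01 (mulr_ge0 (ler0n R 2) (harm_ge0 _)).
- exact: mulr_ge0 (ler0n R 480) (expR_ge0 y).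
- exact: h.
Qed.

Lemma trajectory_rs (M Cd : R) : 0 <= M -> 0 <= Cd -> exists s0 al : R, [/\ 0 < s0, 0 < al &
  forall N s r (c0 F : int * int -> R[i]) A, 0 < s -> s < s0 -> 0 < r -> r <= 1 ->
    (0 < N)%N -> N%:R * r ^+ 40 = 1 -> dir_const N ^+ 3 * r <= Cd ->
    herm c0 -> c0 0 = 0 -> herm F -> supp (3 * N) F -> (forall x, `|tp (3 * N) F x| <= M) ->
    (forall k, k \in box N -> F k = c0 k) -> supb (s ^+ 40) N c0 0 A ->
    forall n, supb (s ^+ 40) N c0 n (A + al * (r ^+ 20 + s ^+ 16))].
Proof.
move=> M0 Cd0.
have half_sum (B u v : R) : u * (2 * B) <= 1 -> v * (2 * B) <= 1 -> B * (u + v) <= 1 by lra.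
pose V0 : R := 16 * M + 36 * M * Cd.
have V00 : 0 <= V0 := addr_ge0 (mulr_ge0 (ler0n R 16) M0) (mulr_ge0 (mulr_ge0 (ler0n R 36) M0) Cd0).
pose e : R := M ^+ 2 * (1 + 2 * V0 ^+ 2) + 1.
have q0 : 0 <= 1 + 2 * V0 ^+ 2 by apply: addr_ge0 => //; apply: mulr_ge0 => //; exact: sqr_ge0.
have e1 : 1 <= e by rewrite /e lerDr; apply: mulr_ge0 => //; exact: sqr_ge0.
have e0 : 0 <= e by exact: le_trans e1.
have E0 : 0 <= 2 * e by exact: mulr_ge0.
have [C C0 HC] := late_estimates E0.
(* A bound for the L2 norm without a root: [eb ^+ 2] exceeds the energy bound [2 * e]. *)
pose eb : R := 1 + 2 * e.
have eb0 : 0 <= eb by exact: addr_ge0.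
have Eeb : 2 * e <= eb ^+ 2 by rewrite /eb; nra.
pose Kv : R := 2 * (7 * eb + 1 + M).
have Kv0 : 0 <= Kv by rewrite /Kv; lra.
have CC0 : 0 <= C * (1 + C) by apply: mulr_ge0; lra.
have CCC0 : 0 <= (1 + C) ^+ 2 * C by apply: mulr_ge0 (sqr_ge0 _) _; exact: ltW.
pose KA : R := 16 * M + 16 * ((1 + C) ^+ 2 * C) + 2 * (C * (1 + C)).
have KA0 : 0 <= KA by rewrite /KA; lra.
pose Kc : R := 2 * (7 * eb + (KA + 1)).
have Kc0 : 0 <= Kc by rewrite /Kc; lra.
pose alB : R := 12 * Kv ^+ 2 * Cd + 8 * Kv ^+ 2 * C * Cd + C * (1 + C).
pose alC : R := 24 * Kc ^+ 2 + 720 * Kc ^+ 2 * Cd + 8 * Kc ^+ 2 * C + C * (1 + C).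
have Kv2 : 0 <= Kv ^+ 2 by exact: sqr_ge0.
have Kc2 : 0 <= Kc ^+ 2 by exact: sqr_ge0.
have C0' := ltW C0.
have alB0 : 0 <= alB.
  exact: addr_ge0 (addr_ge0 (mulr_ge0 (mulr_ge0 (ler0n R 12) Kv2) Cd0)
    (mulr_ge0 (mulr_ge0 (mulr_ge0 (ler0n R 8) Kv2) C0') Cd0)) CC0.
have alC0 : 0 <= alC.
  exact: addr_ge0 (addr_ge0 (addr_ge0 (mulr_ge0 (ler0n R 24) Kc2)
    (mulr_ge0 (mulr_ge0 (ler0n R 720) Kc2) Cd0)) (mulr_ge0 (mulr_ge0 (ler0n R 8) Kc2) C0')) CC0.
(* With [s * z <= 1] and [r * z <= 1], both [alB * (r + s)] and [alC * (r + s)] are at most 1, the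
   smallness that the bounded cases ask for. *)
pose z : R := 2 * (alB + alC + 1).
have z0 : 1 <= z by rewrite /z; lra.
have zB : 2 * alB <= z by rewrite /z; lra.
have zC : 2 * alC <= z by rewrite /z; lra.
have zp : 0 < z by exact: lt_le_trans z0.
have z60 : 0 <= 3 * eb * z ^+ 60 := mulr_ge0 (mulr_ge0 (ler0n R 3) eb0) (exprn_ge0 60 (ltW zp)).
pose y : R := (24 + 720 * Cd) * (1 + C + V0).
have y0 : 0 <= y := mulr_ge0 (addr_ge0 (ler0n R 24) (mulr_ge0 (ler0n R 720) Cd0)) (addr_ge0 (addr_ge0 ler01 C0') V00).
have e49 : 0 <= (49 * e) ^+ 2 by exact: sqr_ge0.
pose x0 : R := 1 + z + 2 * y + (49 * e) ^+ 2.
have [x1 [xz [xy xe]]] : 1 <= x0 /\ z <= x0 /\ 2 * y <= x0 /\ (49 * e) ^+ 2 <= x0.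
  rewrite /x0; clear x0; move: zp y0 e49; clear z60 z0 zB zC; move: z y ((49 * e) ^+ 2) => u v w; clear.
  by move=> u0 v0 w0; do !split; lra.
have x0p : 0 < x0 by exact: lt_le_trans x1.
exists x0^-1, (alB + alC + 3 * eb * z ^+ 60 + 1); split.
- by rewrite invr_gt0.
- by move: alB0 alC0 z60; clear; lra.
move=> N s r c0 F A s0 ss r0 r1 N0 NE Dr h0 c00 hF sF HM Fc HA0 n.
have sx : s * x0 <= 1 by rewrite -ler_pdivlMr// mul1r ltW.
have sy w : 0 <= w -> w <= x0 -> s * w <= 1.
  by move=> w0 wx; apply: le_trans sx; rewrite ler_pM2l.
have s1 : s <= 1 by have := sy 1 ler01; rewrite mulr1; apply; exact: x1.
have sz : s * z <= 1 by apply: sy; [exact: ltW|exact: xz].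
have sY : s * (2 * y) <= 1 by apply: sy; [exact: mulr_ge0|exact: xy].
have se : s * (49 * e) ^+ 2 <= 1 by apply: sy; [exact: e49|exact: xe].
have sp m : 0 < s ^+ m by exact: exprn_gt0.
have rp m : 0 < r ^+ m by exact: exprn_gt0.
have sm m : (0 < m)%N -> s ^+ m <= s by move=> m0; rewrite -[leRHS]expr1; apply: ler_wiXn2l => //; exact: ltW.
have rm m : (0 < m)%N -> r ^+ m <= r by move=> m0; rewrite -[leRHS]expr1; apply: ler_wiXn2l => //; exact: ltW.
have s401 : s ^+ 40 <= 1 by apply: le_trans s1; exact: sm.
set tau := s ^+ 40.
have t0 : 0 < tau by exact: sp.
have D1 := dir_const_ge1 N.
have D0 : 0 <= dir_const N :> R by exact: le_trans D1.
have n0 : 0 < N%:R :> R by rewrite ltr0n.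
have D3 : dir_const N * r <= Cd.
  apply: le_trans Dr; rewrite ler_pM2r// -[leLHS]expr1; exact: ler_weXn2l.
have q : (Num.sqrt N%:R)^-1 = r ^+ 20.
  have -> : N%:R = ((r ^+ 20)^-1) ^+ 2 :> R.
    by apply: (mulIf (lt0r_neq0 (rp 40))); rewrite NE exprVn -exprM mulVf// lt0r_neq0.
  by rewrite sqrtr_sqr normrV ?unitfE ?lt0r_neq0// gtr0_norm// invrK.
have HV : velb tau N c0 0 V0.
  move=> j x; apply: (le_trans (initial_velocity N0 hF sF HM Fc c00 j x)); rewrite q /V0 lerD2l.
  have h : (1 + dir_const N) * r ^+ 20 <= 2 * Cd.
    apply: (@le_trans _ _ ((1 + dir_const N) * r)); first by rewrite ler_wpM2l ?rm// addr_ge0.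
    apply: (@le_trans _ _ (2 * (dir_const N * r))); last by rewrite ler_pM2l.
    by rewrite mulrA ler_pM2r//; move: D1; clear; lra.
  have -> : 18 * (M * (1 + dir_const N)) * r ^+ 20 = 18 * M * ((1 + dir_const N) * r ^+ 20) by ring.
  have -> : 36 * M * Cd = 18 * M * (2 * Cd) by ring.
  by rewrite ler_wpM2l ?mulr_ge0.
have X0 := initial_energy hF sF HM Fc.
have dyn : dynamics N tau (fun n k => cmod (traj tau N c0 n k)) (2 * e).
  apply: (@dynamics_traj _ _ _ _ V0 e) => //.
    apply: (@le_trans _ _ (M ^+ 2 * (1 + 2 * V0 ^+ 2))); last by rewrite /e lerDl.
    apply: ler_pM => //; first exact: XX_ge0.
      apply: addr_ge0 => //; apply: mulr_ge0 (sqr_ge0 _); apply: mulr_ge0 => //; exact: ltW.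
    by rewrite lerD2l ler_wpM2r ?sqr_ge0//; move: s401; rewrite -/tau; clear; lra.
  by apply: le_trans se; rewrite ler_wpM2r// sm.
have [smooth late] := HC N tau _ dyn N0.
have Xeb m : XX N 0 (fun k => cmod (traj tau N c0 m k)) <= eb ^+ 2.
  apply: le_trans Eeb; have [_ [_ Xm _]] := dyn.
  case: m => [|m]; last exact: Xm.
  apply: (le_trans X0); have : M ^+ 2 * 1 <= M ^+ 2 * (1 + 2 * V0 ^+ 2).
    by rewrite ler_wpM2l ?sqr_ge0// lerDl mulr_ge0 ?sqr_ge0.
  rewrite mulr1 => h; apply: (le_trans h); apply: (@le_trans _ _ e); first by rewrite /e lerDl.
  by rewrite mulr2n mulrDl mul1r lerDl.
have Hvel m B : supb tau N c0 m B -> velb tau N c0 m (2 * (7 * eb + B)).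
  by move=> HB j x; apply: velocity_le_sup => //; rewrite traj_mean.
(* [A] is an arbitrary bound of the initial vorticity and may be too large; the minimum also stays
   below the truncation bound, so that [A' + 1 <= Kv * D] in the moderate case. *)
pose A' := Num.min A (dir_const N * M).
have HA : supb tau N c0 0 A'.
  move=> x; rewrite /A' le_min HA0/=; exact: (initial_sup HM Fc x).
have A'0 : 0 <= A' by exact: le_trans (HA (0, 0)).
have A'D : A' <= dir_const N * M by rewrite /A' ge_min lexx orbT.
have A'A : A' <= A by rewrite /A' ge_min lexx.
have rs0 : 0 <= r ^+ 20 + s ^+ 16 by apply: addr_ge0; exact: ltW.
have fin B : 0 <= B -> B <= alB + alC + 3 * eb * z ^+ 60 + 1 ->
    supb tau N c0 n (A' + B * (r ^+ 20 + s ^+ 16)) ->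
    supb tau N c0 n (A + (alB + alC + 3 * eb * z ^+ 60 + 1) * (r ^+ 20 + s ^+ 16)).
  by move=> B0 BB H x; apply: (le_trans (H x)); apply: lerD => //; rewrite ler_wpM2r.
(* If [r * z > 1] then [N < z ^ 40]: energy and the number of modes bound the supremum by a
   constant, and [r ^+ 20] is bounded below, so the error term alone covers it. *)
have [rz|/ltW rz] := leP (r * z) 1; last first.
  apply: (fin (3 * eb * z ^+ 60)) => //; first by move: alB0 alC0; clear; lra.
  move=> x; apply: (le_trans (tp_bound _ _ _)).
  apply: (@le_trans _ _ ((N.*2.+1)%:R * eb)).
    apply: sum_cmod_le => //; apply: le_trans (Xeb n).
    by rewrite le_eqVlt; apply/orP; left; apply/eqP/eq_bigr => k _; rewrite expr0 mul1r.
  apply: (@le_trans _ _ (3 * N%:R * eb)).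
    by rewrite ler_wpM2r// -natrM ler_nat; move: N0; clear; lia.
  apply: (@le_trans _ _ (3 * eb * z ^+ 60 * r ^+ 20)); last first.
    by rewrite -[leLHS]add0r; apply: lerD => //; rewrite ler_wpM2l// lerDl ltW.
  have -> : 3 * N%:R * eb = 3 * eb * N%:R by ring.
  rewrite -[leRHS]mulrA; apply: (ler_wpM2l (mulr_ge0 (ler0n R 3) eb0)).
  rewrite -(ler_pM2r (rp 40)) NE.
  have -> : z ^+ 60 * r ^+ 20 * r ^+ 40 = (r * z) ^+ 60 by ring.
  by rewrite exprn_ege1.
have small B : 0 <= B -> 2 * B <= z -> B * (r ^+ 20 + s ^+ 16) <= 1.
  move=> B0 Bz; apply: (@le_trans _ _ (B * (r + s))).
    by rewrite ler_wpM2l// lerD// ?rm ?sm.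
  apply: half_sum; [apply: le_trans rz|apply: le_trans sz]; by rewrite ler_pM2l.
have [sr|/ltW rs] := leP (s ^+ 2) r.
  apply: (fin alB) => //; first by move: alC0 z60; clear; lra.
  have A1 : A' + 1 <= (M + 1) * dir_const N.
    by rewrite mulrDl mul1r mulrC lerD// mulrC.
  apply: (case_moderate t0 h0 N0 C0 late s0 s1 r0 r1 (erefl _) NE D1 Dr Hvel Kv0 _ _ sr HA).
  - apply: (le_trans A1); rewrite ler_wpM2r// /Kv; move: eb0 M0; clear; lra.
  - have : 7 * eb * 1 <= 7 * eb * dir_const N by rewrite ler_wpM2l ?mulr_ge0.
    move: A1; rewrite /Kv; move: (dir_const N) => d; clear; lra.
  - exact: (small alB alB0 zB).
have [AK|/ltW AK] := leP A' KA.
  apply: (fin alC) => //; first by move: alB0 z60; clear; lra.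
  apply: (case_small t0 h0 N0 C0 late s0 s1 r0 (erefl _) NE D1 Dr Hvel rs Kc0 _ _ HA).
  - rewrite /Kc; move: AK eb0 KA0; clear; lra.
  - rewrite /Kc; move: AK; clear; lra.
  - exact: (small alC alC0 zC).
apply: (fin 0) => //; first by move: alB0 alC0 z60; clear; lra.
rewrite mul0r addr0.
apply: (case_large t0 h0 N0 C0 late s0 s1 r0 r1 (erefl _) NE D1 Dr rs M0 HV V00 _ smooth _ AK HA).
- move=> x; apply: (initial_resolvent N0 hF sF HM Fc); first exact: t0.
  rewrite -(ler_pM2r (rp 40)) -mulrA NE mulr1 mul1r /tau.
  apply: lerXn2r; rewrite ?nnegrE; [exact: ltW|exact: ltW|].
  by apply: (le_trans rs); exact: sm.
- rewrite -/y; move: sY; rewrite mulrCA [s * y]mulrC -ler_pdivlMl ?ltr0n// mulr1; exact.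
Qed.

Lemma trajectory_bound (M : R) : 0 <= M -> exists tau0 al : R, [/\ 0 < tau0, 0 < al &
  forall N tau (c0 F : int * int -> R[i]) A, 0 < tau -> tau < tau0 -> (0 < N)%N ->
    herm c0 -> c0 0 = 0 -> herm F -> supp (3 * N) F -> (forall x, `|tp (3 * N) F x| <= M) ->
    (forall k, k \in box N -> F k = c0 k) -> supb tau N c0 0 A ->
    forall n, supb tau N c0 n (A + (al * N%:R `^ (- 2^-1) + al * tau `^ (4 / 10)))].
Proof.
move=> M0.
have Cd0 : 0 <= 480 ^+ 6 :> R := exprn_ge0 6 (ler0n R 480).
have [s0 [al [s00 al0 H]]] := trajectory_rs M0 Cd0.
exists (s0 ^+ 40), al; split => //; first exact: exprn_gt0.
move=> N tau c0 F A t0 ts N0 h0 c00 hF sF HM Fc HA n.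
have n0 : 0 < N%:R :> R by rewrite ltr0n.
(* Forty is a common denominator of the exponents 1/2, 2/5, 9/10 and 6/5; the smallest unit,
   [N ^ (-1/40)], absorbs the logarithms. *)
pose s : R := expR (ln tau / 40); pose r : R := expR (- ln N%:R / 40).
have tE : tau = s ^+ 40 by rewrite /s -expRM_natl mulrC divfK// lnK.
have NE : N%:R * r ^+ 40 = 1.
  by rewrite /r -expRM_natl mulrC mulrC mulrCA divff// mulr1 expRN lnK// mulfV// lt0r_neq0.
have rE : N%:R `^ (- 2^-1) = r ^+ 20.
  rewrite /powR gt_eqF// /r -expRM_natl; congr expR; lra.
have sE : tau `^ (4 / 10) = s ^+ 16.
  rewrite /powR gt_eqF// /s -expRM_natl; congr expR; lra.
rewrite rE sE -mulrDr; rewrite tE in HA *.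
apply: (H N s r c0 F A) => //.
- exact: expR_gt0.
- by move: ts; rewrite tE ltr_pXn2r// nnegrE ltW// expR_gt0.
- exact: expR_gt0.
- rewrite /r -[leRHS]expR0 ler_expR mulNr oppr_le0; apply: divr_ge0; last exact: ler0n.
  by apply: ln_ge0; rewrite ler1n.
- exact: dir_const_growth.
Qed.

End Assembly.

Theorem theorem1p13 (R : realType) (M : R) :
  exists tau0 alpha1 alpha2 : R,
    [/\ 0 < tau0, 0 < alpha1, 0 < alpha2 &
      forall f : R * R -> R,
        torus_Linfty f -> mean_zero f -> Linfty_norm f = M%:E ->
      forall (tau : R) (N : nat) (w : nat -> R * R -> R),
        0 < tau -> tau < tau0 -> (2 <= N)%N ->
        scheme_solution tau N f w ->
        (ereal_sup (range (fun n : nat => Linfty_norm (w n)))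
         <= Linfty_norm (w 0%N)
            + (alpha1 * N%:R `^ (- 2^-1) + alpha2 * tau `^ (4 / 10))%:E)%E].
Proof.
(* [M] is an arbitrary real at this point, whence the absolute value; 2 is the norm bound of the
   kernel in [vallee_poussin]. *)
have M0 : 0 <= 2 * `|M| by rewrite mulr_ge0.
have [tau0 [al [t00 al0 H]]] := trajectory_bound M0.
exists tau0, al, al; split => //.
move=> f fL mf fM tau N w t0 tt N2 Hw.
have N0 : (0 < N)%N by exact: leq_trans N2.
have wE := scheme_traj t0 mf Hw.
have aeM : {ae torus_measure, forall x, `|f x| <= `|M|}.
  have [Z [mZ Z0 ZM]] := Linfty_ae fM; exists Z; split => // x /= nx; apply: ZM => /= fx.
  by apply: nx; exact: le_trans fx (ler_norm M).
have [F [hF sF FE FB]] := vallee_poussin (Lfun_measurable fL) (normr_ge0 M) aeM N.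
apply: ge_ereal_sup => _ [n _ <-].
have p0 : 0 <= al * N%:R `^ (- 2^-1) + al * tau `^ (4 / 10).
  by apply: addr_ge0; apply: mulr_ge0; rewrite ?powR_ge0// ltW.
have := Lnorm_ge0 torus_measure +oo%E (EFin \o w 0%N); rewrite -[X in (_ <= X)%E]/(Linfty_norm (w 0%N)).
(* An infinite initial norm makes the right-hand side infinite, because the error term is finite. *)
case E : (Linfty_norm (w 0%N)) => [A||//] _; last by rewrite addye// leey.
rewrite -EFinD wE; apply: Linfty_norm_le.
apply: (H N tau (fourier_coef f) F A) => //.
- exact: fourier_coef_herm.
- exact: fourier_coef_mean0.
- move=> x; rewrite -wE; apply: Linfty_norm_ge E _; rewrite wE; [exact: tp_periodic|exact: tp_continuous].
Qed.
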